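(* Let $0<\varepsilon<1$ and $0<\sigma_0<2$. If $C>0$ is large enough, then with $b=C\log t$, as $t\to+\infty$, \[ U(t)=\frac{1}{2\pi i}\int_{-b-i\sigma_0}^{\,b-i\sigma_0} e^{ix\vartheta'(t)+i\frac{x^2}{2}\vartheta''(t)}\,\zeta\bigl(\tfrac12+i(t+x)\bigr)\,\frac{\pi}{2\sinh\frac{\pi x}{2}}\,dx+O\bigl(t^{-\frac74+\varepsilon}\bigr), \] the integral being over the horizontal segment from $-b-i\sigma_0$ to $b-i\sigma_0$.
   Context: $\vartheta$ is the Riemann–Siegel theta function: the holomorphic function on $\mathbb C\setminus(\{iy:y\ge\frac12\}\cup\{iy:y\le-\frac12\})$ with $\vartheta(0)=0$ and $e^{i\vartheta(t)}=\pi^{-it/2}\sqrt{\Gamma(\frac14+\frac{it}{2})/\Gamma(\frac14-\frac{it}{2})}$. $\zeta$ is the Riemann zeta function. For real $t$, \[ U(t)=\frac{1}{2\pi i}\int_{-i\sigma-\infty}^{-i\sigma+\infty} e^{i\vartheta(t+x)-i\vartheta(t)}\,\zeta\bigl(\tfrac12+i(t+x)\bigr)\,\frac{\pi}{2\sinh\frac{\pi x}{2}}\,dx,\qquad 0<\sigma<\tfrac12, \] which is independent of $\sigma\in(0,\frac12)$. *)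

(* Defs.v *)
From Stdlib Require Import Reals.
From Coquelicot Require Import Coquelicot.
Open Scope R_scope.

Definition Cexp (z : C) : C :=
  (exp (Re z) * cos (Im z), exp (Re z) * sin (Im z)).

(* principal argument in (-PI, PI] (value at 0 irrelevant) *)
Definition Carg (z : C) : R :=
  if Rle_dec 0 (Im z) then acos (Re z / Cmod z) else - acos (Re z / Cmod z).

Definition Clog (z : C) : C := (ln (Cmod z), Carg z).

Definition Cpow_pos (a : R) (s : C) : C := Cexp (Cmult s (RtoC (ln a))).

Definition Cseries (a : nat -> C) : C :=
  (Series (fun n => Re (a n)), Series (fun n => Im (a n))).

Definition euler_gamma : R :=
  Lim_seq (fun n => sum_f_R0 (fun k => / INR (S k)) n - ln (INR (S n))).

(** Principal branch of log Gamma on C \ (-oo,0] (Weierstrass product):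
    log Gamma(w) = - gamma w - log w + sum_{k>=1} (w/k - log(1 + w/k)). *)
Definition logGamma (w : C) : C :=
  Cminus (Cmult (RtoC (- euler_gamma)) w) (Clog w) +
  Cseries (fun n => let k := RtoC (INR (S n)) in
                    Cminus (Cdiv w k) (Clog (Cplus (RtoC 1) (Cdiv w k))))%C.

(** Riemann–Siegel theta function, holomorphic off the two imaginary half
    lines, theta(0)=0, e^{i theta(z)} = pi^{-iz/2} sqrt(Gamma(1/4+iz/2)/Gamma(1/4-iz/2)). *)
Definition RStheta (z : C) : C :=
  Cminus
    (Cdiv (Cminus (logGamma (Cplus (RtoC (1/4)) (Cmult (Cmult Ci z) (RtoC (1/2)))))
                  (logGamma (Cminus (RtoC (1/4)) (Cmult (Cmult Ci z) (RtoC (1/2))))))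
          (Cmult (RtoC 2) Ci))
    (Cmult z (RtoC (ln PI / 2))).

(** theta', theta'' at real t (theta is real-valued on the real axis). *)
Definition RStheta_real (t : R) : R := Re (RStheta (RtoC t)).
Definition dtheta (t : R) : R := Derive RStheta_real t.
Definition d2theta (t : R) : R := Derive_n RStheta_real 2 t.

(** Riemann zeta function for Re s > 0, s <> 1:
    zeta(s) = 1/(s-1) + sum_{n>=1} ( n^{-s} - ((n+1)^{1-s} - n^{1-s})/(1-s) ). *)
Definition zeta (s : C) : C :=
  Cplus (Cinv (Cminus s (RtoC 1)))
    (Cseries (fun m => let n := INR (S m) in
       Cminus (Cpow_pos n (Copp s))
              (Cdiv (Cminus (Cpow_pos (n + 1) (Cminus (RtoC 1) s))
                            (Cpow_pos n (Cminus (RtoC 1) s)))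
                    (Cminus (RtoC 1) s)))).

Definition Csinh (z : C) : C := Cdiv (Cminus (Cexp z) (Cexp (Copp z))) (RtoC 2).

Definition kernel (x : C) : C :=
  Cdiv (RtoC PI) (Cmult (RtoC 2) (Csinh (Cmult (RtoC (PI / 2)) x))).

Definition zeta_shift (t : R) (x : C) : C :=
  zeta (Cplus (RtoC (1/2)) (Cmult Ci (Cplus (RtoC t) x))).

(** U(t): the integral over the horizontal line Im x = -sigma, taking
    sigma = 1/4 (the value is independent of sigma in (0,1/2)). *)
Definition U_sigma (sigma t : R) : C :=
  Cdiv
    (@RInt_gen C_R_CompleteNormedModule (fun u : R =>
        let x := Cminus (RtoC u) (Cmult Ci (RtoC sigma)) in
        Cmult (Cmult (Cexp (Cmult Ci (Cminus (RStheta (Cplus (RtoC t) x))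
                                             (RStheta (RtoC t)))))
                     (zeta_shift t x))
              (kernel x))
       (Rbar_locally m_infty) (Rbar_locally p_infty))
    (Cmult (RtoC (2 * PI)) Ci).

Definition U (t : R) : C := U_sigma (1/4) t.

Definition V_approx (sigma0 b t : R) : C :=
  Cdiv
    (@RInt C_R_CompleteNormedModule (fun u : R =>
        let x := Cminus (RtoC u) (Cmult Ci (RtoC sigma0)) in
        Cmult (Cmult (Cexp (Cmult Ci (Cplus (Cmult x (RtoC (dtheta t)))
                                            (Cmult (Cmult (Cmult x x) (RtoC (1/2)))
                                                   (RtoC (d2theta t))))))
                     (zeta_shift t x))
              (kernel x))
       (- b) b)
    (Cmult (RtoC (2 * PI)) Ci).

(* Main.v *)
Require Import Defs.
From Stdlib Require Import Reals Lra Lia Psatz FunctionalExtensionality.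
From Coquelicot Require Import Coquelicot.
Open Scope R_scope.

(** Write the integrand of [U] near the real point [t] as [e^(P(x) + E(x)) zeta kernel], where
    [P(x) = i x theta'(t) + i x^2 theta''(t) / 2] and [E] is the Taylor remainder. Expanding the
    Weierstrass series of [logGamma] term by term gives [E(x) = O(|x|^3 / t^2)], because
    [sum_k |1/4 + k + i t/2|^(-3) = O(t^(-2))]. The kernel decays like [e^(- PI |Re x| / 2)] while all
    other factors grow polynomially, so cutting the integrals at [|Re x| = C log t] and moving
    them to the line [Im x = - (1/2 + eps)] costs a negligible amount as soon as [C >= 4]. On that
    line zeta is bounded and [|e^P| = O(t^(1/4 + eps/2))], hence the difference of the two
    integrals is [O(t^(1/4 + eps/2 - 2))].

    Holomorphy is only needed for partial sums of the series of [E] and of zeta: moving a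
    horizontal segment changes the integral by at most the size of the function on the two
    vertical sides, and this estimate survives uniform limits. *)


(** The contour of [U] cannot be moved as a whole: zeta and theta are both singular at x = -t - i/2,
    and the Taylor expansion of theta fails once |x| is comparable with t. So the full line Im x =
    -1/4 is cut first. This needs a bound of the exact factor e^(i theta(t + x)) for every real part
    of x, obtained by comparing |Gamma(3/8 + iy)| with |Gamma(1/8 + iy)|. Only segments |Re x| <= C
    log t are moved, and the singular point is far from them. The kernel has poles at 0 and -2i,
    which confines the heights to 0 < -Im x < 2. Height 1/2 + eps gives the argument of zeta real
    part 1 + eps, just enough for absolute convergence, while each unit of height costs t^(1/2) in
    |e^P|. The bound of zeta read off its defining series is linear in t: too weak for the main
    comparison, but sufficient on the vertical sides, where a loss of t^2 is repaid by e^(-b) =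
    t^(-C). Hence C >= 4. Cauchy's theorem is replaced by differentiating a horizontal integral with
    respect to its height, which leaves only values at the two ends. *)

(** * Moduli of complex numbers and mean value estimates *)

Lemma C_eq (z w : C) : Re z = Re w -> Im z = Im w -> z = w.
Proof. destruct z, w; simpl; intros; subst; reflexivity. Qed.

Lemma im_le_Cmod (z : C) : Rabs (Im z) <= Cmod z.
Proof. eapply Rle_trans; [apply Rmax_r | apply (Rmax_Cmod z)]. Qed.

Lemma Cmod_le_parts (z : C) (A B : R) :
  Rabs (Re z) <= A -> Rabs (Im z) <= B -> Cmod z <= A + B.
Proof.
  intros HA HB.
  assert (Hz : z = Cplus (RtoC (Re z)) (Cmult Ci (RtoC (Im z)))).
  { apply C_eq; unfold Re, Im; simpl; ring. }
  rewrite Hz. eapply Rle_trans; [apply Cmod_triangle|].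
  rewrite Cmod_mult, Cmod_Ci, !Cmod_R. lra.
Qed.

Lemma Cmod_Rsqr (z : C) : Cmod z * Cmod z = Re z * Re z + Im z * Im z.
Proof.
  unfold Cmod. rewrite sqrt_sqrt; [unfold Re, Im; ring|].
  apply Rplus_le_le_0_compat; apply pow2_ge_0.
Qed.

Lemma Cmod_minus_sym (x y : C) : Cmod (x - y)%C = Cmod (y - x)%C.
Proof. rewrite <- Cmod_opp. f_equal. ring. Qed.

Lemma Cmod_minus_le (x y : C) : Cmod (x - y)%C <= Cmod x + Cmod y.
Proof. unfold Cminus. rewrite <- (Cmod_opp y). apply Cmod_triangle. Qed.

Lemma Cmod_triangle_inv (x y : C) : Cmod x - Cmod y <= Cmod (x + y)%C.
Proof.
  pose proof (Cmod_triangle (x + y)%C (- y)%C).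
  rewrite Cmod_opp in H. replace (x + y + - y)%C with x in H by ring. lra.
Qed.

Lemma Cmod_neq_0 (z : C) (m : R) : 0 < m -> m <= Cmod z -> z <> RtoC 0.
Proof. intros Hm Hz H. rewrite H, Cmod_0 in Hz. lra. Qed.

Lemma Re_pos_neq_0 (z : C) : 0 < Re z -> z <> RtoC 0.
Proof. intros H E. rewrite E in H. simpl in H. lra. Qed.

Lemma Cplus_RtoC_Re (z : C) (a : R) : Re (z + RtoC a)%C = Re z + a.
Proof. reflexivity. Qed.

(* The components are estimated separately, which costs the factor 2. *)
Lemma Cmod_mean_value (f f' : R -> C) (M : R) :
  (forall s, 0 <= s <= 1 -> is_derive (fun s => Re (f s)) s (Re (f' s))) ->
  (forall s, 0 <= s <= 1 -> is_derive (fun s => Im (f s)) s (Im (f' s))) ->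
  (forall s, 0 <= s <= 1 -> Cmod (f' s) <= M) ->
  Cmod (f 1 - f 0)%C <= 2 * M.
Proof.
  intros HR HI HM.
  assert (HH : forall g dg : R -> R,
    (forall s, 0 <= s <= 1 -> is_derive g s (dg s)) ->
    (forall s, 0 <= s <= 1 -> Rabs (dg s) <= M) -> Rabs (g 1 - g 0) <= M).
  { intros g dg Hg HB.
    destruct (MVT_gen g 0 1 dg) as [c [Hc E]].
    - intros x Hx. rewrite Rmin_left, Rmax_right in Hx by lra. apply Hg; lra.
    - intros x Hx. rewrite Rmin_left, Rmax_right in Hx by lra.
      apply continuity_pt_filterlim, (ex_derive_continuous (K := R_AbsRing) (V := R_NormedModule) g x).
      eexists; apply Hg; lra.
    - rewrite Rmin_left, Rmax_right in Hc by lra.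
      rewrite E. replace (dg c * (1 - 0)) with (dg c) by ring. auto. }
  replace (2 * M) with (M + M) by ring.
  apply Cmod_le_parts.
  - refine (HH (fun s => Re (f s)) (fun s => Re (f' s)) HR _).
    intros s Hs. eapply Rle_trans; [apply re_le_Cmod | auto].
  - refine (HH (fun s => Im (f s)) (fun s => Im (f' s)) HI _).
    intros s Hs. eapply Rle_trans; [apply im_le_Cmod | auto].
Qed.

(** Quadratic remainders are what the Taylor expansions below deliver, both for holomorphic
    functions and for theta, so every derivative is read off in this form. *)
Lemma is_derive_quadratic (f : R -> R) (x l r K : R) :
  0 < r -> (forall h, Rabs h <= r -> Rabs (f (x + h) - f x - l * h) <= K * h ^ 2) ->
  is_derive f x l.
Proof.
  intros Hr H. apply is_derive_Reals.
  intros eps Heps.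
  set (K' := Rmax K 1).
  assert (HK : 1 <= K') by apply Rmax_r.
  assert (HK2 : K <= K') by apply Rmax_l.
  assert (Hd : 0 < Rmin r (eps / (2 * K'))).
  { apply Rmin_pos; auto. apply Rdiv_lt_0_compat; lra. }
  exists (mkposreal _ Hd). simpl. intros h Hh0 Hh.
  assert (H1 : Rabs h < r) by (eapply Rlt_le_trans; [apply Hh | apply Rmin_l]).
  assert (H2 : Rabs h < eps / (2 * K')) by (eapply Rlt_le_trans; [apply Hh | apply Rmin_r]).
  specialize (H h (Rlt_le _ _ H1)).
  replace ((f (x + h) - f x) / h - l) with ((f (x + h) - f x - l * h) / h) by (field; auto).
  unfold Rdiv. rewrite Rabs_mult, Rabs_inv.
  assert (Hp : 0 < Rabs h) by (apply Rabs_pos_lt; auto).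
  apply Rle_lt_trans with (K' * Rabs h).
  - apply Rmult_le_reg_r with (Rabs h); auto.
    rewrite Rmult_assoc, Rinv_l, Rmult_1_r by lra.
    eapply Rle_trans; [apply H|]. rewrite <- (pow2_abs h). nra.
  - assert (H3 : Rabs h * (2 * K') < eps).
    { apply Rmult_lt_reg_r with (/ (2 * K')); [apply Rinv_0_lt_compat; lra|].
      rewrite Rmult_assoc, Rinv_r, Rmult_1_r by lra. exact H2. }
    nra.
Qed.

(** * Complex exponential and logarithm *)

Lemma Cexp_plus (z w : C) : Cexp (z + w) = (Cexp z * Cexp w)%C.
Proof.
  unfold Cexp. apply C_eq; unfold Re, Im, Cmult; simpl;
  rewrite exp_plus, ?cos_plus, ?sin_plus; ring.
Qed.

Lemma Cexp_0 : Cexp (RtoC 0) = RtoC 1.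
Proof.
  unfold Cexp. apply C_eq; unfold Re, Im; simpl;
  rewrite exp_0, ?cos_0, ?sin_0; ring.
Qed.

Lemma Cmod_Cexp (z : C) : Cmod (Cexp z) = exp (Re z).
Proof.
  unfold Cexp, Cmod. simpl.
  replace (_ + _) with ((exp (Re z)) ^ 2 * (Rsqr (sin (Im z)) + Rsqr (cos (Im z))))
    by (unfold Rsqr; ring).
  rewrite sin2_cos2, Rmult_1_r. rewrite sqrt_pow2; auto. apply Rlt_le, exp_pos.
Qed.

Lemma Cmod_Cexp_le (z : C) : Cmod (Cexp z) <= exp (Cmod z).
Proof.
  rewrite Cmod_Cexp.
  assert (Re z <= Cmod z) by (eapply Rle_trans; [apply Rle_abs | apply re_le_Cmod]).
  destruct H as [H|H]; [left; apply exp_increasing; auto | rewrite H; lra].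
Qed.

Lemma exp_le (x y : R) : x <= y -> exp x <= exp y.
Proof. intros [H|H]; [left; apply exp_increasing; auto | rewrite H; lra]. Qed.

Lemma Cexp_minus_1_le (z : C) : Cmod (Cexp z - 1)%C <= 2 * (Cmod z * exp (Cmod z)).
Proof.
  replace (Cexp z - 1)%C with (Cexp (RtoC 1 * z) - Cexp (RtoC 0 * z))%C
    by (rewrite Cmult_1_l, Cmult_0_l, Cexp_0; reflexivity).
  apply (Cmod_mean_value (fun s => Cexp (RtoC s * z)) (fun s => (z * Cexp (RtoC s * z))%C)).
  - intros s _. unfold Cexp, Re, Im, Cmult, RtoC; simpl. auto_derive; auto. unfold Rminus. ring.
  - intros s _. unfold Cexp, Re, Im, Cmult, RtoC; simpl. auto_derive; auto. unfold Rminus. ring.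
  - intros s Hs. rewrite Cmod_mult.
    apply Rmult_le_compat_l; [apply Cmod_ge_0|].
    eapply Rle_trans; [apply Cmod_Cexp_le|]. apply exp_le.
    rewrite Cmod_mult, Cmod_R, Rabs_right by lra.
    pose proof (Cmod_ge_0 z). nra.
Qed.

(** The function e^(sz) - 1 - sz has s-derivative z (e^(sz) - 1), to which the previous estimate
    applies; each use of the mean value bound contributes a factor 2. *)
Lemma Cexp_taylor_1 (z : C) :
  Cmod (Cexp z - 1 - z)%C <= 4 * (Cmod z ^ 2 * exp (Cmod z)).
Proof.
  replace (Cexp z - 1 - z)%C with
    ((Cexp (RtoC 1 * z) - 1 - RtoC 1 * z) - (Cexp (RtoC 0 * z) - 1 - RtoC 0 * z))%C
    by (rewrite Cmult_1_l, Cmult_0_l, Cexp_0; ring).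
  replace (4 * _) with (2 * (Cmod z * (2 * (Cmod z * exp (Cmod z))))) by ring.
  apply (Cmod_mean_value (fun s => Cexp (RtoC s * z) - 1 - RtoC s * z)%C
     (fun s => (z * (Cexp (RtoC s * z) - 1))%C)).
  - intros s _. unfold Cexp, Re, Im, Cminus, Cplus, Copp, Cmult, RtoC; simpl. auto_derive; auto. unfold Rminus. ring.
  - intros s _. unfold Cexp, Re, Im, Cminus, Cplus, Copp, Cmult, RtoC; simpl. auto_derive; auto. unfold Rminus. ring.
  - intros s Hs. rewrite Cmod_mult.
    apply Rmult_le_compat_l; [apply Cmod_ge_0|].
    eapply Rle_trans; [apply Cexp_minus_1_le|].
    assert (Cmod (RtoC s * z)%C <= Cmod z).
    { rewrite Cmod_mult, Cmod_R, Rabs_right by lra.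
      pose proof (Cmod_ge_0 z). nra. }
    apply Rmult_le_compat_l; [lra|].
    apply Rmult_le_compat; auto using Cmod_ge_0, exp_le. apply Rlt_le, exp_pos.
Qed.

Lemma Carg_polar (r phi : R) : 0 < r -> - PI < phi < PI ->
  Carg (r * cos phi, r * sin phi) = phi.
Proof.
  intros Hr Hphi. unfold Carg.
  assert (HM : Cmod (r * cos phi, r * sin phi) = r).
  { unfold Cmod. simpl.
    replace (_ + _) with (r ^ 2 * (Rsqr (sin phi) + Rsqr (cos phi))) by (unfold Rsqr; ring).
    rewrite sin2_cos2, Rmult_1_r, sqrt_pow2; lra. }
  rewrite HM. unfold Re, Im. simpl.
  replace (r * cos phi / r) with (cos phi) by (field; lra).
  destruct (Rle_dec 0 phi) as [Hp|Hp].
  - assert (0 <= sin phi) by (apply sin_ge_0; lra).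
    destruct (Rle_dec 0 (r * sin phi)) as [_|n]; [|exfalso; apply n; nra].
    apply acos_cos; lra.
  - assert (0 < sin (- phi)) by (apply sin_gt_0; lra).
    rewrite sin_neg in H.
    destruct (Rle_dec 0 (r * sin phi)) as [n|_]; [exfalso; nra|].
    rewrite <- cos_neg, acos_cos; lra.
Qed.

Lemma polar_atan (z : C) : 0 < Re z ->
  z = (Cmod z * cos (atan (Im z / Re z)), Cmod z * sin (atan (Im z / Re z))).
Proof.
  intros H.
  assert (Hs : 0 < sqrt (1 + (Im z / Re z)²)).
  { apply sqrt_lt_R0. pose proof (Rle_0_sqr (Im z / Re z)). lra. }
  assert (HM : Cmod z = Re z * sqrt (1 + (Im z / Re z)²)).
  { apply Rsqr_inj; [apply Cmod_ge_0 | nra |].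
    rewrite Rsqr_mult, Rsqr_sqrt by (pose proof (Rle_0_sqr (Im z / Re z)); lra).
    unfold Rsqr. rewrite Cmod_Rsqr. field. lra. }
  rewrite cos_atan, sin_atan, HM.
  apply C_eq; unfold Re, Im in *; simpl; field; lra.
Qed.

(** On the right half-plane the argument becomes an arctangent, which is differentiable everywhere
    and bounded by PI / 2; the definition by [acos] offers neither directly. *)
Lemma Carg_atan (z : C) : 0 < Re z -> Carg z = atan (Im z / Re z).
Proof.
  intros H. rewrite (polar_atan z H) at 1.
  apply Carg_polar.
  - apply Cmod_gt_0, Re_pos_neq_0, H.
  - pose proof (atan_bound (Im z / Re z)). lra.
Qed.

(** Both arguments lie strictly between - PI / 2 and PI / 2, so their sum stays inside the principal
    range and no multiple of 2 PI appears. *)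
Lemma Clog_mult (z w : C) : 0 < Re z -> 0 < Re w ->
  Clog (z * w) = (Clog z + Clog w)%C.
Proof.
  intros Hz Hw.
  assert (Hz0 := proj1 (Cmod_gt_0 z) (Re_pos_neq_0 z Hz)).
  assert (Hw0 := proj1 (Cmod_gt_0 w) (Re_pos_neq_0 w Hw)).
  unfold Clog. rewrite Cmod_mult, ln_mult by auto.
  rewrite (Carg_atan z Hz), (Carg_atan w Hw).
  unfold Cplus; simpl. f_equal.
  rewrite (polar_atan z Hz) at 1. rewrite (polar_atan w Hw) at 1.
  set (a := atan _). set (b := atan _).
  replace (_ * _)%C with (Cmod z * Cmod w * cos (a + b), Cmod z * Cmod w * sin (a + b)).
  - apply Carg_polar; [nra|].
    pose proof (atan_bound (Im z / Re z)). pose proof (atan_bound (Im w / Re w)).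
    unfold a, b. lra.
  - rewrite cos_plus, sin_plus. unfold Cmult; simpl. f_equal; ring.
Qed.

Lemma Clog_Re_pos (z : C) : 0 < Re z ->
  Clog z = (/ 2 * ln (Re z * Re z + Im z * Im z), atan (Im z / Re z)).
Proof.
  intros H. unfold Clog. rewrite (Carg_atan z H). f_equal.
  rewrite <- Cmod_Rsqr.
  assert (Hz0 := proj1 (Cmod_gt_0 z) (Re_pos_neq_0 z H)).
  rewrite ln_mult by auto. lra.
Qed.

(* [Clog (1 + s z)] has derivative [z / (1 + s z)] in [s]; integrating the remainder
   [p' s - z / (1 + s z)] over [0, 1] compares the logarithm with the polynomial [p]. *)
Lemma Clog_1p_taylor (z : C) (p p' : R -> C) (M : R) :
  -1 < Re z -> p 0 = RtoC 0 ->
  (forall s, is_derive (fun s => Re (p s)) s (Re (p' s))) ->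
  (forall s, is_derive (fun s => Im (p s)) s (Im (p' s))) ->
  (forall s, 0 <= s <= 1 -> Cmod (z / (1 + RtoC s * z) - p' s)%C <= M) ->
  Cmod (Clog (1 + z) - p 1)%C <= 2 * M.
Proof.
  intros Hz Hp0 HR HI HM.
  set (L := fun s : R => (/ 2 * ln ((1 + s * Re z) * (1 + s * Re z) + (s * Im z) * (s * Im z)),
            atan (s * Im z / (1 + s * Re z))) : C).
  assert (H1 : forall s, 0 <= s <= 1 -> 0 < 1 + s * Re z) by (intros s Hs; destruct (Rle_dec 0 (Re z)); nra).
  replace (Clog (1 + z) - p 1)%C with ((L 1 - p 1) - (L 0 - p 0))%C.
  2:{ rewrite Hp0, Clog_Re_pos by (unfold Re in *; simpl; lra).
      unfold L. apply C_eq; unfold Re, Im in *; simpl.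
      - replace ((1 + 0 * fst z) * (1 + 0 * fst z) + 0 * snd z * (0 * snd z)) with 1 by ring.
        rewrite ln_1, !Rmult_1_l, Rplus_0_l. ring.
      - replace (0 * snd z / (1 + 0 * fst z)) with 0 by (field; lra).
        rewrite atan_0, !Rmult_1_l, !Rplus_0_l. ring. }
  apply (Cmod_mean_value (fun s => L s - p s)%C (fun s => (z / (1 + RtoC s * z) - p' s)%C)); auto.
  - intros s Hs. specialize (H1 s Hs).
    assert (Hq : 0 < (1 + s * Re z) * (1 + s * Re z) + (s * Im z) * (s * Im z)) by nra.
    apply (is_derive_minus (fun s => Re (L s)) (fun s => Re (p s)) s
             (Re (z / (1 + RtoC s * z))%C) (Re (p' s))); [|apply HR].
    unfold L, Re, Im in *; simpl in *. auto_derive; [lra|].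
    field. repeat split; nra.
  - intros s Hs. specialize (H1 s Hs).
    assert (Hq : 0 < (1 + s * Re z) * (1 + s * Re z) + (s * Im z) * (s * Im z)) by nra.
    apply (is_derive_minus (fun s => Im (L s)) (fun s => Im (p s)) s
             (Im (z / (1 + RtoC s * z))%C) (Im (p' s))); [|apply HI].
    unfold L, Re, Im in *; simpl in *. auto_derive; [lra|].
    field. repeat split; nra.
Qed.

(** The remainder to integrate is - s z^2 / (1 + s z), hence the lower bound [m] on the denominator.
    Two instances matter: m = 1 when Re z >= 0, without restriction on |z|, for the convergence of
    the Weierstrass series, and m = 1/2 when |z| <= 1/2. *)
Lemma Clog_1p_linear (z : C) (m : R) : 0 < m -> -1 < Re z ->
  (forall s, 0 <= s <= 1 -> m <= Cmod (1 + RtoC s * z)%C) ->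
  Cmod (Clog (1 + z) - z)%C <= 2 * (Cmod z ^ 2 / m).
Proof.
  intros Hm Hz H.
  replace z with (RtoC 1 * z)%C at 2 by ring.
  apply (Clog_1p_taylor z (fun s => RtoC s * z)%C (fun _ => z)); auto.
  - ring.
  - intros s. unfold Re, Im; simpl. auto_derive; auto. ring.
  - intros s. unfold Re, Im; simpl. auto_derive; auto. ring.
  - intros s Hs. specialize (H s Hs).
    assert (Hn := Cmod_neq_0 _ _ Hm H).
    replace (z / (1 + RtoC s * z) - z)%C with (- (RtoC s * (z * z)) / (1 + RtoC s * z))%C
      by (field; auto).
    rewrite Cmod_div, Cmod_opp, !Cmod_mult, Cmod_R, Rabs_right by (auto; lra).
    pose proof (Rle_0_sqr (Cmod z)) as Hq. unfold Rsqr in Hq.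
    apply Rmult_le_compat.
    + apply Rmult_le_pos; [lra | exact Hq].
    + apply Rlt_le, Rinv_0_lt_compat. lra.
    + simpl. rewrite Rmult_1_r. nra.
    + apply Rinv_le_contravar; auto.
Qed.

Lemma Clog_1p_linear_Re_nonneg (z : C) : 0 <= Re z ->
  Cmod (Clog (1 + z) - z)%C <= 2 * Cmod z ^ 2.
Proof.
  intros Hz. replace (2 * Cmod z ^ 2) with (2 * (Cmod z ^ 2 / 1)) by field.
  apply Clog_1p_linear; try lra.
  intros s Hs. eapply Rle_trans; [|apply re_le_Cmod].
  unfold Re in *; simpl. rewrite Rabs_right; nra.
Qed.

Lemma Cmod_1p_ge (z : C) (s : R) : Cmod z <= / 2 -> 0 <= s <= 1 ->
  / 2 <= Cmod (1 + RtoC s * z)%C.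
Proof.
  intros Hz Hs. eapply Rle_trans; [|apply Cmod_triangle_inv].
  rewrite Cmod_1, Cmod_mult, Cmod_R, Rabs_right by lra.
  pose proof (Cmod_ge_0 z). nra.
Qed.

Lemma Re_ge_of_Cmod_le (z : C) (m : R) : Cmod z <= m -> - m <= Re z.
Proof.
  intros H. pose proof (re_le_Cmod z). apply Rabs_le_between in H0. lra.
Qed.

Lemma Clog_1p_linear_small (z : C) : Cmod z <= / 2 ->
  Cmod (Clog (1 + z) - z)%C <= 4 * Cmod z ^ 2.
Proof.
  intros Hz. replace (4 * Cmod z ^ 2) with (2 * (Cmod z ^ 2 / / 2)) by field.
  apply Clog_1p_linear; try lra.
  - apply Re_ge_of_Cmod_le in Hz. lra.
  - intros s Hs. apply Cmod_1p_ge; auto.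
Qed.

(** With p(s) = s z - s^2 z^2 / 2 the remainder is exactly s^2 z^3 / (1 + s z), at most 2 |z|^3 in
    modulus. This cubic bound is the source of the error |x|^3 / t^2. *)
Lemma Clog_1p_quadratic_small (z : C) : Cmod z <= / 2 ->
  Cmod (Clog (1 + z) - (z - z * z / 2))%C <= 4 * Cmod z ^ 3.
Proof.
  intros Hz.
  replace (z - z * z / 2)%C with (RtoC 1 * z - RtoC (1 * 1) * (z * z / 2))%C.
  2:{ rewrite RtoC_mult. field. }
  replace (4 * Cmod z ^ 3) with (2 * (2 * Cmod z ^ 3)) by ring.
  apply (Clog_1p_taylor z (fun s => RtoC s * z - RtoC (s * s) * (z * z / 2))%C
           (fun s => z - RtoC s * (z * z))%C).
  - apply Re_ge_of_Cmod_le in Hz. lra.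
  - rewrite Rmult_0_l. ring.
  - intros s. unfold Re, Im; simpl. auto_derive; auto. field.
  - intros s. unfold Re, Im; simpl. auto_derive; auto. field.
  - intros s Hs. pose proof (Cmod_1p_ge z s Hz Hs).
    assert (Hn : (1 + RtoC s * z)%C <> 0) by (apply Cmod_neq_0 with (/ 2); [lra|auto]).
    replace (z / (1 + RtoC s * z) - (z - RtoC s * (z * z)))%C
      with ((RtoC s * RtoC s * (z * z * z)) / (1 + RtoC s * z))%C by (field; auto).
    rewrite Cmod_div, !Cmod_mult, Cmod_R, Rabs_right by (auto; lra).
    pose proof (Cmod_ge_0 z).
    assert (0 <= Cmod z * Cmod z * Cmod z) by nra.
    apply Rle_trans with (Cmod z * Cmod z * Cmod z * 2); [|right; ring].
    assert (0 <= s * s <= 1) by nra.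
    apply Rmult_le_compat.
    + apply Rmult_le_pos; lra.
    + apply Rlt_le, Rinv_0_lt_compat. lra.
    + nra.
    + replace 2 with (/ / 2) by field. apply Rinv_le_contravar; auto. lra.
Qed.

(** * Holomorphic functions *)

(* Complex differentiability with a locally uniform quadratic remainder; this form passes
   to sums, products and composites with explicit constants and makes [f'] continuous. *)
Definition Hol (f f' : C -> C) (z0 : C) : Prop :=
  exists r K : R, 0 < r <= 1 /\ 0 <= K /\
  forall z h : C, Cmod (z - z0) <= r -> Cmod h <= r ->
    Cmod (f (z + h) - f z - f' z * h)%C <= K * Cmod h ^ 2.

(** Adding the expansion at [z0] with increment h to the expansion at [z] with increment -h cancels
    the values of [f] and leaves (f'(z) - f'(z0)) h, bounded by 2 K |h|^2. *)
Lemma Hol_derivative_continuous (f f' : C -> C) (z0 : C) : Hol f f' z0 ->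
  exists r K : R, 0 < r <= 1 /\ 0 <= K /\
  forall z, Cmod (z - z0) <= r -> Cmod (f' z - f' z0)%C <= K * Cmod (z - z0)%C.
Proof.
  intros (r & K & Hr & HK & H). exists r, (2 * K). repeat split; try lra.
  intros z Hz. set (h := (z - z0)%C) in *.
  assert (H1 := H z0 h). assert (H2 := H z (- h)%C).
  replace (z0 - z0)%C with (RtoC 0) in H1 by ring. rewrite Cmod_0 in H1.
  rewrite Cmod_opp in H2. specialize (H1 ltac:(lra) Hz). specialize (H2 Hz Hz).
  replace (z0 + h)%C with z in H1 by (unfold h; ring).
  replace (z + - h)%C with z0 in H2 by (unfold h; ring).
  destruct (Req_dec (Cmod h) 0) as [E|E].
  - apply Cmod_eq_0 in E. assert (z = z0).
    { replace z with (z0 + h)%C by (unfold h; ring). rewrite E. ring. }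
    subst z. replace (f' z0 - f' z0)%C with (RtoC 0) by ring.
    rewrite Cmod_0. pose proof (Cmod_ge_0 h). nra.
  - pose proof (Cmod_ge_0 h).
    apply Rmult_le_reg_r with (Cmod h); [lra|]. rewrite <- Cmod_mult.
    replace ((f' z - f' z0) * h)%C with
      ((f z - f z0 - f' z0 * h) + (f z0 - f z - f' z * - h))%C by ring.
    eapply Rle_trans; [apply Cmod_triangle|]. nra.
Qed.

(** One radius and one constant for the remainder, the increment, the value and the derivative: the
    form in which products and composites can be estimated. *)
Lemma Hol_bounds (f f' : C -> C) (z0 : C) : Hol f f' z0 ->
  exists r L : R, 0 < r <= 1 /\ 1 <= L /\
  forall z h : C, Cmod (z - z0) <= r -> Cmod h <= r ->
    Cmod (f (z + h) - f z - f' z * h)%C <= L * Cmod h ^ 2 /\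
    Cmod (f (z + h) - f z)%C <= L * Cmod h /\
    Cmod (f z) <= L /\ Cmod (f' z) <= L.
Proof.
  intros HH. destruct (Hol_derivative_continuous _ _ _ HH) as (r1 & K1 & Hr1 & HK1 & H1).
  destruct HH as (r & K & Hr & HK & H).
  set (A := Cmod (f' z0)). set (B := Cmod (f z0)).
  assert (HA : 0 <= A) by apply Cmod_ge_0. assert (HB : 0 <= B) by apply Cmod_ge_0.
  exists (Rmin r r1), (B + A + K + K1 + 1 + (A + K1 + K)).
  assert (Hm : 0 < Rmin r r1) by (apply Rmin_pos; lra).
  assert (Hm1 := Rmin_l r r1). assert (Hm2 := Rmin_r r r1).
  split; [lra|]. split; [lra|]. intros z h Hz Hh. repeat split.
  - eapply Rle_trans; [apply H; lra|]. pose proof (pow2_ge_0 (Cmod h)). nra.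
  - assert (Hf' : Cmod (f' z) <= A + K1).
    { replace (f' z) with (f' z0 + (f' z - f' z0))%C by ring.
      eapply Rle_trans; [apply Cmod_triangle|]. fold A.
      specialize (H1 z ltac:(lra)).
      assert (K1 * Cmod (z - z0)%C <= K1 * 1) by (apply Rmult_le_compat_l; lra). lra. }
    replace (f (z + h) - f z)%C with ((f (z + h) - f z - f' z * h) + f' z * h)%C by ring.
    eapply Rle_trans; [apply Cmod_triangle|]. rewrite Cmod_mult.
    specialize (H z h ltac:(lra) ltac:(lra)).
    assert (0 <= Cmod h <= 1) by (pose proof (Cmod_ge_0 h); lra).
    assert (Cmod h ^ 2 <= Cmod h) by nra.
    assert (K * Cmod h ^ 2 <= K * Cmod h) by (apply Rmult_le_compat_l; lra).
    assert (Cmod (f' z) * Cmod h <= (A + K1) * Cmod h) by (apply Rmult_le_compat_r; lra).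
    nra.
  - replace (f z) with ((f (z0 + (z - z0)) - f z0 - f' z0 * (z - z0)) + (f z0 + f' z0 * (z - z0)))%C.
    2:{ replace (z0 + (z - z0))%C with z by ring. ring. }
    eapply Rle_trans; [apply Cmod_triangle|].
    assert (H2 := H z0 (z - z0)%C).
    replace (z0 - z0)%C with (RtoC 0) in H2 by ring. rewrite Cmod_0 in H2.
    specialize (H2 ltac:(lra) ltac:(lra)).
    assert (H3 := Cmod_triangle (f z0) (f' z0 * (z - z0))%C).
    rewrite Cmod_mult in H3. fold A B in H3.
    assert (Hd : 0 <= Cmod (z - z0)%C <= 1) by (pose proof (Cmod_ge_0 (z - z0)%C); lra).
    assert (K * Cmod (z - z0)%C ^ 2 <= K * 1) by (apply Rmult_le_compat_l; nra).
    assert (A * Cmod (z - z0)%C <= A * 1) by (apply Rmult_le_compat_l; lra).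
    lra.
  - replace (f' z) with (f' z0 + (f' z - f' z0))%C by ring.
    eapply Rle_trans; [apply Cmod_triangle|]. fold A.
    specialize (H1 z ltac:(lra)).
      assert (K1 * Cmod (z - z0)%C <= K1 * 1) by (apply Rmult_le_compat_l; lra). lra.
Qed.

Lemma Hol_const (c z0 : C) : Hol (fun _ => c) (fun _ => RtoC 0) z0.
Proof.
  exists 1, 0. repeat split; try lra. intros z h _ _.
  replace (c - c - 0 * h)%C with (RtoC 0) by ring. rewrite Cmod_0. lra.
Qed.

Lemma Hol_id (z0 : C) : Hol (fun z => z) (fun _ => RtoC 1) z0.
Proof.
  exists 1, 0. repeat split; try lra. intros z h _ _.
  replace (z + h - z - 1 * h)%C with (RtoC 0) by ring. rewrite Cmod_0. lra.
Qed.

Lemma Hol_ext (f f' g g' : C -> C) (z0 : C) :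
  (forall z, f z = g z) -> (forall z, f' z = g' z) -> Hol f f' z0 -> Hol g g' z0.
Proof.
  intros E E' (r & K & Hr & HK & H). exists r, K. repeat split; try lra.
  intros z h Hz Hh. rewrite <- !E, <- E'. auto.
Qed.

Lemma Hol_plus (f f' g g' : C -> C) (z0 : C) : Hol f f' z0 -> Hol g g' z0 ->
  Hol (fun z => f z + g z)%C (fun z => f' z + g' z)%C z0.
Proof.
  intros (r & K & Hr & HK & H) (r2 & K2 & Hr2 & HK2 & H2).
  assert (Hm : 0 < Rmin r r2) by (apply Rmin_pos; lra).
  assert (Hm1 := Rmin_l r r2). assert (Hm2 := Rmin_r r r2).
  exists (Rmin r r2), (K + K2). repeat split; try lra.
  intros z h Hz Hh.
  replace (_ - _ - _)%C with
    ((f (z + h) - f z - f' z * h) + (g (z + h) - g z - g' z * h))%C by ring.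
  eapply Rle_trans; [apply Cmod_triangle|].
  specialize (H z h ltac:(lra) ltac:(lra)). specialize (H2 z h ltac:(lra) ltac:(lra)). lra.
Qed.

Lemma Hol_mult (f f' g g' : C -> C) (z0 : C) : Hol f f' z0 -> Hol g g' z0 ->
  Hol (fun z => f z * g z)%C (fun z => f' z * g z + f z * g' z)%C z0.
Proof.
  intros Hf Hg. apply Hol_bounds in Hf, Hg.
  destruct Hf as (r & K & Hr & HK & H). destruct Hg as (r2 & K2 & Hr2 & HK2 & H2).
  assert (Hm : 0 < Rmin r r2) by (apply Rmin_pos; lra).
  assert (Hm1 := Rmin_l r r2). assert (Hm2 := Rmin_r r r2).
  exists (Rmin r r2), (3 * (K * K2)). repeat split; try nra.
  intros z h Hz Hh.
  destruct (H z h ltac:(lra) ltac:(lra)) as (A1 & A2 & A3 & A4).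
  destruct (H2 z h ltac:(lra) ltac:(lra)) as (B1 & B2 & B3 & B4).
  replace (_ - _ - _)%C with
    ((f (z + h) - f z - f' z * h) * g z + f z * (g (z + h) - g z - g' z * h)
     + (f (z + h) - f z) * (g (z + h) - g z))%C by ring.
  eapply Rle_trans; [apply Cmod_triangle|].
  eapply Rle_trans; [apply Rplus_le_compat_r, Cmod_triangle|].
  rewrite !Cmod_mult.
  assert (C1 := Rmult_le_compat _ _ _ _ (Cmod_ge_0 _) (Cmod_ge_0 _) A1 B3).
  assert (C2 := Rmult_le_compat _ _ _ _ (Cmod_ge_0 _) (Cmod_ge_0 _) A3 B1).
  assert (C3 := Rmult_le_compat _ _ _ _ (Cmod_ge_0 _) (Cmod_ge_0 _) A2 B2).
  replace (3 * (K * K2) * Cmod h ^ 2) with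
    (K * Cmod h ^ 2 * K2 + K * (K2 * Cmod h ^ 2) + K * Cmod h * (K2 * Cmod h)) by ring.
  lra.
Qed.

Lemma Hol_comp (f f' g g' : C -> C) (z0 : C) : Hol f f' z0 -> Hol g g' (f z0) ->
  Hol (fun z => g (f z)) (fun z => g' (f z) * f' z)%C z0.
Proof.
  intros Hf Hg. apply Hol_bounds in Hf, Hg.
  destruct Hf as (r & K & Hr & HK & H). destruct Hg as (r2 & K2 & Hr2 & HK2 & H2).
  (* The radius ensures K d <= r2, so both f(z) - f(z0) and f(z + h) - f(z) stay in the disc where
     the expansion of [g] is valid. *)
  set (d := Rmin r (r2 / K)).
  assert (Hd0 : 0 < r2 / K) by (apply Rdiv_lt_0_compat; lra).
  assert (Hd : 0 < d) by (apply Rmin_pos; lra).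
  assert (Hd1 : d <= r) by apply Rmin_l. assert (Hd2 : d <= r2 / K) by apply Rmin_r.
  assert (Hd3 : K * d <= r2).
  { apply Rmult_le_compat_l with (r := K) in Hd2; [|lra].
    replace (K * (r2 / K)) with r2 in Hd2 by (field; lra). exact Hd2. }
  exists d, (K2 * (K * K) + K2 * K). repeat split; try nra.
  intros z h Hz Hh.
  destruct (H z h ltac:(lra) ltac:(lra)) as (A1 & A2 & A3 & A4).
  set (H' := (f (z + h) - f z)%C) in *.
  assert (Hfz : Cmod (f z - f z0)%C <= r2).
  { destruct (H z0 (z - z0)%C) as (_ & E & _ & _); try lra.
    - replace (z0 - z0)%C with (RtoC 0) by ring. rewrite Cmod_0. lra.
    - replace (z0 + (z - z0))%C with z in E by ring.
      eapply Rle_trans; [apply E|]. nra. }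
  assert (HH' : Cmod H' <= r2) by (eapply Rle_trans; [apply A2|]; nra).
  destruct (H2 (f z) H' Hfz HH') as (B1 & B2 & B3 & B4).
  replace (f z + H')%C with (f (z + h)%C) in B1 by (unfold H'; ring).
  replace (_ - _ - _)%C with
    ((g (f (z + h)) - g (f z) - g' (f z) * H') + g' (f z) * (H' - f' z * h))%C by ring.
  eapply Rle_trans; [apply Cmod_triangle|]. rewrite Cmod_mult.
  assert (C1 : Cmod H' ^ 2 <= (K * Cmod h) ^ 2) by (apply pow_incr; split; auto using Cmod_ge_0).
  assert (C2 := Rmult_le_compat _ _ _ _ (Cmod_ge_0 _) (Cmod_ge_0 _) B4 A1).
  replace (K * Cmod h ^ 2) with (K * (Cmod h * Cmod h)) in C2 by ring.
  replace ((K * Cmod h) ^ 2) with (K * K * (Cmod h * Cmod h)) in C1 by ring.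
  replace (_ * Cmod h ^ 2) with
    (K2 * (K * K * (Cmod h * Cmod h)) + K2 * (K * (Cmod h * Cmod h))) by ring.
  nra.
Qed.

Lemma Hol_Cexp (z0 : C) : Hol Cexp Cexp z0.
Proof.
  exists 1, (exp (Cmod z0 + 1) * (4 * exp 1)).
  pose proof (exp_pos (Cmod z0 + 1)). pose proof (exp_pos 1).
  repeat split; try nra. intros z h Hz Hh.
  rewrite Cexp_plus.
  replace (_ - _ - _)%C with (Cexp z * (Cexp h - 1 - h))%C by ring.
  rewrite Cmod_mult, Rmult_assoc.
  apply Rmult_le_compat; auto using Cmod_ge_0.
  - eapply Rle_trans; [apply Cmod_Cexp_le|]. apply exp_le.
    replace z with (z0 + (z - z0))%C by ring.
    eapply Rle_trans; [apply Cmod_triangle|]. lra.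
  - eapply Rle_trans; [apply Cexp_taylor_1|].
    pose proof (exp_le _ _ Hh). pose proof (pow2_ge_0 (Cmod h)). nra.
Qed.

Lemma Cmod_near (z z0 : C) (r : R) : Cmod (z - z0)%C <= r -> Cmod z0 - r <= Cmod z.
Proof.
  intros H. pose proof (Cmod_triangle_inv z0 (z - z0)%C) as E.
  replace (z0 + (z - z0))%C with z in E by ring. lra.
Qed.

(** The remainder is exactly h^2 / (z^2 (z + h)); the radius |z0| / 4 keeps both z and z + h at
    distance at least |z0| / 2 from 0. *)
Lemma Hol_Cinv (z0 : C) : z0 <> 0 -> Hol Cinv (fun z => - / (z * z))%C z0.
Proof.
  intros Hz0. apply Cmod_gt_0 in Hz0. set (m := Cmod z0) in *.
  set (r := Rmin 1 (m / 4)).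
  assert (Hr : 0 < r) by (apply Rmin_pos; lra).
  assert (Hr1 : r <= 1) by apply Rmin_l. assert (Hr2 : r <= m / 4) by apply Rmin_r.
  exists r, (/ ((m / 2) * (m / 2) * (m / 2))).
  assert (Hm3 : 0 < m / 2 * (m / 2) * (m / 2)) by (assert (0 < m / 2) by lra; repeat apply Rmult_lt_0_compat; lra).
  repeat split; try lra.
  { apply Rlt_le, Rinv_0_lt_compat; auto. }
  intros z h Hz Hh.
  assert (Hzm : m / 2 <= Cmod z) by (apply Cmod_near in Hz; fold m in Hz; lra).
  assert (Hzh : m / 2 <= Cmod (z + h)%C).
  { pose proof (Cmod_triangle_inv z h). apply Cmod_near in Hz. fold m in Hz. lra. }
  assert (N1 := Cmod_neq_0 z (m / 2) ltac:(lra) Hzm).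
  assert (N2 := Cmod_neq_0 _ (m / 2) ltac:(lra) Hzh).
  replace (_ - _ - _)%C with ((h * h) / (z * z * (z + h)))%C by (field; auto).
  rewrite Cmod_div by (repeat apply Cmult_neq_0; auto).
  rewrite !Cmod_mult. unfold Rdiv. rewrite Rmult_comm.
  replace (Cmod h ^ 2) with (Cmod h * Cmod h) by ring.
  apply Rmult_le_compat_r; [pose proof (Cmod_ge_0 h); nra|].
  apply Rinv_le_contravar; auto.
  apply Rmult_le_compat; try nra.
Qed.

(** Factoring 1 + z + h = (1 + z)(1 + w) with w = h / (1 + z) reduces the expansion at an arbitrary
    point to that of the logarithm at 1. The radius makes |w| <= 1/2. *)
Lemma Hol_Clog_1p (z0 : C) : 0 < Re (1 + z0)%C ->
  Hol (fun z => Clog (1 + z)) (fun z => / (1 + z))%C z0.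
Proof.
  intros Hz0. set (m := Re (1 + z0)%C) in *.
  set (r := Rmin 1 (m / 4)).
  assert (Hr : 0 < r) by (apply Rmin_pos; lra).
  assert (Hr1 : r <= 1) by apply Rmin_l. assert (Hr2 : r <= m / 4) by apply Rmin_r.
  exists r, (4 * (/ (m / 2)) ^ 2).
  repeat split; try lra.
  { pose proof (pow2_ge_0 (/ (m / 2))). lra. }
  intros z h Hz Hh.
  assert (HR : m / 2 <= Re (1 + z)%C).
  { replace (1 + z)%C with ((1 + z0) + (z - z0))%C by ring.
    apply Re_ge_of_Cmod_le in Hz.
    change (Re (1 + z0 + (z - z0))%C) with (Re (1 + z0)%C + Re (z - z0)%C).
    fold m. lra. }
  assert (HM : m / 2 <= Cmod (1 + z)%C).
  { eapply Rle_trans; [apply HR|]. eapply Rle_trans; [apply Rle_abs|apply re_le_Cmod]. }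
  assert (N1 := Cmod_neq_0 _ (m / 2) ltac:(lra) HM).
  set (w := (h / (1 + z))%C).
  assert (Hw : Cmod w <= Cmod h * / (m / 2)).
  { unfold w. rewrite Cmod_div by auto. apply Rmult_le_compat_l; [apply Cmod_ge_0|].
    apply Rinv_le_contravar; lra. }
  assert (Hw2 : Cmod w <= / 2).
  { eapply Rle_trans; [apply Hw|]. apply Rmult_le_reg_r with (m / 2); [lra|].
    rewrite Rmult_assoc, Rinv_l by lra. lra. }
  replace (1 + (z + h))%C with ((1 + z) * (1 + w))%C by (unfold w; field; auto).
  rewrite Clog_mult; [| lra |].
  2:{ apply Re_ge_of_Cmod_le in Hw2.
      change (Re (1 + w)%C) with (1 + Re w). lra. }
  replace (_ - _ - _)%C with (Clog (1 + w) - w)%C by (unfold w; field; auto).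
  eapply Rle_trans; [apply Clog_1p_linear_small; auto|].
  replace (_ * Cmod h ^ 2) with (4 * (Cmod h * / (m / 2)) ^ 2) by (rewrite Rpow_mult_distr; ring).
  apply Rmult_le_compat_l; [lra|]. apply pow_incr. split; auto using Cmod_ge_0.
Qed.

(** * Shifting horizontal contours *)

Lemma norm_C_R (z : C) : @norm R_AbsRing C_R_NormedModule z = Cmod z.
Proof. symmetry. apply (Cmod_norm z). Qed.

(** Phrased with [Cmod] instead of the product uniform structure, so that modulus estimates apply
    directly; [Ccont_Re] and [Ccont_Im] convert it when integrability is needed. *)
Definition Ccont (f : R -> C) (u : R) : Prop :=
  forall eps, 0 < eps -> exists d, 0 < d /\
    forall v, Rabs (v - u) < d -> Cmod (f v - f u)%C <= eps.

Lemma Ccont_Re (f : R -> C) (u : R) : Ccont f u -> continuous (fun v => Re (f v)) u.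
Proof.
  intros H. apply continuity_pt_filterlim. intros eps Heps.
  destruct (H (eps / 2) ltac:(lra)) as (d & Hd & HH).
  exists d. split; auto. intros v [_ Hv]. simpl in *. unfold R_dist in *.
  apply Rle_lt_trans with (eps / 2); [|lra].
  eapply Rle_trans; [|apply (HH v Hv)].
  apply (re_le_Cmod (f v - f u)%C).
Qed.

Lemma Ccont_Im (f : R -> C) (u : R) : Ccont f u -> continuous (fun v => Im (f v)) u.
Proof.
  intros H. apply continuity_pt_filterlim. intros eps Heps.
  destruct (H (eps / 2) ltac:(lra)) as (d & Hd & HH).
  exists d. split; auto. intros v [_ Hv]. simpl in *. unfold R_dist in *.
  apply Rle_lt_trans with (eps / 2); [|lra].
  eapply Rle_trans; [|apply (HH v Hv)].
  apply (im_le_Cmod (f v - f u)%C).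
Qed.

Lemma is_RInt_C (f : R -> C) (a b : R) :
  (forall u, Rmin a b <= u <= Rmax a b -> Ccont f u) ->
  is_RInt (V := C_R_NormedModule) f a b
    (RInt (fun u => Re (f u)) a b, RInt (fun u => Im (f u)) a b).
Proof.
  intros H.
  apply (is_RInt_fct_extend_pair (U := R_NormedModule) (V := R_NormedModule)).
  - apply (RInt_correct (V := R_CompleteNormedModule)). apply ex_RInt_continuous.
    intros z Hz. apply Ccont_Re, H, Hz.
  - apply (RInt_correct (V := R_CompleteNormedModule)). apply ex_RInt_continuous.
    intros z Hz. apply Ccont_Im, H, Hz.
Qed.

Definition CInt (f : R -> C) (a b : R) : C := @RInt C_R_CompleteNormedModule f a b.

Lemma CInt_is_RInt (f : R -> C) (a b : R) :
  (forall u, Rmin a b <= u <= Rmax a b -> Ccont f u) ->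
  is_RInt (V := C_R_NormedModule) f a b (CInt f a b).
Proof.
  intros H. apply (RInt_correct (V := C_R_CompleteNormedModule)).
  eexists. apply is_RInt_C, H.
Qed.

Lemma CInt_parts (f : R -> C) (a b : R) :
  (forall u, Rmin a b <= u <= Rmax a b -> Ccont f u) ->
  CInt f a b = (RInt (fun u => Re (f u)) a b, RInt (fun u => Im (f u)) a b).
Proof.
  intros H. apply (is_RInt_unique (V := C_R_CompleteNormedModule)).
  apply is_RInt_C, H.
Qed.

Lemma CInt_bound (f : R -> C) (g : R -> R) (a b lg : R) : a <= b ->
  (forall u, a <= u <= b -> Ccont f u) ->
  (forall u, a <= u <= b -> Cmod (f u) <= g u) ->
  is_RInt g a b lg -> Cmod (CInt f a b) <= lg.
Proof.
  intros Hab Hf Hg Hl. rewrite <- norm_C_R.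
  apply (norm_RInt_le (V := C_R_NormedModule) f g a b); auto.
  - intros x Hx. rewrite norm_C_R. auto.
  - apply CInt_is_RInt. intros u Hu.
    rewrite Rmin_left, Rmax_right in Hu by auto. auto.
Qed.

Lemma CInt_bound_const (f : R -> C) (a b M : R) : a <= b ->
  (forall u, a <= u <= b -> Ccont f u) ->
  (forall u, a <= u <= b -> Cmod (f u) <= M) -> Cmod (CInt f a b) <= (b - a) * M.
Proof.
  intros Hab Hf Hg.
  apply (CInt_bound f (fun _ => M) a b); auto. apply (is_RInt_const a b M).
Qed.

Lemma CInt_minus (f g : R -> C) (a b : R) : a <= b ->
  (forall u, a <= u <= b -> Ccont f u) -> (forall u, a <= u <= b -> Ccont g u) ->
  (CInt f a b - CInt g a b)%C = CInt (fun u => f u - g u)%C a b.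
Proof.
  intros Hab Hf Hg. symmetry.
  apply (is_RInt_unique (V := C_R_CompleteNormedModule)).
  assert (HR : forall u, Rmin a b <= u <= Rmax a b -> a <= u <= b).
  { intros u. rewrite Rmin_left, Rmax_right; auto. }
  apply (is_RInt_minus (V := C_R_NormedModule) f g a b (CInt f a b) (CInt g a b));
    apply CInt_is_RInt; auto.
Qed.

Lemma Ccont_minus (f g : R -> C) (u : R) : Ccont f u -> Ccont g u ->
  Ccont (fun u => f u - g u)%C u.
Proof.
  intros Hf Hg eps He.
  destruct (Hf (eps / 2) ltac:(lra)) as (d & Hd & Df).
  destruct (Hg (eps / 2) ltac:(lra)) as (d' & Hd' & Dg).
  exists (Rmin d d'). split; [apply Rmin_pos; auto|]. intros v Hv.
  assert (H1 := Rlt_le_trans _ _ _ Hv (Rmin_l d d')).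
  assert (H2 := Rlt_le_trans _ _ _ Hv (Rmin_r d d')).
  replace (_ - _ - _)%C with ((f v - f u) - (g v - g u))%C by ring.
  eapply Rle_trans; [apply Cmod_minus_le|].
  specialize (Df v H1). specialize (Dg v H2). lra.
Qed.

Lemma Ccont_mult (f g : R -> C) (u : R) : Ccont f u -> Ccont g u ->
  Ccont (fun u => f u * g u)%C u.
Proof.
  intros Hf Hg eps He.
  set (A := Cmod (f u)). set (B := Cmod (g u)).
  assert (HA : 0 <= A) by apply Cmod_ge_0. assert (HB : 0 <= B) by apply Cmod_ge_0.
  set (e := Rmin 1 (eps / (A + B + 1))).
  assert (He0 : 0 < eps / (A + B + 1)) by (apply Rdiv_lt_0_compat; lra).
  assert (Hep : 0 < e) by (apply Rmin_pos; lra).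
  assert (He1 : e <= 1) by apply Rmin_l. assert (He2 : e <= eps / (A + B + 1)) by apply Rmin_r.
  assert (He3 : e * (A + B + 1) <= eps).
  { apply Rmult_le_compat_r with (r := A + B + 1) in He2; [|lra].
    replace (eps / (A + B + 1) * (A + B + 1)) with eps in He2 by (field; lra). exact He2. }
  destruct (Hf e Hep) as (d & Hd & Df).
  destruct (Hg e Hep) as (d' & Hd' & Dg).
  exists (Rmin d d'). split; [apply Rmin_pos; auto|]. intros v Hv.
  assert (H1 := Rlt_le_trans _ _ _ Hv (Rmin_l d d')).
  assert (H2 := Rlt_le_trans _ _ _ Hv (Rmin_r d d')).
  specialize (Df v H1). specialize (Dg v H2).
  replace (_ - _)%C with ((f v - f u) * (g v - g u) + (f v - f u) * g u + f u * (g v - g u))%C by ring.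
  eapply Rle_trans; [apply Cmod_triangle|].
  eapply Rle_trans; [apply Rplus_le_compat_r, Cmod_triangle|].
  rewrite !Cmod_mult. fold A B.
  pose proof (Cmod_ge_0 (f v - f u)%C). pose proof (Cmod_ge_0 (g v - g u)%C). nra.
Qed.

Lemma Cmod_horizontal (u v s : R) : Cmod ((v, s) - (u, s))%C = Rabs (v - u).
Proof.
  replace ((v, s) - (u, s))%C with (RtoC (v - u)) by (apply C_eq; unfold Re, Im; simpl; ring).
  apply Cmod_R.
Qed.

Lemma Hol_Ccont (f f' : C -> C) (u s : R) : Hol f f' (u, s) -> Ccont (fun u => f (u, s)) u.
Proof.
  intros H. apply Hol_bounds in H. destruct H as (r & L & Hr & HL & H).
  intros eps He. exists (Rmin r (eps / L)). split.
  { apply Rmin_pos; [lra|]. apply Rdiv_lt_0_compat; lra. }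
  intros v Hv.
  assert (H1 := Rlt_le_trans _ _ _ Hv (Rmin_l _ _)).
  assert (H2 := Rlt_le_trans _ _ _ Hv (Rmin_r _ _)).
  destruct (H (u, s) ((v, s) - (u, s))%C) as (_ & E & _).
  - replace ((u, s) - (u, s))%C with (RtoC 0) by (apply C_eq; unfold Re, Im; simpl; ring). rewrite Cmod_0. lra.
  - rewrite Cmod_horizontal. lra.
  - replace ((u, s) + ((v, s) - (u, s)))%C with ((v, s) : C) in E
      by (apply C_eq; unfold Re, Im; simpl; ring).
    eapply Rle_trans; [apply E|]. rewrite Cmod_horizontal.
    apply Rlt_le in H2. apply Rmult_le_compat_l with (r := L) in H2; [|lra].
    replace (L * (eps / L)) with eps in H2 by (field; lra). exact H2.
Qed.

(** Joint continuity in both coordinates is the condition for differentiating under the integral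
    sign with respect to the height. *)
Lemma Hol_derivative_2d (f f' : C -> C) (u s : R) : Hol f f' (u, (- s)%R) ->
  continuity_2d_pt (fun s u => Re (f' (u, (- s)%R))) s u /\
  continuity_2d_pt (fun s u => Im (f' (u, (- s)%R))) s u.
Proof.
  intros H. apply Hol_derivative_continuous in H. destruct H as (r & K & Hr & HK & H).
  assert (HH : forall eps : posreal, exists d : posreal, forall s' u',
     Rabs (s' - s) < d -> Rabs (u' - u) < d -> Cmod (f' (u', (- s')%R) - f' (u, (- s)%R))%C < eps).
  { intros eps. pose proof (cond_pos eps) as He.
    assert (Hd : 0 < Rmin (r / 2) (eps / (4 * (K + 1)))).
    { apply Rmin_pos; [lra|]. apply Rdiv_lt_0_compat; lra. }
    exists (mkposreal _ Hd). simpl. intros s' u' Hs Hu.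
    assert (Hs1 := Rlt_le_trans _ _ _ Hs (Rmin_l _ _)).
    assert (Hu1 := Rlt_le_trans _ _ _ Hu (Rmin_l _ _)).
    assert (Hs2 := Rlt_le_trans _ _ _ Hs (Rmin_r _ _)).
    assert (Hu2 := Rlt_le_trans _ _ _ Hu (Rmin_r _ _)).
    set (d := ((u', (- s')%R) - (u, (- s)%R))%C) in *.
    assert (HM : forall m, Rabs (s' - s) < m -> Rabs (u' - u) < m -> Cmod d <= 2 * m).
    { intros m H1 H2. replace (2 * m) with (m + m) by ring.
      apply Cmod_le_parts; unfold d, Re, Im; simpl.
      - apply Rlt_le. exact H2.
      - replace (- s' + - - s) with (- (s' - s)) by ring. rewrite Rabs_Ropp. lra. }
    apply Rle_lt_trans with (K * Cmod d).
    - apply H. specialize (HM (r / 2) Hs1 Hu1). unfold d in HM. lra.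
    - specialize (HM _ Hs2 Hu2).
      apply Rmult_le_compat_l with (r := K + 1) in HM; [|lra].
      replace ((K + 1) * (2 * (eps / (4 * (K + 1))))) with (eps / 2) in HM by (field; lra).
      pose proof (Cmod_ge_0 d). lra. }
  split; intros eps; destruct (HH eps) as [d Hd]; exists d; intros s' u' Hs Hu;
    eapply Rle_lt_trans; [| apply (Hd s' u' Hs Hu) | | apply (Hd s' u' Hs Hu)].
  - apply (re_le_Cmod (f' (u', (- s')%R) - f' (u, (- s)%R))%C).
  - apply (im_le_Cmod (f' (u', (- s')%R) - f' (u, (- s)%R))%C).
Qed.

Lemma Hol_is_derive_line (f f' : C -> C) (a d : C) (p : R) :
  Hol f f' (a + RtoC p * d)%C -> Cmod d <= 1 ->
  is_derive (fun h : R => Re (f (a + RtoC h * d)%C)) p (Re (f' (a + RtoC p * d) * d)%C) /\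
  is_derive (fun h : R => Im (f (a + RtoC h * d)%C)) p (Im (f' (a + RtoC p * d) * d)%C).
Proof.
  intros (r & K & Hr & HK & H) Hd.
  set (x0 := (a + RtoC p * d)%C) in *.
  assert (HH : forall h : R, Rabs h <= r ->
    Cmod (f (a + RtoC (p + h) * d) - f x0 - RtoC h * (f' x0 * d))%C <= K * h ^ 2).
  { intros h Hh. rewrite RtoC_plus.
    replace (a + (RtoC p + RtoC h) * d)%C with (x0 + RtoC h * d)%C by (unfold x0; ring).
    replace (RtoC h * (f' x0 * d))%C with (f' x0 * (RtoC h * d))%C by ring.
    assert (Hm : Cmod (RtoC h * d)%C <= Rabs h).
    { rewrite Cmod_mult, Cmod_R. pose proof (Rabs_pos h). nra. }
    eapply Rle_trans; [apply H|].
    - replace (x0 - x0)%C with (RtoC 0) by ring. rewrite Cmod_0. lra.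
    - lra.
    - apply Rmult_le_compat_l; auto. rewrite <- (pow2_abs h).
      apply pow_incr. split; auto using Cmod_ge_0. }
  split; apply is_derive_quadratic with (r := r) (K := K); try lra; intros h Hh;
    (eapply Rle_trans; [| apply (HH h Hh)]).
  - eapply Rle_trans; [|apply re_le_Cmod]. right. f_equal.
    fold x0. generalize (f (a + RtoC (p + h) * d)%C) (f x0) (f' x0 * d)%C.
    intros; unfold Re; simpl. ring.
  - eapply Rle_trans; [|apply im_le_Cmod]. right. f_equal.
    fold x0. generalize (f (a + RtoC (p + h) * d)%C) (f x0) (f' x0 * d)%C.
    intros; unfold Im; simpl. ring.
Qed.

Lemma Hol_is_derive_horizontal (f f' : C -> C) (u s : R) : Hol f f' (u, s) ->
  is_derive (fun u => Re (f (u, s))) u (Re (f' (u, s))) /\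
  is_derive (fun u => Im (f (u, s))) u (Im (f' (u, s))).
Proof.
  intros H.
  assert (E : forall h : R, ((0, s) + RtoC h * 1)%C = (h, s))
    by (intros; apply C_eq; unfold Re, Im; simpl; ring).
  destruct (Hol_is_derive_line f f' (0, s) 1 u) as [H1 H2].
  - rewrite E. exact H.
  - rewrite Cmod_1. lra.
  - rewrite E, Cmult_1_r in H1, H2.
    split; [eapply is_derive_ext; [|exact H1] | eapply is_derive_ext; [|exact H2]];
    intros h; simpl; now rewrite E.
Qed.

(** Moving down multiplies the derivative by -i. Next to the horizontal derivatives this is the
    Cauchy-Riemann system: the s-derivatives of Re f and Im f equal the u-derivatives of Im f and -
    Re f. *)
Lemma Hol_is_derive_vertical (f f' : C -> C) (u s : R) : Hol f f' (u, (- s)%R) ->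
  is_derive (fun s => Re (f (u, (- s)%R))) s (Im (f' (u, (- s)%R))) /\
  is_derive (fun s => Im (f (u, (- s)%R))) s (- Re (f' (u, (- s)%R))).
Proof.
  intros H.
  assert (E : forall h : R, ((u, 0) + RtoC h * - Ci)%C = (u, (- h)%R))
    by (intros; apply C_eq; unfold Re, Im; simpl; ring).
  destruct (Hol_is_derive_line f f' (u, 0) (- Ci)%C s) as [H1 H2].
  - rewrite E. exact H.
  - rewrite Cmod_opp, Cmod_Ci. lra.
  - rewrite E in H1, H2.
    replace (Re (f' (u, (- s)%R) * - Ci)%C) with (Im (f' (u, (- s)%R))) in H1
      by (unfold Re, Im; simpl; ring).
    replace (Im (f' (u, (- s)%R) * - Ci)%C) with (- Re (f' (u, (- s)%R))) in H2
      by (unfold Re, Im; simpl; ring).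
    split; [eapply is_derive_ext; [|exact H1] | eapply is_derive_ext; [|exact H2]];
    intros h; simpl; now rewrite E.
Qed.

(* Points are parametrised as [(u, - s)], that is [u - i s]. *)
Definition box (b a1 a2 : R) (z : C) : Prop :=
  Rabs (Re z) < b + 1 /\ a1 <= - Im z <= a2.

(** The derivative of the integral with respect to [s] is the integral of -i f', that is -i times
    the difference of the two end values of [f]. The mean value theorem in [s], over a range shorter
    than 2, bounds each component by 2 M times 2, and the two components give 8 M. *)
Lemma Hol_horizontal_integral (f f' : C -> C) (b a1 a2 M : R) : 0 <= b -> 0 < a1 -> a2 < 2 ->
  (forall u s, Rabs u < b + 1 -> 0 < s < 2 -> Hol f f' (u, (- s)%R)) ->
  (forall s, a1 <= s <= a2 -> Cmod (f (b, (- s)%R)) <= M /\ Cmod (f ((- b)%R, (- s)%R)) <= M) ->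
  forall s1 s2, a1 <= s1 <= a2 -> a1 <= s2 <= a2 ->
  Cmod (CInt (fun u => f (u, (- s1)%R)) (- b) b - CInt (fun u => f (u, (- s2)%R)) (- b) b)%C
    <= 8 * M.
Proof.
  intros Hb Ha1 Ha2 Hf HM s1 s2 Hs1 Hs2.
  assert (Hin : forall u, Rmin (- b) b <= u <= Rmax (- b) b -> Rabs u < b + 1).
  { intros u Hu. rewrite Rmin_left, Rmax_right in Hu by lra.
    apply Rabs_lt_between. lra. }
  assert (Hcont : forall s, 0 < s < 2 -> forall u, Rmin (- b) b <= u <= Rmax (- b) b ->
            Ccont (fun u => f (u, (- s)%R)) u).
  { intros s Hs u Hu. apply (Hol_Ccont f f'). apply Hf; auto. }
  assert (HMp : 0 <= M).
  { eapply Rle_trans; [|apply (proj1 (HM s1 Hs1))]. apply Cmod_ge_0. }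
  assert (Hloc : forall (x : R) (P : R -> Prop), 0 < x < 2 -> (forall y, 0 < y < 2 -> P y) -> locally x P).
  { intros x P Hx HP.
    assert (Hd : 0 < Rmin x (2 - x)) by (apply Rmin_pos; lra).
    exists (mkposreal _ Hd). intros y Hy. apply HP.
    change (Rabs (y - x) < Rmin x (2 - x)) in Hy.
    assert (H1 := Rlt_le_trans _ _ _ Hy (Rmin_l _ _)).
    assert (H2 := Rlt_le_trans _ _ _ Hy (Rmin_r _ _)).
    apply Rabs_lt_between in H1, H2. lra. }
  (* Treats both components at once: [p] is the component that is integrated, [q] its harmonic
     conjugate up to sign, and p' applied to f' is both the s-derivative of p(f) and the
     u-derivative of q(f). The instances are (Re, Im, Im) and (Im, - Re, - Re). *)
  assert (Hkey : forall (p q : C -> R) (p' : C -> R),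
    (forall z, Rabs (q z) <= Cmod z) ->
    (forall u s, Rabs u < b + 1 -> 0 < s < 2 ->
       is_derive (fun s => p (f (u, (- s)%R))) s (p' (f' (u, (- s)%R)))) ->
    (forall u s, Rabs u < b + 1 -> 0 < s < 2 ->
       is_derive (fun u => q (f (u, (- s)%R))) u (p' (f' (u, (- s)%R)))) ->
    (forall u s, Rabs u < b + 1 -> 0 < s < 2 ->
       continuity_2d_pt (fun s u => p' (f' (u, (- s)%R))) s u) ->
    (forall u s, Rabs u < b + 1 -> 0 < s < 2 ->
       continuous (fun u => p (f (u, (- s)%R))) u) ->
    Rabs (RInt (fun u => p (f (u, (- s1)%R))) (- b) b - RInt (fun u => p (f (u, (- s2)%R))) (- b) b)
      <= 4 * M).
  { intros p q p' Hq Hv Hh Hc Hp.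
    assert (Hder : forall s, 0 < s < 2 ->
      is_derive (fun s => RInt (fun u => p (f (u, (- s)%R))) (- b) b) s
        (q (f (b, (- s)%R)) - q (f ((- b)%R, (- s)%R)))).
    { intros s Hs.
      assert (HI : is_RInt (fun u => Derive (fun s => p (f (u, (- s)%R))) s) (- b) b
                     (q (f (b, (- s)%R)) - q (f ((- b)%R, (- s)%R)))).
      { apply is_RInt_ext with (fun u => p' (f' (u, (- s)%R))).
        { intros u Hu. symmetry. apply is_derive_unique, Hv; auto.
          apply Hin. lra. }
        apply (is_RInt_derive (V := R_CompleteNormedModule) (fun u => q (f (u, (- s)%R)))).
        - intros u Hu. apply Hh; auto.
        - intros u Hu. apply continuity_pt_filterlim. intros e He.
          destruct (Hc u s (Hin u Hu) Hs (mkposreal e He)) as [d Hd].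
          exists d. split; [apply cond_pos|]. intros v [_ Hv']. simpl in *.
          apply Hd; auto. rewrite Rminus_diag, Rabs_R0. apply cond_pos. }
      rewrite <- (is_RInt_unique _ _ _ _ HI).
      apply (is_derive_RInt_param (fun s u => p (f (u, (- s)%R)))).
      - apply Hloc; auto. intros y Hy t Ht. eexists. apply Hv; auto.
      - intros u Hu.
        (* [Derive] is known to agree with the expression in f' only inside the open strip, so the
           two are exchanged on a neighbourhood that stays inside it. *)
        apply continuity_2d_pt_ext_loc with (fun s u => p' (f' (u, (- s)%R))); [|apply Hc; auto].
        assert (Hu' := Hin u Hu).
        assert (Hd : 0 < Rmin (Rmin s (2 - s)) (b + 1 - Rabs u)).
        { apply Rmin_pos; [apply Rmin_pos; lra|lra]. }
        exists (mkposreal _ Hd). simpl. intros s' u' Hs' Hu''. symmetry.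
        assert (H1 := Rlt_le_trans _ _ _ Hs' (Rmin_l _ _)).
        assert (H2 := Rlt_le_trans _ _ _ H1 (Rmin_r _ _)).
        assert (H3 := Rlt_le_trans _ _ _ H1 (Rmin_l _ _)).
        assert (H4 := Rlt_le_trans _ _ _ Hu'' (Rmin_r _ _)).
        apply is_derive_unique, Hv.
        + replace u' with (u + (u' - u)) by ring.
          eapply Rle_lt_trans; [apply Rabs_triang|]. lra.
        + apply Rabs_lt_between in H2, H3. lra.
      - apply Hloc; auto. intros y Hy. apply (ex_RInt_continuous (V := R_CompleteNormedModule)). intros u Hu.
        apply Hp; auto. }
    assert (Hmm : forall x, Rmin s2 s1 <= x <= Rmax s2 s1 -> a1 <= x <= a2).
    { intros x Hx. destruct (Rle_dec s2 s1).
      - rewrite Rmin_left, Rmax_right in Hx by lra. lra.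
      - rewrite Rmin_right, Rmax_left in Hx by lra. lra. }
    destruct (MVT_gen (fun s => RInt (fun u => p (f (u, (- s)%R))) (- b) b) s2 s1
      (fun s => q (f (b, (- s)%R)) - q (f ((- b)%R, (- s)%R)))) as [c [Hc1 Hc2]].
    - intros x Hx. apply Hder. assert (a1 <= x <= a2) by (apply Hmm; lra). lra.
    - intros x Hx. assert (a1 <= x <= a2) by (apply Hmm; lra).
      apply continuity_pt_filterlim.
      apply (ex_derive_continuous (K := R_AbsRing) (V := R_NormedModule)
        (fun s => RInt (fun u => p (f (u, (- s)%R))) (- b) b) x).
      eexists. apply Hder. lra.
    - rewrite Hc2, Rabs_mult. apply Hmm in Hc1. destruct (HM c Hc1) as [M1 M2].
      assert (Rabs (q (f (b, (- c)%R)) - q (f ((- b)%R, (- c)%R))) <= 2 * M).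
      { unfold Rminus. eapply Rle_trans; [apply Rabs_triang|]. rewrite Rabs_Ropp.
        pose proof (Hq (f (b, (- c)%R))). pose proof (Hq (f ((- b)%R, (- c)%R))). lra. }
      assert (Rabs (s1 - s2) <= 2) by (apply Rabs_le_between; lra).
      replace (4 * M) with ((2 * M) * 2) by ring.
      apply Rmult_le_compat; auto using Rabs_pos. }
  rewrite !CInt_parts by (apply Hcont; lra).
  replace (8 * M) with (4 * M + 4 * M) by ring. apply Cmod_le_parts.
  - change (Rabs (RInt (fun u => Re (f (u, (- s1)%R))) (- b) b
       - RInt (fun u => Re (f (u, (- s2)%R))) (- b) b) <= 4 * M).
    apply (Hkey Re Im Im).
    + apply im_le_Cmod.
    + intros u s Hu Hs. apply Hol_is_derive_vertical, Hf; auto.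
    + intros u s Hu Hs. apply Hol_is_derive_horizontal, Hf; auto.
    + intros u s Hu Hs. apply (Hol_derivative_2d f f'), Hf; auto.
    + intros u s Hu Hs. apply (Ccont_Re (fun u => f (u, (- s)%R))), (Hol_Ccont f f'), Hf; auto.
  - change (Rabs (RInt (fun u => Im (f (u, (- s1)%R))) (- b) b
       - RInt (fun u => Im (f (u, (- s2)%R))) (- b) b) <= 4 * M).
    apply (Hkey Im (fun z => - Re z) (fun z => - Re z)).
    + intros z. rewrite Rabs_Ropp. apply re_le_Cmod.
    + intros u s Hu Hs. apply Hol_is_derive_vertical, Hf; auto.
    + intros u s Hu Hs. apply (is_derive_opp (V := R_NormedModule) (fun u => Re (f (u, (- s)%R)))).
      apply Hol_is_derive_horizontal, Hf; auto.
    + intros u s Hu Hs. apply continuity_2d_pt_opp, (Hol_derivative_2d f f'), Hf; auto.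
    + intros u s Hu Hs. apply (Ccont_Im (fun u => f (u, (- s)%R))), (Hol_Ccont f f'), Hf; auto.
Qed.

Lemma Ccont_uniform_limit (f : R -> C) (u d : R) : 0 < d ->
  (forall eps, 0 < eps -> exists g, Ccont g u /\
     forall v, Rabs (v - u) < d -> Cmod (f v - g v)%C <= eps) -> Ccont f u.
Proof.
  intros Hd H eps He. destruct (H (eps / 3) ltac:(lra)) as (g & Hg & HH).
  destruct (Hg (eps / 3) ltac:(lra)) as (d' & Hd' & Hgd).
  exists (Rmin d d'). split; [apply Rmin_pos; auto|]. intros v Hv.
  assert (H1 := Rlt_le_trans _ _ _ Hv (Rmin_l _ _)).
  assert (H2 := Rlt_le_trans _ _ _ Hv (Rmin_r _ _)).
  replace (f v - f u)%C with ((f v - g v) + (g v - g u) - (f u - g u))%C by ring.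
  eapply Rle_trans; [apply Cmod_minus_le|].
  eapply Rle_trans; [apply Rplus_le_compat_r, Cmod_triangle|].
  specialize (Hgd v H2). assert (E1 := HH v H1). assert (E2 := HH u).
  rewrite Rminus_diag, Rabs_R0 in E2. specialize (E2 Hd). lra.
Qed.

(** The approximants are holomorphic on the whole open strip, but need to be close to [f] only on
    the smaller box, where the kernel is bounded. This form makes it unnecessary to show that a
    uniform limit of holomorphic functions is holomorphic. *)
Definition Hol_limit (f : C -> C) (b a1 a2 : R) : Prop :=
  forall eps, 0 < eps -> exists g g' : C -> C,
    (forall u s, Rabs u < b + 1 -> 0 < s < 2 -> Hol g g' (u, (- s)%R)) /\
    (forall z, box b a1 a2 z -> Cmod (f z - g z)%C <= eps).

Lemma Hol_limit_Ccont (f : C -> C) (b a1 a2 u s : R) : 0 < a1 -> a2 < 2 ->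
  Hol_limit f b a1 a2 -> Rabs u < b + 1 -> a1 <= s <= a2 ->
  Ccont (fun u => f (u, (- s)%R)) u.
Proof.
  intros Ha1 Ha2 Hf Hu Hs. apply Ccont_uniform_limit with (d := b + 1 - Rabs u); [lra|].
  intros eps He. destruct (Hf eps He) as (g & g' & Hg & Hfg).
  exists (fun u => g (u, (- s)%R)). split.
  - apply (Hol_Ccont g g'), Hg; auto. lra.
  - intros v Hv. apply Hfg. split; simpl.
    + replace v with (u + (v - u)) by ring.
      eapply Rle_lt_trans; [apply Rabs_triang|]. lra.
    + lra.
Qed.

Lemma Hol_limit_horizontal_integral (f : C -> C) (b a1 a2 M : R) :
  0 <= b -> 0 < a1 -> a2 < 2 -> Hol_limit f b a1 a2 ->
  (forall s, a1 <= s <= a2 -> Cmod (f (b, (- s)%R)) <= M /\ Cmod (f ((- b)%R, (- s)%R)) <= M) ->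
  forall s1 s2, a1 <= s1 <= a2 -> a1 <= s2 <= a2 ->
  Cmod (CInt (fun u => f (u, (- s1)%R)) (- b) b - CInt (fun u => f (u, (- s2)%R)) (- b) b)%C
    <= 8 * M.
Proof.
  intros Hb Ha1 Ha2 Hf HM s1 s2 Hs1 Hs2.
  apply le_epsilon. intros e He.
  (* Replacing [f] by [g] costs 2 b e' on each of the two horizontal segments and 8 e' through the
     bound on the sides. *)
  set (e' := e / (8 + 4 * b)).
  assert (He' : 0 < e') by (apply Rdiv_lt_0_compat; lra).
  destruct (Hf e' He') as (g & g' & Hg & Hfg).
  assert (Hin : forall u, - b <= u <= b -> Rabs u < b + 1)
    by (intros u Hu; apply Rabs_lt_between; lra).
  assert (Hcl : forall s, a1 <= s <= a2 ->
    Cmod (CInt (fun u => f (u, (- s)%R)) (- b) b - CInt (fun u => g (u, (- s)%R)) (- b) b)%C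
      <= (b - - b) * e').
  { intros s Hs.
    assert (Cf : forall u, - b <= u <= b -> Ccont (fun u => f (u, (- s)%R)) u).
    { intros u Hu. apply (Hol_limit_Ccont f b a1 a2); auto. }
    assert (Cg : forall u, - b <= u <= b -> Ccont (fun u => g (u, (- s)%R)) u).
    { intros u Hu. apply (Hol_Ccont g g'), Hg; auto. lra. }
    rewrite CInt_minus by (auto; lra).
    apply CInt_bound_const; [lra | intros; apply Ccont_minus; auto |].
    intros u Hu. apply Hfg. split; simpl; auto. lra. }
  assert (Hgs := Hol_horizontal_integral g g' b a1 a2 (M + e') Hb Ha1 Ha2 Hg).
  assert (Hgm : forall s, a1 <= s <= a2 ->
     Cmod (g (b, (- s)%R)) <= M + e' /\ Cmod (g ((- b)%R, (- s)%R)) <= M + e').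
  { intros s Hs. destruct (HM s Hs) as [M1 M2].
    assert (E1 := Hfg (b, (- s)%R)). assert (E2 := Hfg ((- b)%R, (- s)%R)).
    assert (B1 : box b a1 a2 (b, (- s)%R)) by (split; simpl; [apply Hin; lra|lra]).
    assert (B2 : box b a1 a2 ((- b)%R, (- s)%R)) by (split; simpl; [apply Hin; lra|lra]).
    specialize (E1 B1). specialize (E2 B2). split.
    - replace (g (b, (- s)%R)) with (f (b, (- s)%R) - (f (b, (- s)%R) - g (b, (- s)%R)))%C by ring.
      eapply Rle_trans; [apply Cmod_minus_le|]. lra.
    - replace (g ((- b)%R, (- s)%R)) with (f ((- b)%R, (- s)%R) - (f ((- b)%R, (- s)%R) - g ((- b)%R, (- s)%R)))%C by ring.
      eapply Rle_trans; [apply Cmod_minus_le|]. lra. }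
  specialize (Hgs Hgm s1 s2 Hs1 Hs2).
  assert (D1 := Hcl s1 Hs1). assert (D2 := Hcl s2 Hs2).
  set (f1 := CInt (fun u => f (u, (- s1)%R)) (- b) b) in *.
  set (f2 := CInt (fun u => f (u, (- s2)%R)) (- b) b) in *.
  set (g1 := CInt (fun u => g (u, (- s1)%R)) (- b) b) in *.
  set (g2 := CInt (fun u => g (u, (- s2)%R)) (- b) b) in *.
  replace (f1 - f2)%C with ((f1 - g1) + (g1 - g2) - (f2 - g2))%C by ring.
  eapply Rle_trans; [apply Cmod_minus_le|].
  eapply Rle_trans; [apply Rplus_le_compat_r, Cmod_triangle|].
  assert (e' * (8 + 4 * b) = e) by (unfold e'; field; lra).
  lra.
Qed.

(** * Series *)

Lemma INR_S_ge_1 (n : nat) : 1 <= INR (S n).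
Proof. rewrite S_INR. pose proof (pos_INR n). lra. Qed.

(** Gives convergence and an explicit bound together; [v] plays the part of a tail integral. The
    sums of powers, of 1 / (k^2 + y^2) and of the harmonic defect are all bounded this way. *)
Lemma ex_series_nonneg_telescope (a v : nat -> R) :
  (forall n, 0 <= a n) -> (forall n, 0 <= v n) ->
  (forall n, a n <= v n - v (S n)) ->
  ex_series a /\ Series a <= v 0%nat.
Proof.
  intros Ha Hv H.
  assert (HS : forall n, sum_n a n <= v 0%nat - v (S n)).
  { induction n as [|n IH].
    - rewrite sum_O. apply H.
    - rewrite sum_Sn. unfold plus; simpl. specialize (H (S n)). lra. }
  assert (Hex : ex_series a).
  { apply ex_finite_lim_seq_incr with (M := v 0%nat).
    - intros n. rewrite sum_Sn. change (sum_n a n <= sum_n a n + a (S n)).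
      specialize (Ha (S n)). lra.
    - intros n. specialize (HS n). specialize (Hv (S n)). apply Rle_trans with (v 0%nat - v (S n)); [exact HS | lra]. }
  split; auto.
  assert (HL := Series_correct a Hex).
  apply (is_lim_seq_le (sum_n a) (fun _ => v 0%nat) (Series a) (v 0%nat)).
  - intros n. specialize (Hv (S n)).
    apply Rle_trans with (v 0%nat - v (S n)); [exact (HS n) | lra].
  - exact HL.
  - apply is_lim_seq_const.
Qed.

Lemma Series_nonneg (a : nat -> R) : (forall n, 0 <= a n) -> ex_series a -> 0 <= Series a.
Proof.
  intros Ha Hex.
  replace 0 with (Series (fun _ => 0 * 0)).
  - apply Series_le; auto. intros n. split; [lra|]. rewrite Rmult_0_l; auto.
  - rewrite Series_scal_l. ring.
Qed.

Lemma Rpower_succ_le (x a : R) : 0 < a -> 0 < x ->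
  Rpower (x + 1) (- (1 + a)) <= / a * Rpower x (- a) - / a * Rpower (x + 1) (- a).
Proof.
  intros Ha Hx.
  destruct (MVT_gen (fun u => Rpower u (- a)) x (x + 1) (fun u => - a * Rpower u (- a - 1)))
    as [c [Hc E]].
  - intros u Hu. rewrite Rmin_left in Hu by lra.
    apply is_derive_Reals. apply derivable_pt_lim_power. lra.
  - intros u Hu. rewrite Rmin_left in Hu by lra.
    apply derivable_continuous_pt. eexists. apply derivable_pt_lim_power. lra.
  - rewrite Rmin_left, Rmax_right in Hc by lra.
    replace (/ a * Rpower x (- a) - / a * Rpower (x + 1) (- a))
      with (- / a * (Rpower (x + 1) (- a) - Rpower x (- a))) by ring.
    rewrite E.
    replace (- / a * (- a * Rpower c (- a - 1) * (x + 1 - x))) with (Rpower c (- a - 1)) by (field; lra).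
    replace (- (1 + a)) with (- (a + 1)) by ring. replace (- a - 1) with (- (a + 1)) by ring.
    rewrite !Rpower_Ropp. apply Rinv_le_contravar; [apply exp_pos|].
    apply Rle_Rpower_l; lra.
Qed.

Lemma p_series (a : R) : 0 < a ->
  ex_series (fun n => Rpower (INR (S n)) (- (1 + a))) /\
  Series (fun n => Rpower (INR (S n)) (- (1 + a))) <= 1 + / a.
Proof.
  intros Ha.
  assert (Hp : forall n, 0 <= Rpower (INR (S n)) (- (1 + a))) by (intros; apply Rlt_le, exp_pos).
  assert (Hia : 0 < / a) by (apply Rinv_0_lt_compat; auto).
  (* The first term equals 1 and is paid by the special value at 0; the later terms telescope
     against the primitive of u^(-1-a). *)
  destruct (ex_series_nonneg_telescope (fun n => Rpower (INR (S n)) (- (1 + a)))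
    (fun n => match n with O => 1 + / a | S m => / a * Rpower (INR (S m)) (- a) end)); auto.
  - intros [|n]; [lra|]. apply Rmult_le_pos; [lra|]. apply Rlt_le, exp_pos.
  - intros [|n].
    + change (INR 1) with 1.  unfold Rpower. rewrite ln_1, !Rmult_0_r, exp_0. lra.
    + rewrite (S_INR (S n)). apply Rpower_succ_le; auto.
      pose proof (INR_S_ge_1 n). lra.
Qed.

Lemma ex_series_inv_sqr : ex_series (fun n => / INR (S n) ^ 2).
Proof.
  apply ex_series_ext with (2 := proj1 (p_series 1 Rlt_0_1)).
  intros n. pose proof (INR_S_ge_1 n).
  rewrite Rpower_Ropp. replace (1 + 1) with (INR 2) by (simpl; ring).
  rewrite Rpower_pow by lra. reflexivity.
Qed.

(** Since 2 ((k + 1)^2 + y^2) >= (k + 1 + y)^2 >= (k + y)(k + 1 + y), the terms telescope against 2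
    / (k + y). The decay in [y] is the point: it yields theta'' = O(1/t) and one of the two powers
    of 1/t in the Taylor remainder. *)
Lemma Series_inv_sqr_shift (y : R) : 0 < y ->
  ex_series (fun n => / (INR (S n) ^ 2 + y ^ 2)) /\
  Series (fun n => / (INR (S n) ^ 2 + y ^ 2)) <= 2 / y.
Proof.
  intros Hy.
  assert (Hk : forall n : nat, 0 <= INR n) by apply pos_INR.
  replace (2 / y) with (2 / (INR 0 + y)) by (simpl; f_equal; ring).
  apply (ex_series_nonneg_telescope _ (fun n => 2 / (INR n + y))).
  - intros n. apply Rlt_le, Rinv_0_lt_compat. pose proof (INR_S_ge_1 n). nra.
  - intros n. specialize (Hk n). apply Rlt_le, Rdiv_lt_0_compat; lra.
  - intros n. specialize (Hk n). rewrite S_INR. set (k := INR n) in *.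
    replace (2 / (k + y) - 2 / (k + 1 + y)) with (/ ((k + y) * (k + 1 + y) / 2)) by (field; lra).
    apply Rinv_le_contravar; [|pose proof (pow2_ge_0 (k + 1 - y)); nra].
    apply Rdiv_lt_0_compat; [|lra]. apply Rmult_lt_0_compat; lra.
Qed.

(** * Complex series by components, partial sums and tails *)

Definition CSer (a : nat -> C) (l : C) : Prop :=
  is_series (fun n => Re (a n)) (Re l) /\ is_series (fun n => Im (a n)) (Im l).

Lemma CSer_unique (a : nat -> C) (l : C) : CSer a l -> Cseries a = l.
Proof.
  intros [H1 H2]. unfold Cseries. apply C_eq; simpl; apply is_series_unique; auto.
Qed.

Lemma CSer_ext (a b : nat -> C) (l : C) : (forall n, a n = b n) -> CSer a l -> CSer b l.
Proof.
  intros E [H1 H2]. split; [eapply is_series_ext; [|exact H1] | eapply is_series_ext; [|exact H2]];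
  intros n; simpl; now rewrite E.
Qed.

Lemma CSer_plus (a b : nat -> C) (l m : C) : CSer a l -> CSer b m ->
  CSer (fun n => a n + b n)%C (l + m)%C.
Proof.
  intros [H1 H2] [H3 H4]. split.
  - apply (is_series_plus _ _ _ _ H1 H3).
  - apply (is_series_plus _ _ _ _ H2 H4).
Qed.

Lemma CSer_scal (c : C) (a : nat -> C) (l : C) : CSer a l -> CSer (fun n => c * a n)%C (c * l)%C.
Proof.
  intros [H1 H2]. split.
  - apply (is_series_minus _ _ _ _ (is_series_scal_l (Re c) _ _ H1) (is_series_scal_l (Im c) _ _ H2)).
  - apply (is_series_plus _ _ _ _ (is_series_scal_l (Re c) _ _ H2) (is_series_scal_l (Im c) _ _ H1)).
Qed.

Lemma CSer_minus (a b : nat -> C) (l m : C) : CSer a l -> CSer b m ->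
  CSer (fun n => a n - b n)%C (l - m)%C.
Proof.
  intros H1 H2. apply (CSer_scal (-1)%C) in H2.
  assert (H := CSer_plus _ _ _ _ H1 H2).
  replace (l - m)%C with (l + -1 * m)%C by ring.
  eapply CSer_ext; [|exact H]. intros n; simpl; ring.
Qed.

Lemma CSer_RtoC (a : nat -> R) : ex_series a -> CSer (fun n => RtoC (a n)) (RtoC (Series a)).
Proof.
  intros H. split; simpl.
  - apply Series_correct, H.
  - assert (H0 := is_series_scal_l 0 _ _ (Series_correct a H)).
    change (is_series (fun n => 0 * a n) (0 * Series a)) in H0. rewrite Rmult_0_l in H0.
    eapply is_series_ext; [|exact H0]. intros n. change (0 * a n = 0). ring.
Qed.

Lemma CSer_dominated (a : nat -> C) (g : nat -> R) :
  (forall n, Cmod (a n) <= g n) -> ex_series g ->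
  CSer a (Cseries a) /\ Cmod (Cseries a) <= 2 * Series g.
Proof.
  intros H Hg.
  assert (HR : forall n, Rabs (Re (a n)) <= g n)
    by (intros; eapply Rle_trans; [apply re_le_Cmod|apply H]).
  assert (HI : forall n, Rabs (Im (a n)) <= g n)
    by (intros; eapply Rle_trans; [apply im_le_Cmod|apply H]).
  assert (ER : ex_series (fun n => Rabs (Re (a n)))).
  { apply (ex_series_le (V := R_CompleteNormedModule)) with g; auto. intros n.
    unfold norm; simpl; unfold abs; simpl. rewrite Rabs_Rabsolu. auto. }
  assert (EI : ex_series (fun n => Rabs (Im (a n)))).
  { apply (ex_series_le (V := R_CompleteNormedModule)) with g; auto. intros n.
    unfold norm; simpl; unfold abs; simpl. rewrite Rabs_Rabsolu. auto. }
  split.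
  - split; simpl; apply Series_correct, ex_series_Rabs; auto.
  - replace (2 * Series g) with (Series g + Series g) by ring.
    apply Cmod_le_parts; simpl.
    + eapply Rle_trans; [apply Series_Rabs, ER|].
      apply Series_le; auto. intros n; split; auto using Rabs_pos.
    + eapply Rle_trans; [apply Series_Rabs, EI|].
      apply Series_le; auto. intros n; split; auto using Rabs_pos.
Qed.

(** Unlike [sum_n], the index counts the terms and the empty sum is allowed, so the rest after
    [csum a N] starts exactly at index N. *)
Fixpoint csum (a : nat -> C) (N : nat) : C :=
  match N with O => RtoC 0 | S n => (csum a n + a n)%C end.

Lemma csum_S (a : nat -> C) (N : nat) : csum a (S N) = (csum a N + a N)%C.
Proof. reflexivity. Qed.

Lemma csum_shift (a : nat -> C) (N : nat) : csum a (S N) = (a 0%nat + csum (fun n => a (S n)) N)%C.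
Proof.
  induction N as [|N IH]; [simpl; ring|].
  change (csum a (S (S N))) with (csum a (S N) + a (S N))%C.
  rewrite IH. simpl. ring.
Qed.

Lemma Cseries_tail (a : nat -> C) (g : nat -> R) (N : nat) :
  (forall n, Cmod (a n) <= g n) -> ex_series g ->
  Cmod (Cseries a - csum a N)%C <= 2 * Series (fun k => g (N + k)%nat).
Proof.
  revert a g. induction N as [|N IH]; intros a g H Hg.
  - simpl csum. replace (Cseries a - 0)%C with (Cseries a) by ring.
    apply CSer_dominated; auto.
  - rewrite csum_shift.
    assert (Hg' : ex_series (fun n => g (S n))) by (apply (proj1 (ex_series_incr_1 (K := R_AbsRing) (V := R_NormedModule) g)); auto).
    destruct (CSer_dominated a g H Hg) as [[H1 H2] _].
    assert (E : Cseries a = (a 0%nat + Cseries (fun n => a (S n)))%C).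
    { unfold Cseries. apply C_eq; simpl; apply Series_incr_1; eexists; eauto. }
    rewrite E.
    replace (_ - _)%C with (Cseries (fun n => a (S n)) - csum (fun n => a (S n)) N)%C by ring.
    eapply Rle_trans; [apply (IH _ (fun n => g (S n))); auto|]. apply Rle_refl.
Qed.

Lemma Series_tail_small (g : nat -> R) (eps : R) : ex_series g -> 0 < eps ->
  exists N, Series (fun k => g (N + k)%nat) <= eps.
Proof.
  intros Hg He. assert (HL := Series_correct g Hg).
  change (is_lim_seq (sum_n g) (Series g)) in HL. apply is_lim_seq_spec in HL. destruct (HL (mkposreal eps He)) as [N HN].
  (* [sum_n g N] has N + 1 terms, hence the tail starts at S N. *)
  exists (S N). specialize (HN N (Nat.le_refl N)). simpl in HN.
  rewrite (Series_incr_n g (S N)) in HN by (auto; lia).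
  simpl pred in HN. rewrite sum_n_Reals in HN.
  apply Rabs_lt_between in HN. lra.
Qed.

(** * Increments of the logarithm of the Gamma function *)

Lemma Cmod_ge_INR (w : C) (n : nat) : 0 <= Re w -> INR (S n) <= Cmod (w + RtoC (INR (S n)))%C.
Proof.
  intros H. eapply Rle_trans; [|apply re_le_Cmod]. rewrite Cplus_RtoC_Re.
  pose proof (INR_S_ge_1 n). rewrite Rabs_right; lra.
Qed.

Lemma RtoC_neq_0 (x : R) : x <> 0 -> RtoC x <> RtoC 0.
Proof. intros H E. apply H. now inversion E. Qed.

Lemma RtoC_INR_S_neq_0 (n : nat) : RtoC (INR (S n)) <> RtoC 0.
Proof. apply RtoC_neq_0. pose proof (INR_S_ge_1 n). lra. Qed.

Definition logGamma_term (w : C) (n : nat) : C :=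
  let k := RtoC (INR (S n)) in (w / k - Clog (1 + w / k))%C.

Lemma logGamma_eq (w : C) :
  logGamma w = (RtoC (- euler_gamma) * w - Clog w + Cseries (logGamma_term w))%C.
Proof. reflexivity. Qed.

(** For Re w >= 0 the quotient w/k has nonnegative real part, so the linear bound of the logarithm
    applies to every k, however large |w| is, and the terms are O(|w|^2 / k^2). *)
Lemma CSer_logGamma_term (w : C) : 0 <= Re w -> CSer (logGamma_term w) (Cseries (logGamma_term w)).
Proof.
  intros Hw. apply (CSer_dominated _ (fun n => 2 * Cmod w ^ 2 * / INR (S n) ^ 2)).
  - intros n. unfold logGamma_term. cbv zeta. pose proof (INR_S_ge_1 n).
    rewrite Cmod_minus_sym.
    eapply Rle_trans; [apply Clog_1p_linear_Re_nonneg|].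
    + replace (w / RtoC (INR (S n)))%C with (RtoC (/ INR (S n)) * w)%C
        by (rewrite RtoC_inv by lra; field; apply RtoC_INR_S_neq_0).
      replace (Re (RtoC (/ INR (S n)) * w)%C) with (/ INR (S n) * Re w)
        by (unfold Re; simpl; ring).
      apply Rmult_le_pos; auto. apply Rlt_le, Rinv_0_lt_compat. lra.
    + rewrite Cmod_div by apply RtoC_INR_S_neq_0.
      rewrite Cmod_R, Rabs_right by lra. right. field. lra.
  - apply (ex_series_scal_l (K := R_AbsRing) (V := R_NormedModule)), ex_series_inv_sqr.
Qed.

(** Each Weierstrass factor splits as 1 + (w + h)/k = (1 + w/k)(1 + h/(w + k)), and the hypothesis
    on [h] keeps h/(w + k) in the disc of radius 1/2, so [Clog_mult] applies. The series itself
    serves the Taylor expansion of theta, the bound of [L] the continuity of [logGamma]. *)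
Lemma logGamma_increment (w h : C) : 0 < Re w ->
  (forall k : nat, 2 * Cmod h <= Cmod (w + RtoC (INR k))%C) ->
  exists L : C,
    CSer (fun n => h / RtoC (INR (S n)) - Clog (1 + h / (w + RtoC (INR (S n)))))%C L /\
    (logGamma (w + h) - logGamma w)%C
      = (- RtoC euler_gamma * h - Clog (1 + h / w) + L)%C /\
    Cmod L <= 2 * (Cmod h * (Cmod w + 4 * Cmod h) * Series (fun n => / INR (S n) ^ 2)).
Proof.
  intros Hw Hh.
  set (T := fun n => (h / RtoC (INR (S n)) - Clog (1 + h / (w + RtoC (INR (S n)))))%C).
  assert (HW : forall k : nat, 0 < Cmod (w + RtoC (INR k))%C).
  { intros k. apply Cmod_gt_0, Re_pos_neq_0. rewrite Cplus_RtoC_Re.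
    pose proof (pos_INR k). lra. }
  assert (Hz : forall k : nat, Cmod (h / (w + RtoC (INR k)))%C <= / 2).
  { intros k. rewrite Cmod_div by (apply Cmod_gt_0, HW).
    apply Rmult_le_reg_r with (Cmod (w + RtoC (INR k))%C); auto.
    specialize (Hh k). specialize (HW k).
    replace (Cmod h / Cmod (w + RtoC (INR k)) * Cmod (w + RtoC (INR k))) with (Cmod h) by (field; lra).
    lra. }
  assert (HRe : forall k : nat, 0 < Re (1 + h / (w + RtoC (INR k)))%C).
  { intros k. specialize (Hz k). apply Re_ge_of_Cmod_le in Hz.
    change (0 < 1 + Re (h / (w + RtoC (INR k)))%C). lra. }
  assert (HT : forall n, Cmod (T n) <= Cmod h * (Cmod w + 4 * Cmod h) * / INR (S n) ^ 2).
  { intros n. unfold T. pose proof (INR_S_ge_1 n) as Hn.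
    assert (N1 := RtoC_INR_S_neq_0 n).
    assert (N2 : (w + RtoC (INR (S n)))%C <> 0) by (apply Cmod_gt_0, HW).
    assert (Hge := Cmod_ge_INR w n ltac:(lra)).
    set (k := INR (S n)) in *. set (W := (w + RtoC k)%C) in *.
    (* The difference h/k - h/W equals h w / (k W), which already has size 1/k^2; what remains is
       the quadratic error of the logarithm. *)
    replace (h / RtoC k - Clog (1 + h / W))%C with
      (h * w / (RtoC k * W) - (Clog (1 + h / W) - h / W))%C by (unfold W; field; auto).
    eapply Rle_trans; [apply Cmod_minus_le|].
    assert (H1 := Clog_1p_linear_small (h / W)%C (Hz (S n))).
    rewrite Cmod_div in H1 by auto.
    rewrite Cmod_div by (apply Cmult_neq_0; auto). rewrite !Cmod_mult, Cmod_R, Rabs_right by lra.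
    pose proof (Cmod_ge_0 h). pose proof (Cmod_ge_0 w).
    assert (I1 : / (k * Cmod W) <= / k ^ 2) by (apply Rinv_le_contravar; nra).
    assert (I2 : (/ Cmod W) ^ 2 <= / k ^ 2).
    { rewrite pow_inv. apply Rinv_le_contravar; [nra|]. apply pow_incr; lra. }
    unfold Rdiv in *. rewrite Rpow_mult_distr in H1.
    assert (0 <= Cmod h * Cmod w) by nra.
    assert (0 <= Cmod h ^ 2) by apply pow2_ge_0.
    assert (J1 := Rmult_le_compat_l _ _ _ H2 I1).
    assert (J2 := Rmult_le_compat_l _ _ _ H3 I2). nra. }
  assert (Hex : ex_series (fun n => Cmod h * (Cmod w + 4 * Cmod h) * / INR (S n) ^ 2)).
  { apply (ex_series_scal_l (K := R_AbsRing) (V := R_NormedModule)), ex_series_inv_sqr. }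
  destruct (CSer_dominated T _ HT Hex) as [HS HB].
  rewrite Series_scal_l in HB.
  exists (Cseries T). split; [exact HS|]. split; [|exact HB].
  assert (H1 := CSer_logGamma_term w ltac:(lra)).
  assert (H2 := CSer_plus _ _ _ _ H1 HS).
  assert (H3 : CSer (logGamma_term (w + h)) (Cseries (logGamma_term w) + Cseries T)%C).
  { eapply CSer_ext; [|exact H2]. intros n. simpl. unfold T, logGamma_term. cbv zeta.
    assert (N1 := RtoC_INR_S_neq_0 n).
    assert (N2 : (w + RtoC (INR (S n)))%C <> 0) by (apply Cmod_gt_0, HW).
    replace (1 + (w + h) / RtoC (INR (S n)))%C with
      ((1 + w / RtoC (INR (S n))) * (1 + h / (w + RtoC (INR (S n)))))%C by (field; auto).
    rewrite Clog_mult; auto.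
    - field; auto.
    - replace (1 + w / RtoC (INR (S n)))%C with (1 + RtoC (/ INR (S n)) * w)%C.
      2:{ rewrite RtoC_inv by (pose proof (INR_S_ge_1 n); lra). field; auto. }
      replace (Re (1 + RtoC (/ INR (S n)) * w)%C) with (1 + / INR (S n) * Re w)
        by (unfold Re; simpl; ring).
      assert (0 < / INR (S n)) by (apply Rinv_0_lt_compat; pose proof (INR_S_ge_1 n); lra).
      nra. }
  apply CSer_unique in H3. rewrite !logGamma_eq.
  rewrite H3.
  assert (E0 : (w + RtoC (INR 0))%C = w) by (simpl; ring).
  assert (N0 : w <> 0) by (apply Re_pos_neq_0; auto).
  replace (Clog (w + h)) with (Clog w + Clog (1 + h / w))%C.
  2:{ rewrite <- Clog_mult; auto.
      - f_equal. field; auto.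
      - specialize (HRe 0%nat). rewrite E0 in HRe. exact HRe. }
  rewrite RtoC_opp. ring.
Qed.

(** * Taylor expansion of the Riemann-Siegel theta function *)

(* [inv_re a y] is the real part of [1 / (a + i y)], and [- 2 * inv_sqr_im a y] is the
   imaginary part of [1 / (a + i y)^2]. *)
Definition inv_re (a y : R) : R := a / (a ^ 2 + y ^ 2).
Definition inv_sqr_im (a y : R) : R := a * y / (a ^ 2 + y ^ 2) ^ 2.

(** This is theta'(t) = Re psi(1/4 + it/2) / 2 - (ln PI) / 2, with the digamma function psi written
    as its series - gamma - 1/w + sum (1/k - 1/(w + k)). *)
Definition theta1 (t : R) : R :=
  / 2 * (- euler_gamma - inv_re (1 / 4) (t / 2)
         + Series (fun n => / INR (S n) - inv_re (1 / 4 + INR (S n)) (t / 2))) - ln PI / 2.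

(** This is theta''(t) = - Im psi'(1/4 + it/2) / 4, where psi' is the sum of 1/(w + k)^2. *)
Definition theta2 (t : R) : R :=
  / 2 * (inv_sqr_im (1 / 4) (t / 2) + Series (fun n => inv_sqr_im (1 / 4 + INR (S n)) (t / 2))).

(** The k-th pole of Gamma(1/4 + iz/2), as a function of z, lies at distance 2 |[pole t k]| from t;
    the conjugate plays the same part for Gamma(1/4 - iz/2). A condition |x| <= |[pole t k]|
    therefore keeps t + x within half that distance. *)
Definition pole (t : R) (k : nat) : C := (1 / 4 + INR k, t / 2).

Definition log_rem (z : C) : C := (Clog (1 + z) - (z - z * z / 2))%C.

Definition theta_rem (t : R) (k : nat) (x : C) : C :=
  ((log_rem (- (Ci * x / 2) / Cconj (pole t k)) - log_rem (Ci * x / 2 / pole t k)) / 2)%C.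

Lemma sum_sqr_pos (a y : R) : 0 < a -> 0 < a ^ 2 + y ^ 2.
Proof. intros Ha. pose proof (pow2_ge_0 y). nra. Qed.

Lemma quarter_pos (k : nat) : 0 < 1 / 4 + INR k.
Proof. pose proof (pos_INR k). lra. Qed.

Lemma pole_neq_0 (t : R) (k : nat) : pole t k <> 0.
Proof. apply Re_pos_neq_0. apply quarter_pos. Qed.

Lemma Cconj_pole_neq_0 (t : R) (k : nat) : Cconj (pole t k) <> 0.
Proof. apply Re_pos_neq_0. apply quarter_pos. Qed.

Lemma Cmod_pole_ge (t : R) (k : nat) : 1 / 4 + INR k <= Cmod (pole t k).
Proof.
  eapply Rle_trans; [|apply re_le_Cmod]. simpl. apply Rle_abs.
Qed.

Lemma Cmod_pole_ge_im (t : R) (k : nat) : t / 2 <= Cmod (pole t k).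
Proof.
  eapply Rle_trans; [|apply im_le_Cmod]. simpl. apply Rle_abs.
Qed.

(** Here and in [pole_inv_sqr_im] real quantities become rational functions of the pole and its
    conjugate. Treated as independent variables, these turn the identity for one term into a task
    for [field]. *)
Lemma pole_inv_re (t : R) (k : nat) :
  RtoC (inv_re (1 / 4 + INR k) (t / 2))
  = ((pole t k + Cconj (pole t k)) / (2 * (pole t k * Cconj (pole t k))))%C.
Proof.
  pose proof (sum_sqr_pos _ (t / 2) (quarter_pos k)) as H.
  unfold inv_re. rewrite RtoC_div by lra.
  set (W := pole t k). set (W' := Cconj W).
  assert (E1 : RtoC (1 / 4 + INR k) = ((W + W') / 2)%C).
  { apply C_eq; unfold W, W', pole, Re, Im; simpl; field. }
  assert (E2 : RtoC ((1 / 4 + INR k) ^ 2 + (t / 2) ^ 2) = (W * W')%C).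
  { apply C_eq; unfold W, W', pole, Re, Im; simpl; ring. }
  rewrite E1, E2. field. split; [apply Cconj_pole_neq_0 | apply pole_neq_0].
Qed.

Lemma pole_inv_sqr_im (t : R) (k : nat) :
  (Ci * RtoC (inv_sqr_im (1 / 4 + INR k) (t / 2)))%C
  = ((pole t k + Cconj (pole t k)) * (pole t k - Cconj (pole t k))
     / (4 * (pole t k * Cconj (pole t k)) * (pole t k * Cconj (pole t k))))%C.
Proof.
  pose proof (sum_sqr_pos _ (t / 2) (quarter_pos k)) as H.
  unfold inv_sqr_im. rewrite RtoC_div by (apply pow_nonzero; lra).
  set (W := pole t k). set (W' := Cconj W).
  assert (E1 : (Ci * RtoC ((1 / 4 + INR k) * (t / 2)))%C = ((W + W') * (W - W') / 4)%C).
  { apply C_eq; unfold W, W', pole, Re, Im; simpl; field. }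
  assert (E2 : RtoC (((1 / 4 + INR k) ^ 2 + (t / 2) ^ 2) ^ 2) = (W * W' * (W * W'))%C).
  { apply C_eq; unfold W, W', pole, Re, Im; simpl; ring. }
  rewrite E2. unfold Cdiv at 1. rewrite Cmult_assoc, E1.
  assert (N1 : W <> 0) by apply pole_neq_0. assert (N2 : W' <> 0) by apply Cconj_pole_neq_0.
  field. auto.
Qed.

(** The two logarithms carry opposite signs and conjugate denominators: in first order the
    reciprocals average to a real part, and in second order the reciprocal squares subtract to an
    imaginary part. *)
Lemma theta_term_eq (t : R) (k : nat) (x : C) :
  let h := (Ci * x / 2)%C in
  ((- Clog (1 + h / pole t k) + Clog (1 + - h / Cconj (pole t k))) / 2)%C
  = (- RtoC (inv_re (1 / 4 + INR k) (t / 2)) * h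
     - Ci * RtoC (inv_sqr_im (1 / 4 + INR k) (t / 2)) * (h * h) + theta_rem t k x)%C.
Proof.
  cbv zeta. unfold theta_rem, log_rem. rewrite pole_inv_sqr_im, pole_inv_re.
  set (h := (Ci * x / 2)%C).
  generalize (Clog (1 + h / pole t k)) (Clog (1 + - h / Cconj (pole t k))). intros A B.
  pose proof (pole_neq_0 t k). pose proof (Cconj_pole_neq_0 t k).
  set (W := pole t k) in *. set (W' := Cconj W) in *. field. auto.
Qed.

Lemma ex_series_theta1 (y : R) :
  ex_series (fun n => / INR (S n) - inv_re (1 / 4 + INR (S n)) y).
Proof.
  apply (ex_series_le (V := R_CompleteNormedModule)) with (fun n => (1 + y ^ 2) * / INR (S n) ^ 2).
  - intros n. unfold norm; simpl; unfold abs; simpl.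
    change (Rabs (/ INR (S n) - inv_re (1 / 4 + INR (S n)) y) <= (1 + y ^ 2) * / INR (S n) ^ 2).
    pose proof (INR_S_ge_1 n) as Hk. set (k := INR (S n)) in *.
    pose proof (sum_sqr_pos (1 / 4 + k) y ltac:(lra)) as HA. pose proof (pow2_ge_0 y) as Hy.
    unfold inv_re.
    replace (/ k - (1 / 4 + k) / ((1 / 4 + k) ^ 2 + y ^ 2))
      with (((1 / 4 + k) / 4 + y ^ 2) * / (k * ((1 / 4 + k) ^ 2 + y ^ 2))) by (field; lra).
    assert (HB : 0 < k * ((1 / 4 + k) ^ 2 + y ^ 2)) by nra.
    rewrite Rabs_right by (apply Rle_ge, Rmult_le_pos; [lra | apply Rlt_le, Rinv_0_lt_compat; auto]).
    apply Rmult_le_reg_r with (k * ((1 / 4 + k) ^ 2 + y ^ 2)); auto.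
    rewrite Rmult_assoc, Rinv_l, Rmult_1_r by lra.
    replace ((1 + y ^ 2) * / k ^ 2 * (k * ((1 / 4 + k) ^ 2 + y ^ 2)))
      with ((1 + y ^ 2) * (((1 / 4 + k) ^ 2 + y ^ 2) / k)) by (field; lra).
    assert (HC : 1 / 4 + k <= ((1 / 4 + k) ^ 2 + y ^ 2) / k).
    { apply Rmult_le_reg_r with k; [lra|].
      replace (((1 / 4 + k) ^ 2 + y ^ 2) / k * k) with ((1 / 4 + k) ^ 2 + y ^ 2) by (field; lra). nra. }
    apply Rle_trans with ((1 + y ^ 2) * (1 / 4 + k)); [nra|].
    apply Rmult_le_compat_l; lra.
  - apply (ex_series_scal_l (K := R_AbsRing) (V := R_NormedModule)), ex_series_inv_sqr.
Qed.

Lemma inv_sqr_im_le (a y : R) : 0 < a -> Rabs (inv_sqr_im a y) <= / (a ^ 2 + y ^ 2).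
Proof.
  intros Ha. pose proof (sum_sqr_pos a y Ha) as H. unfold inv_sqr_im, Rdiv.
  rewrite Rabs_mult, (Rabs_right (/ (a ^ 2 + y ^ 2) ^ 2)).
  2:{ apply Rle_ge, Rlt_le, Rinv_0_lt_compat. apply pow_lt; auto. }
  replace (/ (a ^ 2 + y ^ 2)) with ((a ^ 2 + y ^ 2) * / (a ^ 2 + y ^ 2) ^ 2) by (field; lra).
  apply Rmult_le_compat_r; [apply Rlt_le, Rinv_0_lt_compat, pow_lt; auto|].
  apply Rabs_le_between.
  pose proof (pow2_ge_0 (a + y)). pose proof (pow2_ge_0 (a - y)). nra.
Qed.

Lemma inv_sqr_im_le_INR (n : nat) (y : R) :
  Rabs (inv_sqr_im (1 / 4 + INR (S n)) y) <= / (INR (S n) ^ 2 + y ^ 2).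
Proof.
  pose proof (INR_S_ge_1 n). pose proof (pow2_ge_0 y).
  eapply Rle_trans; [apply inv_sqr_im_le; lra|]. apply Rinv_le_contravar; nra.
Qed.

Lemma ex_series_theta2 (y : R) : ex_series (fun n => inv_sqr_im (1 / 4 + INR (S n)) y).
Proof.
  apply (ex_series_le (V := R_CompleteNormedModule)) with (fun n => / INR (S n) ^ 2).
  - intros n. eapply Rle_trans; [apply inv_sqr_im_le_INR|].
    pose proof (INR_S_ge_1 n). pose proof (pow2_ge_0 y). apply Rinv_le_contravar; nra.
  - apply ex_series_inv_sqr.
Qed.

Lemma log_rem_le (z : C) : Cmod z <= / 2 -> Cmod (log_rem z) <= 4 * Cmod z ^ 3.
Proof. apply Clog_1p_quadratic_small. Qed.

Lemma Cmod_half_Ci (x : C) : Cmod (Ci * x / 2)%C = Cmod x / 2.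
Proof.
  rewrite Cmod_div by (apply RtoC_neq_0; lra).
  rewrite Cmod_mult, Cmod_Ci, Cmod_R, Rabs_right by lra. field.
Qed.

Lemma pole_ratio_le (t : R) (k : nat) (x : C) : Cmod x <= Cmod (pole t k) ->
  Cmod (Ci * x / 2 / pole t k)%C <= / 2 /\ Cmod (- (Ci * x / 2) / Cconj (pole t k))%C <= / 2.
Proof.
  intros H. pose proof (proj1 (Cmod_gt_0 _) (pole_neq_0 t k)) as Hp.
  rewrite !Cmod_div by (try apply pole_neq_0; try apply Cconj_pole_neq_0; apply RtoC_neq_0; lra).
  rewrite Cmod_conj, Cmod_opp.
  replace (Cmod (Ci * x / 2)%C) with (Cmod x / 2) by (symmetry; apply Cmod_half_Ci).
  rewrite Cmod_mult, Cmod_Ci, Cmod_R, Rabs_right by lra.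
  assert (E : 1 * Cmod x / 2 / Cmod (pole t k) <= / 2).
  { apply Rmult_le_reg_r with (Cmod (pole t k)); auto.
    replace (1 * Cmod x / 2 / Cmod (pole t k) * Cmod (pole t k)) with (Cmod x / 2) by (field; lra). lra. }
  split; [exact E|]. rewrite Rmult_1_l in E. exact E.
Qed.

Lemma theta_rem_le (t : R) (k : nat) (x : C) : Cmod x <= Cmod (pole t k) ->
  Cmod (theta_rem t k x) <= Cmod x ^ 3 * (/ Cmod (pole t k)) ^ 3.
Proof.
  intros H. destruct (pole_ratio_le t k x H) as [H1 H2].
  apply log_rem_le in H1, H2.
  pose proof (proj1 (Cmod_gt_0 _) (pole_neq_0 t k)) as Hp.
  unfold theta_rem. rewrite Cmod_div by (apply RtoC_neq_0; lra).
  rewrite Cmod_R, (Rabs_right 2) by lra.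
  assert (E1 : Cmod (Ci * x / 2 / pole t k)%C = Cmod x / 2 * / Cmod (pole t k)).
  { rewrite Cmod_div by apply pole_neq_0. rewrite Cmod_half_Ci. reflexivity. }
  assert (E2 : Cmod (- (Ci * x / 2) / Cconj (pole t k))%C = Cmod x / 2 * / Cmod (pole t k)).
  { rewrite Cmod_div by apply Cconj_pole_neq_0. rewrite Cmod_opp, Cmod_conj, Cmod_half_Ci. reflexivity. }
  rewrite E1 in H1. rewrite E2 in H2.
  eapply Rle_trans; [apply Rmult_le_compat_r; [lra|apply Cmod_minus_le]|].
  assert (E3 : (Cmod x / 2 * / Cmod (pole t k)) ^ 3 = Cmod x ^ 3 * (/ Cmod (pole t k)) ^ 3 / 8) by (field; lra).
  rewrite E3 in H1, H2.
  assert (0 <= Cmod x ^ 3 * (/ Cmod (pole t k)) ^ 3).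
  { apply Rmult_le_pos; apply pow_le; [apply Cmod_ge_0 | apply Rlt_le, Rinv_0_lt_compat; auto]. }
  lra.
Qed.

(** The term of index 0 stands apart because [logGamma] has [- Clog w] outside its series, which
    starts at k = 1. *)
Definition theta_rem_sum (t : R) (x : C) : C :=
  (theta_rem t 0 x + Cseries (fun n => theta_rem t (S n) x))%C.

Lemma inv_pole_cube_le (t : R) (n : nat) : (/ Cmod (pole t (S n))) ^ 3 <= / INR (S n) ^ 2.
Proof.
  rewrite pow_inv. pose proof (Cmod_pole_ge t (S n)). pose proof (INR_S_ge_1 n).
  apply Rinv_le_contravar; [nra|].
  assert (INR (S n) ^ 2 <= Cmod (pole t (S n)) ^ 2) by (apply pow_incr; lra).
  assert (1 <= Cmod (pole t (S n))) by lra. simpl in *. nra.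
Qed.

Lemma ex_series_inv_pole_cube (t : R) : ex_series (fun n => (/ Cmod (pole t (S n))) ^ 3).
Proof.
  apply (ex_series_le (V := R_CompleteNormedModule)) with (fun n => / INR (S n) ^ 2).
  - intros n. eapply Rle_trans; [|apply (inv_pole_cube_le t n)].
    right. apply Rabs_right. apply Rle_ge, pow_le, Rlt_le, Rinv_0_lt_compat.
    apply Cmod_gt_0, pole_neq_0.
  - apply ex_series_inv_sqr.
Qed.

Lemma theta_rem_sum_le (t : R) (x : C) : (forall k, Cmod x <= Cmod (pole t k)) ->
  CSer (fun n => theta_rem t (S n) x) (Cseries (fun n => theta_rem t (S n) x)) /\
  Cmod (theta_rem_sum t x) <= Cmod x ^ 3 *
    ((/ Cmod (pole t 0)) ^ 3 + 2 * Series (fun n => (/ Cmod (pole t (S n))) ^ 3)).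
Proof.
  intros H.
  destruct (CSer_dominated (fun n => theta_rem t (S n) x)
     (fun n => Cmod x ^ 3 * (/ Cmod (pole t (S n))) ^ 3)) as [H1 H2].
  - intros n. apply theta_rem_le; auto.
  - apply (ex_series_scal_l (K := R_AbsRing) (V := R_NormedModule)), ex_series_inv_pole_cube.
  - split; auto. unfold theta_rem_sum. eapply Rle_trans; [apply Cmod_triangle|].
    rewrite Series_scal_l in H2. pose proof (theta_rem_le t 0 x (H 0%nat)). lra.
Qed.

(** Both logarithms of Gamma are incremented, by h = ix/2 at w and by -h at its conjugate, and the
    resulting series are expanded term by term. The terms h/k add up instead of cancelling; paired
    with the real parts of the reciprocals they give the convergent series of [theta1]. *)
Lemma theta_taylor (t : R) (x : C) : (forall k, Cmod x <= Cmod (pole t k)) ->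
  (Ci * (RStheta (RtoC t + x) - RStheta (RtoC t)))%C
  = (Ci * (x * RtoC (theta1 t) + x * x * RtoC (1 / 2) * RtoC (theta2 t)) + theta_rem_sum t x)%C.
Proof.
  intros H. set (h := (Ci * x / 2)%C). set (w := pole t 0). set (w' := Cconj w).
  assert (Hpk : forall k, (w + RtoC (INR k))%C = pole t k).
  { intros k. apply C_eq; unfold w, pole, Re, Im; simpl; ring. }
  assert (Hpk' : forall k, (w' + RtoC (INR k))%C = Cconj (pole t k)).
  { intros k. apply C_eq; unfold w', w, pole, Re, Im; simpl; ring. }
  assert (Hh : Cmod h = Cmod x / 2) by apply Cmod_half_Ci.
  destruct (logGamma_increment w h) as (L & HL & EL & _).
  { unfold w, pole; simpl. lra. }
  { intros k. rewrite Hpk, Hh. specialize (H k). lra. }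
  destruct (logGamma_increment w' (- h)%C) as (L' & HL' & EL' & _).
  { unfold w', w, pole; simpl. lra. }
  { intros k. rewrite Hpk', Cmod_opp, Hh, Cmod_conj. specialize (H k). lra. }
  assert (HS := proj1 (theta_rem_sum_le t x H)).
  assert (Hd := CSer_scal (/ 2)%C _ _ (CSer_minus _ _ _ _ HL HL')).
  assert (H1 := CSer_scal h _ _ (CSer_RtoC _ (ex_series_theta1 (t / 2)))).
  assert (H2 := CSer_scal (- Ci * (h * h))%C _ _ (CSer_RtoC _ (ex_series_theta2 (t / 2)))).
  assert (H3 := CSer_plus _ _ _ _ (CSer_plus _ _ _ _ H1 H2) HS).
  (* Both sides are sums of the same series, so the termwise identity suffices. *)
  assert (E : (/ 2 * (L - L'))%C = (h * RtoC (Series (fun n => / INR (S n) - inv_re (1 / 4 + INR (S n)) (t / 2))%R)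
    + - Ci * (h * h) * RtoC (Series (fun n => inv_sqr_im (1 / 4 + INR (S n)) (t / 2))%R)
    + Cseries (fun n => theta_rem t (S n) x))%C).
  { rewrite <- (CSer_unique _ _ Hd). apply CSer_unique.
    eapply CSer_ext; [|exact H3]. intros n. cbv beta.
    rewrite Hpk, Hpk'.
    assert (T := theta_term_eq t (S n) x). cbv zeta in T. fold h in T.
    assert (N1 := RtoC_INR_S_neq_0 n).
    replace (/ 2 * (h / RtoC (INR (S n)) - Clog (1 + h / pole t (S n)) -
       (- h / RtoC (INR (S n)) - Clog (1 + - h / Cconj (pole t (S n))))))%C
      with (h / RtoC (INR (S n)) + (- Clog (1 + h / pole t (S n)) + Clog (1 + - h / Cconj (pole t (S n)))) / 2)%C
      by (field; auto).
    rewrite T. rewrite RtoC_minus, RtoC_inv by (pose proof (INR_S_ge_1 n); lra). field. auto. }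
  assert (T0 := theta_term_eq t 0 x). cbv zeta in T0. fold h w w' in T0.
  replace (1 / 4 + INR 0) with (1 / 4) in T0 by (simpl; ring).
  unfold RStheta.
  assert (EA : (RtoC (1 / 4) + Ci * (RtoC t + x) * RtoC (1 / 2))%C = (w + h)%C).
  { apply C_eq; unfold w, h, pole, Re, Im; simpl; field. }
  assert (EB : (RtoC (1 / 4) - Ci * (RtoC t + x) * RtoC (1 / 2))%C = (w' + - h)%C).
  { apply C_eq; unfold w', w, h, pole, Re, Im; simpl; field. }
  assert (EC : (RtoC (1 / 4) + Ci * RtoC t * RtoC (1 / 2))%C = w).
  { apply C_eq; unfold w, h, pole, Re, Im; simpl; field. }
  assert (ED : (RtoC (1 / 4) - Ci * RtoC t * RtoC (1 / 2))%C = w').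
  { apply C_eq; unfold w', w, h, pole, Re, Im; simpl; field. }
  rewrite EA, EB, EC, ED.
  assert (NCi : Ci <> 0) by (intros X; apply (f_equal Im) in X; simpl in X; lra).
  assert (N2 : RtoC 2 <> 0) by (apply RtoC_neq_0; lra).
  set (l1 := logGamma (w + h)) in *. set (l2 := logGamma w) in *.
  set (l3 := logGamma (w' + - h)) in *. set (l4 := logGamma w') in *.
  replace (Ci * ((l1 - l3) / (2 * Ci) - (RtoC t + x) * RtoC (ln PI / 2)
     - ((l2 - l4) / (2 * Ci) - RtoC t * RtoC (ln PI / 2))))%C
    with (((l1 - l2) - (l3 - l4)) / 2 - Ci * x * RtoC (ln PI / 2))%C by (field; auto).
  rewrite EL, EL'.
  replace ((- RtoC euler_gamma * h - Clog (1 + h / w) + L -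
     (- RtoC euler_gamma * - h - Clog (1 + - h / w') + L')) / 2)%C
    with (- RtoC euler_gamma * h + (- Clog (1 + h / w) + Clog (1 + - h / w')) / 2 + / 2 * (L - L'))%C
    by (field; auto).
  rewrite E, T0. unfold theta1, theta2, theta_rem_sum.
  assert (Ehh : (Ci * (h * h))%C = (- Ci * (x * x) * RtoC (/ 4))%C).
  { unfold h. apply C_eq; unfold Re, Im; simpl; field. }
  rewrite !RtoC_minus, !RtoC_mult, !RtoC_plus, !RtoC_minus, RtoC_opp.
  set (S1 := RtoC (Series _)). set (S2 := RtoC (Series _)).
  set (q := RtoC (inv_sqr_im _ _)). set (r := RtoC (inv_re _ _)).
  set (S0 := Cseries _).
  replace (- r * h - Ci * q * (h * h) + theta_rem t 0 x)%C
     with (- r * h - (Ci * (h * h)) * q + theta_rem t 0 x)%C by ring.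
  replace (- Ci * (h * h) * S2)%C with (- (Ci * (h * h)) * S2)%C by ring.
  rewrite Ehh. unfold h.
  replace (RtoC (1 / 2)) with (/ 2)%C by (rewrite RtoC_div by lra; field; auto).
  replace (RtoC (/ 2)) with (/ 2)%C by (rewrite RtoC_inv by lra; reflexivity).
  replace (RtoC (/ 4)) with (/ (2 * 2))%C.
  2:{ rewrite <- RtoC_mult, <- RtoC_inv by lra. f_equal; lra. }
  field; auto.
Qed.

(** The expansion at a real increment: multiplying by i moves the real part of theta into the
    imaginary part. The first derivative of theta follows without differentiating its series term by
    term. Every pole has modulus at least 1/4, whence the range of [s]. *)
Lemma RStheta_real_increment (t s : R) : Rabs s <= / 4 ->
  exists K, RStheta_real (t + s) - RStheta_real t = theta1 t * s + theta2 t / 2 * s ^ 2 + K /\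
   Rabs K <= Rabs s ^ 3 *
    ((/ Cmod (pole t 0)) ^ 3 + 2 * Series (fun n => (/ Cmod (pole t (S n))) ^ 3)).
Proof.
  intros Hs.
  assert (H : forall k, Cmod (RtoC s) <= Cmod (pole t k)).
  { intros k. rewrite Cmod_R. pose proof (Cmod_pole_ge t k). pose proof (pos_INR k). lra. }
  assert (E := theta_taylor t (RtoC s) H).
  exists (Im (theta_rem_sum t (RtoC s))). split.
  - apply (f_equal Im) in E. unfold RStheta_real. rewrite RtoC_plus.
    revert E. generalize (RStheta (RtoC t + RtoC s)) (RStheta (RtoC t)) (theta_rem_sum t (RtoC s)).
    intros A B D. unfold Re, Im; simpl. intros E.
    replace (fst A - fst B) with (0 * (snd A + - snd B) + 1 * (fst A + - fst B)) by ring.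
    rewrite E. field.
  - eapply Rle_trans; [apply im_le_Cmod|].
    eapply Rle_trans; [apply theta_rem_sum_le, H|]. rewrite Cmod_R. apply Rle_refl.
Qed.

Lemma is_derive_RStheta_real (t : R) : is_derive RStheta_real t (theta1 t).
Proof.
  set (K := (/ Cmod (pole t 0)) ^ 3 + 2 * Series (fun n => (/ Cmod (pole t (S n))) ^ 3)).
  assert (HK : 0 <= K).
  { unfold K. assert (Hk : forall k, 0 <= (/ Cmod (pole t k)) ^ 3).
    { intros k. apply pow_le, Rlt_le, Rinv_0_lt_compat, Cmod_gt_0, pole_neq_0. }
    pose proof (Hk 0%nat).
    assert (0 <= Series (fun n => (/ Cmod (pole t (S n))) ^ 3)).
    { apply Series_nonneg; auto. apply ex_series_inv_pole_cube. }
    lra. }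
  apply is_derive_quadratic with (r := / 4) (K := Rabs (theta2 t / 2) + K); [lra|].
  intros h Hh. destruct (RStheta_real_increment t h Hh) as (k & E & Hk). fold K in Hk.
  rewrite E. replace (_ - _) with (theta2 t / 2 * h ^ 2 + k) by ring.
  eapply Rle_trans; [apply Rabs_triang|]. rewrite Rabs_mult, (Rabs_right (h ^ 2)) by (apply Rle_ge, pow2_ge_0).
  assert (Rabs h ^ 3 <= h ^ 2).
  { rewrite <- (pow2_abs h). pose proof (Rabs_pos h). simpl. nra. }
  assert (Rabs h ^ 3 * K <= h ^ 2 * K) by (apply Rmult_le_compat_r; auto).
  lra.
Qed.

(** Taylor expansion in [y] whose remainder is O(d^2 / a^2) uniformly in [y]; with a = 1/4 + k it
    can be summed over k, which justifies differentiating the series of [theta1]. *)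
Lemma inv_re_increment (a y d : R) : / 4 <= a -> Rabs d <= 1 ->
  Rabs (inv_re a (y + d) - inv_re a y + 2 * d * inv_sqr_im a y) <= 100 * (d ^ 2 * / a ^ 2).
Proof.
  intros Ha Hd. unfold inv_re, inv_sqr_im.
  set (A := a ^ 2 + y ^ 2). set (B := a ^ 2 + (y + d) ^ 2).
  assert (HA : 0 < A) by (apply sum_sqr_pos; lra).
  assert (HB : 0 < B) by (apply sum_sqr_pos; lra).
  replace (a / B - a / A + 2 * d * (a * y / A ^ 2))
    with (d ^ 2 * ((- A + 4 * y ^ 2 + 2 * y * d) / A * (/ A * (a * / B)))).
  2:{ unfold Rdiv.
      assert (EB : B = A + 2 * y * d + d ^ 2) by (unfold A, B; ring).
      field_simplify_eq; [|lra]. rewrite EB. ring. }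
  rewrite Rabs_mult, (Rabs_right (d ^ 2)) by (apply Rle_ge, pow2_ge_0).
  replace (100 * (d ^ 2 * / a ^ 2)) with (d ^ 2 * (100 * / a ^ 2)) by ring.
  apply Rmult_le_compat_l; [apply pow2_ge_0|].
  rewrite Rabs_mult.
  (* From a >= 1/4 follows 1 <= 16 A, so the numerator is at most A + 4 A + (1 + A) <= 22 A. *)
  assert (F1 : Rabs ((- A + 4 * y ^ 2 + 2 * y * d) / A) <= 25).
  { unfold Rdiv. rewrite Rabs_mult, Rabs_inv, (Rabs_right A) by lra.
    apply Rmult_le_reg_r with A; auto. rewrite Rmult_assoc, Rinv_l, Rmult_1_r by lra.
    apply Rabs_le_between in Hd.
    assert (HA2 : 1 <= 16 * A) by (unfold A; pose proof (pow2_ge_0 y); nra).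
    assert (Hy : y ^ 2 <= A) by (unfold A; nra).
    assert (Hyd : - (1 + y ^ 2) <= 2 * y * d <= 1 + y ^ 2).
    { pose proof (pow2_ge_0 (y + d)). pose proof (pow2_ge_0 (y - d)). nra. }
    pose proof (pow2_ge_0 y).
    apply Rabs_le_between. lra. }
  assert (Ha0 : 0 < a ^ 2) by nra.
  assert (F2 : 0 <= / A * (a * / B) <= 4 * / a ^ 2).
  { assert (I1 : / A <= / a ^ 2) by (apply Rinv_le_contravar; auto; unfold A; pose proof (pow2_ge_0 y); lra).
    assert (I2 : / B <= / a ^ 2) by (apply Rinv_le_contravar; auto; unfold B; pose proof (pow2_ge_0 (y + d)); lra).
    assert (I3 : a * / B <= 4).
    { apply Rle_trans with (a * / a ^ 2); [apply Rmult_le_compat_l; lra|].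
      replace (a * / a ^ 2) with (/ a) by (field; lra).
      replace 4 with (/ / 4) by field. apply Rinv_le_contravar; lra. }
    assert (0 < / A) by (apply Rinv_0_lt_compat; auto).
    assert (0 < / B) by (apply Rinv_0_lt_compat; auto).
    assert (0 < a * / B) by (apply Rmult_lt_0_compat; lra).
    split; [nra|]. rewrite (Rmult_comm 4). apply Rmult_le_compat; lra. }
  rewrite (Rabs_right (/ A * (a * / B))) by lra.
  replace (100 * / a ^ 2) with (25 * (4 * / a ^ 2)) by ring.
  apply Rmult_le_compat; try lra. apply Rabs_pos.
Qed.

Lemma is_derive_theta1 (t : R) : is_derive theta1 t (theta2 t).
Proof.
  set (Z := Series (fun n => / INR (S n) ^ 2)).
  (* The constant is generous: 16 is 1 / (1/4)^2 from the isolated term, [Z] collects the others,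
     and the factors coming from y = t/2 are given away. *)
  apply is_derive_quadratic with (r := 1) (K := 100 * 16 + 100 * Z); [lra|].
  intros s Hs. unfold theta1, theta2.
  set (y := t / 2). replace ((t + s) / 2) with (y + s / 2) by (unfold y; field).
  assert (Hd : Rabs (s / 2) <= 1).
  { apply Rabs_le_between. apply Rabs_le_between in Hs. lra. }
  set (T := fun n => / INR (S n) - inv_re (1 / 4 + INR (S n)) (y + s / 2)
     - (/ INR (S n) - inv_re (1 / 4 + INR (S n)) y)
     - s * inv_sqr_im (1 / 4 + INR (S n)) y).
  assert (HT : forall n, Rabs (T n) <= 100 * (s / 2) ^ 2 * / INR (S n) ^ 2).
  { intros n. unfold T. pose proof (INR_S_ge_1 n).
    replace (_ - _ - _) with (- (inv_re (1 / 4 + INR (S n)) (y + s / 2) - inv_re (1 / 4 + INR (S n)) y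
      + 2 * (s / 2) * inv_sqr_im (1 / 4 + INR (S n)) y)) by (field; lra).
    rewrite Rabs_Ropp. eapply Rle_trans; [apply inv_re_increment; lra|].
    rewrite <- Rmult_assoc. apply Rmult_le_compat_l; [pose proof (pow2_ge_0 (s / 2)); lra|].
    apply Rinv_le_contravar; nra. }
  assert (Hex : ex_series (fun n => 100 * (s / 2) ^ 2 * / INR (S n) ^ 2)).
  { apply (ex_series_scal_l (K := R_AbsRing) (V := R_NormedModule)), ex_series_inv_sqr. }
  assert (HTa : ex_series (fun n => Rabs (T n))).
  { apply (ex_series_le (V := R_CompleteNormedModule)) with (fun n => 100 * (s / 2) ^ 2 * / INR (S n) ^ 2); auto.
    intros n. unfold norm; simpl; unfold abs; simpl. rewrite Rabs_Rabsolu. apply HT. }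
  assert (HTb : Rabs (Series T) <= 100 * (s / 2) ^ 2 * Z).
  { eapply Rle_trans; [apply Series_Rabs; auto|]. unfold Z. rewrite <- Series_scal_l.
    apply Series_le; auto. intros n. split; auto using Rabs_pos. }
  assert (ET : Series T = Series (fun n => / INR (S n) - inv_re (1 / 4 + INR (S n)) (y + s / 2))
     - Series (fun n => / INR (S n) - inv_re (1 / 4 + INR (S n)) y)
     - s * Series (fun n => inv_sqr_im (1 / 4 + INR (S n)) y)).
  { unfold T. rewrite Series_minus, Series_minus, Series_scal_l; auto using ex_series_theta1.
    - apply (ex_series_minus (V := R_NormedModule)); apply ex_series_theta1.
    - apply (ex_series_scal_l (K := R_AbsRing) (V := R_NormedModule)), ex_series_theta2. }
  assert (H0 := inv_re_increment (1 / 4) y (s / 2) ltac:(lra) Hd).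
  replace (/ (1 / 4) ^ 2) with 16 in H0 by field.
  set (X0 := inv_re (1 / 4) (y + s / 2) - inv_re (1 / 4) y + 2 * (s / 2) * inv_sqr_im (1 / 4) y) in H0.
  match goal with |- Rabs ?g <= _ => replace g with (/ 2 * (Series T - X0)) by (rewrite ET; unfold X0; field) end.
  rewrite Rabs_mult, (Rabs_right (/ 2)) by lra.
  assert (Rabs (Series T - X0) <= Rabs (Series T) + Rabs X0).
  { unfold Rminus. eapply Rle_trans; [apply Rabs_triang|]. rewrite Rabs_Ropp. lra. }
  assert (HZ : 0 <= Z).
  { apply Series_nonneg; [|apply ex_series_inv_sqr]. intros n. apply Rlt_le, Rinv_0_lt_compat.
    apply pow_lt. pose proof (INR_S_ge_1 n). lra. }
  assert ((s / 2) ^ 2 = s ^ 2 / 4) by field.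
  assert (0 <= s ^ 2) by apply pow2_ge_0.
  assert (0 <= s ^ 2 * Z) by (apply Rmult_le_pos; auto).
  rewrite H1 in *. lra.
Qed.

Lemma dtheta_eq (t : R) : dtheta t = theta1 t.
Proof. apply is_derive_unique, is_derive_RStheta_real. Qed.

Lemma d2theta_eq (t : R) : d2theta t = theta2 t.
Proof.
  unfold d2theta. simpl. rewrite (Derive_ext (fun x => Derive RStheta_real x) theta1).
  - apply is_derive_unique, is_derive_theta1.
  - intros x. apply is_derive_unique, is_derive_RStheta_real.
Qed.

(** * Growth of theta and its derivatives *)

Lemma ln_le_minus_1 (x : R) : 0 < x -> ln x <= x - 1.
Proof.
  intros Hx. destruct (Req_dec (ln x) 0) as [E|E].
  - rewrite E. apply (f_equal exp) in E. rewrite exp_ln, exp_0 in E by auto. lra.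
  - pose proof (exp_ineq1 (ln x) E). rewrite exp_ln in H by auto. lra.
Qed.

Lemma ln_diff_ge (x y : R) : 0 < x -> 0 < y -> 1 - y / x <= ln x - ln y.
Proof.
  intros Hx Hy. assert (H : 0 < y / x) by (apply Rdiv_lt_0_compat; auto).
  pose proof (ln_le_minus_1 _ H). rewrite ln_div in H0 by auto. lra.
Qed.

Lemma Series_le_gen (a b : nat -> R) : ex_series a -> ex_series b ->
  (forall n, a n <= b n) -> Series a <= Series b.
Proof.
  intros Ha Hb H.
  assert (0 <= Series (fun n => b n - a n)).
  { apply Series_nonneg; [intros n; specialize (H n); lra|].
    apply (ex_series_minus (V := R_NormedModule)); auto. }
  rewrite Series_minus in H0 by auto. lra.
Qed.

(** With (k + 1)^2 in place of (k + a)^2 the same series majorises the terms for every 0 < a <= 1.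
    It serves both theta' (a = 1/4) and the Gamma quotient on the line of [U]. *)
Definition harmonic_defect (y : R) (n : nat) : R :=
  / INR (S n) - INR (S n) / ((INR (S n) + 1) ^ 2 + y ^ 2).

(* Telescopes against [ln (1 + y^2 / k^2) / 2 + 4 / k], a primitive of
   [1 / k - k / (k^2 + y^2)] corrected by a summable term. *)
Lemma Series_harmonic_defect (y : R) :
  ex_series (harmonic_defect y) /\ Series (harmonic_defect y) <= / 2 * ln (1 + y ^ 2) + 4.
Proof.
  set (v := fun n => / 2 * ln (1 + y ^ 2 / INR (S n) ^ 2) + 4 / INR (S n)).
  replace (/ 2 * ln (1 + y ^ 2) + 4) with (v 0%nat).
  2:{ unfold v. simpl INR. replace (y ^ 2 / 1 ^ 2) with (y ^ 2) by field. field. }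
  set (Y := y ^ 2) in *. assert (HY : 0 <= Y) by apply pow2_ge_0.
  apply ex_series_nonneg_telescope.
  - intros n. unfold harmonic_defect. fold Y. pose proof (INR_S_ge_1 n). set (k := INR (S n)) in *.
    replace (/ k - k / ((k + 1) ^ 2 + Y)) with ((2 * k + 1 + Y) / (k * ((k + 1) ^ 2 + Y))) by (field; nra).
    apply Rmult_le_pos; [lra|]. apply Rlt_le, Rinv_0_lt_compat. nra.
  - intros n. unfold v. pose proof (INR_S_ge_1 n). set (k := INR (S n)) in *.
    assert (0 < / k ^ 2) by (apply Rinv_0_lt_compat; nra).
    assert (0 <= ln (1 + Y / k ^ 2)).
    { rewrite <- ln_1. apply Rcomplements.ln_le; [lra|]. unfold Rdiv. nra. }
    assert (0 < 4 / k) by (apply Rdiv_lt_0_compat; lra). lra.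
  - intros n. unfold harmonic_defect, v. fold Y. rewrite (S_INR (S n)).
    pose proof (INR_S_ge_1 n). set (k := INR (S n)) in *.
    assert (K2 : 0 < k ^ 2) by nra. assert (K3 : 0 < (k + 1) ^ 2) by nra.
    assert (P1 : 0 < 1 + Y / k ^ 2).
    { assert (0 < / k ^ 2) by (apply Rinv_0_lt_compat; nra). unfold Rdiv; nra. }
    assert (P2 : 0 < 1 + Y / (k + 1) ^ 2).
    { assert (0 < / (k + 1) ^ 2) by (apply Rinv_0_lt_compat; nra). unfold Rdiv; nra. }
    assert (HL := ln_diff_ge _ _ P1 P2).
    assert (E1 : 1 - (1 + Y / (k + 1) ^ 2) / (1 + Y / k ^ 2) = Y * (2 * k + 1) / ((k + 1) ^ 2 * (k ^ 2 + Y))).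
    { field; repeat split; nra. }
    rewrite E1 in HL.
    assert (E2 : 4 / k - 4 / (k + 1) = 4 / (k * (k + 1))) by (field; lra).
    (* One 2 / (k (k + 1)) pays for the part of the defect present at Y = 0, the other for replacing
       1/k by (2k + 1) / (2 (k + 1)^2) in the part proportional to Y. *)
    assert (G : / k - k / ((k + 1) ^ 2 + Y) <= Y * (2 * k + 1) / (2 * ((k + 1) ^ 2 * (k ^ 2 + Y))) + 4 / (k * (k + 1))).
    { apply Rle_trans with (2 / (k * (k + 1)) + Y / (k * (k ^ 2 + Y))).
      - replace (/ k - k / ((k + 1) ^ 2 + Y))
          with ((2 * k + 1) / (k * ((k + 1) ^ 2 + Y)) + Y / (k * ((k + 1) ^ 2 + Y))) by (field; nra).
        apply Rplus_le_compat.
        + apply Rle_trans with ((2 * k + 1) / (k * (k + 1) ^ 2)).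
          * apply Rmult_le_compat_l; [lra|]. apply Rinv_le_contravar; nra.
          * apply Rmult_le_reg_r with (k * (k + 1) ^ 2); [nra|].
            replace ((2 * k + 1) / (k * (k + 1) ^ 2) * (k * (k + 1) ^ 2)) with (2 * k + 1) by (field; lra).
            replace (2 / (k * (k + 1)) * (k * (k + 1) ^ 2)) with (2 * (k + 1)) by (field; lra). lra.
        + apply Rmult_le_compat_l; [lra|]. apply Rinv_le_contravar; nra.
      - assert (HX : 0 <= Y / (k ^ 2 + Y) <= 1).
        { split; [apply Rmult_le_pos; [lra|apply Rlt_le, Rinv_0_lt_compat; lra]|].
          apply Rmult_le_reg_r with (k ^ 2 + Y); [lra|].
          replace (Y / (k ^ 2 + Y) * (k ^ 2 + Y)) with Y by (field; lra). lra. }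
        replace (Y / (k * (k ^ 2 + Y))) with (Y / (k ^ 2 + Y) * / k) by (field; lra).
        replace (Y * (2 * k + 1) / (2 * ((k + 1) ^ 2 * (k ^ 2 + Y))))
          with (Y / (k ^ 2 + Y) * ((2 * k + 1) / (2 * (k + 1) ^ 2))) by (field; lra).
        set (X := Y / (k ^ 2 + Y)) in *.
        assert (D : / k - (2 * k + 1) / (2 * (k + 1) ^ 2) <= 2 / (k * (k + 1))).
        { replace (/ k - (2 * k + 1) / (2 * (k + 1) ^ 2))
            with ((3 * k + 2) / 2 * / (k * (k + 1) ^ 2)) by (field; lra).
          replace (2 / (k * (k + 1))) with (2 * (k + 1) * / (k * (k + 1) ^ 2)) by (field; lra).
          apply Rmult_le_compat_r; [|lra]. apply Rlt_le, Rinv_0_lt_compat. nra. }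
        assert (D0 : 0 < 2 / (k * (k + 1))) by (apply Rdiv_lt_0_compat; nra).
        assert (X * (/ k - (2 * k + 1) / (2 * (k + 1) ^ 2)) <= 2 / (k * (k + 1))).
        { apply Rle_trans with (X * (2 / (k * (k + 1)))); [apply Rmult_le_compat_l; lra|]. nra. }
        assert (4 / (k * (k + 1)) = 2 / (k * (k + 1)) + 2 / (k * (k + 1))) by (field; lra).
        lra. }
    assert (E3 : Y * (2 * k + 1) / (2 * ((k + 1) ^ 2 * (k ^ 2 + Y)))
       = / 2 * (Y * (2 * k + 1) / ((k + 1) ^ 2 * (k ^ 2 + Y)))) by (field; lra).
    lra.
Qed.

(** The absolute value makes it nonnegative, so that multiplying it by a height below 2 is bounded
    by doubling it. *)
Definition theta1_const : R := Rabs (/ 2 * (- euler_gamma + 4) - ln PI / 2).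

(** Only the coefficient 1/2 of ln t matters: it gives |e^P| the size t^(s/2) at height [s]. An
    upper bound is enough because heights are positive. *)
Lemma theta1_le (t : R) : 2 <= t -> theta1 t <= / 2 * ln t + theta1_const.
Proof.
  intros Ht. unfold theta1. set (y := t / 2).
  destruct (Series_harmonic_defect y) as [Hex HS].
  assert (H1 : Series (fun n => / INR (S n) - inv_re (1 / 4 + INR (S n)) y) <= / 2 * ln (1 + y ^ 2) + 4).
  { eapply Rle_trans; [|exact HS]. apply Series_le_gen; auto using ex_series_theta1.
    intros n. unfold harmonic_defect, inv_re. pose proof (INR_S_ge_1 n). set (k := INR (S n)) in *.
    pose proof (pow2_ge_0 y).
    assert (k / ((k + 1) ^ 2 + y ^ 2) <= (1 / 4 + k) / ((1 / 4 + k) ^ 2 + y ^ 2)); [|lra].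
    apply Rmult_le_compat; try lra.
    - apply Rlt_le, Rinv_0_lt_compat. nra.
    - apply Rinv_le_contravar; nra. }
  assert (H2 : 0 <= inv_re (1 / 4) y).
  { unfold inv_re. apply Rmult_le_pos; [lra|]. apply Rlt_le, Rinv_0_lt_compat, sum_sqr_pos. lra. }
  assert (H3 : / 2 * ln (1 + y ^ 2) <= ln t).
  { replace (ln t) with (/ 2 * ln (t ^ 2)) by (simpl; rewrite Rmult_1_r, ln_mult by lra; field).
    apply Rmult_le_compat_l; [lra|]. apply Rcomplements.ln_le; [pose proof (pow2_ge_0 y); lra|].
    unfold y. nra. }
  pose proof (Rle_abs (/ 2 * (- euler_gamma + 4) - ln PI / 2)). fold theta1_const in H. lra.
Qed.

Lemma theta2_le (t : R) : 2 <= t -> Rabs (theta2 t) <= 3 / t.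
Proof.
  intros Ht. unfold theta2. set (y := t / 2). assert (Hy : 1 <= y) by (unfold y; lra).
  destruct (Series_inv_sqr_shift y ltac:(lra)) as [Hex HS].
  assert (Hab : ex_series (fun n => Rabs (inv_sqr_im (1 / 4 + INR (S n)) y))).
  { apply (ex_series_le (V := R_CompleteNormedModule)) with (fun n => / (INR (S n) ^ 2 + y ^ 2)); auto.
    intros n. unfold norm; simpl; unfold abs; simpl. rewrite Rabs_Rabsolu. apply inv_sqr_im_le_INR. }
  assert (H1 : Rabs (Series (fun n => inv_sqr_im (1 / 4 + INR (S n)) y)) <= 2 / y).
  { eapply Rle_trans; [apply Series_Rabs; auto|]. eapply Rle_trans; [|exact HS].
    apply Series_le; auto. intros n. split; [apply Rabs_pos | apply inv_sqr_im_le_INR]. }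
  assert (H2 : Rabs (inv_sqr_im (1 / 4) y) <= 1 / y).
  { eapply Rle_trans; [apply inv_sqr_im_le; lra|]. unfold Rdiv. rewrite !Rmult_1_l.
    apply Rinv_le_contravar; nra. }
  rewrite Rabs_mult, (Rabs_right (/ 2)) by lra.
  eapply Rle_trans; [apply Rmult_le_compat_l; [lra|apply Rabs_triang]|].
  replace (3 / t) with (/ 2 * (1 / y + 2 / y)) by (unfold y; field; lra).
  apply Rmult_le_compat_l; lra.
Qed.

(** One factor of the cube is bounded by the imaginary part y = t/2 alone, the other two by k^2 +
    y^2, whose reciprocals sum to 2/y. Together 1/y^2 + 4/y^2 = 20/t^2. *)
Lemma Series_inv_pole_cube_le (t : R) : 2 <= t ->
  (/ Cmod (pole t 0)) ^ 3 + 2 * Series (fun n => (/ Cmod (pole t (S n))) ^ 3) <= 20 / t ^ 2.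
Proof.
  intros Ht. set (y := t / 2). assert (Hy : 1 <= y) by (unfold y; lra).
  destruct (Series_inv_sqr_shift y ltac:(lra)) as [Hex HS].
  assert (HC : forall k, (/ Cmod (pole t k)) ^ 3 <= / y * / (INR k ^ 2 + y ^ 2)).
  { intros k. pose proof (Cmod_pole_ge_im t k) as H1. fold y in H1.
    pose proof (Cmod_Rsqr (pole t k)) as H2. simpl in H2. fold y in H2.
    pose proof (pos_INR k) as H3.
    assert (H4 : INR k ^ 2 + y ^ 2 <= Cmod (pole t k) ^ 2) by nra.
    assert (H5 : 0 < INR k ^ 2 + y ^ 2) by nra.
    replace ((/ Cmod (pole t k)) ^ 3) with (/ Cmod (pole t k) * / (Cmod (pole t k) ^ 2)) by (field; lra).
    apply Rmult_le_compat.
    - apply Rlt_le, Rinv_0_lt_compat; lra.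
    - apply Rlt_le, Rinv_0_lt_compat; lra.
    - apply Rinv_le_contravar; lra.
    - apply Rinv_le_contravar; lra. }
  assert (H1 : Series (fun n => (/ Cmod (pole t (S n))) ^ 3) <= / y * (2 / y)).
  { eapply Rle_trans; [|apply Rmult_le_compat_l; [apply Rlt_le, Rinv_0_lt_compat; lra | exact HS]].
    rewrite <- Series_scal_l. apply Series_le.
    - intros n. split; [|apply HC]. apply pow_le, Rlt_le, Rinv_0_lt_compat, Cmod_gt_0, pole_neq_0.
    - apply (ex_series_scal_l (K := R_AbsRing) (V := R_NormedModule)); auto. }
  assert (H2 := HC 0%nat). replace (INR 0 ^ 2 + y ^ 2) with (y ^ 2) in H2 by (simpl; ring).
  assert (H3 : / y * / y ^ 2 <= / y * / y).
  { apply Rmult_le_compat_l; [apply Rlt_le, Rinv_0_lt_compat; lra|]. apply Rinv_le_contravar; nra. }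
  replace (20 / t ^ 2) with (/ y * / y + 2 * (/ y * (2 / y))) by (unfold y; field; lra).
  lra.
Qed.

(** * The Gamma quotient on the line Im x = -1/4 *)

Lemma Re_logGamma_conj (w : C) : Re (logGamma (Cconj w)) = Re (logGamma w).
Proof.
  rewrite !logGamma_eq.
  assert (E : Series (fun n => Re (logGamma_term (Cconj w) n)) = Series (fun n => Re (logGamma_term w n))).
  { apply Series_ext. intros n. unfold logGamma_term. cbv zeta.
    assert (E1 : (Cconj w / RtoC (INR (S n)))%C = Cconj (w / RtoC (INR (S n)))).
    { pose proof (INR_S_ge_1 n). unfold Cdiv. rewrite <- RtoC_inv by lra.
      apply C_eq; unfold Re, Im; simpl; ring. }
    assert (E2 : forall z, (1 + Cconj z)%C = Cconj (1 + z)%C)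
      by (intros; apply C_eq; unfold Re, Im; simpl; ring).
    rewrite E1, E2. unfold Cminus.
    change (Re (Cconj (w / RtoC (INR (S n)))) - ln (Cmod (Cconj (1 + w / RtoC (INR (S n)))))
       = Re (w / RtoC (INR (S n)))%C - ln (Cmod (1 + w / RtoC (INR (S n)))%C)).
    rewrite Cmod_conj. reflexivity. }
  change ((- euler_gamma * Re w - 0 * - Im w) - ln (Cmod (Cconj w)) + Series (fun n => Re (logGamma_term (Cconj w) n))
   = (- euler_gamma * Re w - 0 * Im w) - ln (Cmod w) + Series (fun n => Re (logGamma_term w n))).
  rewrite E, Cmod_conj. ring.
Qed.

Lemma Re_Ci_RStheta_real (t : R) : Re (Ci * RStheta (RtoC t))%C = 0.
Proof.
  unfold RStheta.
  set (w := (RtoC (1 / 4) + Ci * RtoC t * RtoC (1 / 2))%C).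
  replace (RtoC (1 / 4) - Ci * RtoC t * RtoC (1 / 2))%C with (Cconj w).
  2:{ apply C_eq; unfold w, Re, Im; simpl; ring. }
  pose proof (Re_logGamma_conj w) as E.
  assert (NCi : Ci <> 0) by (intros X; apply (f_equal Im) in X; simpl in X; lra).
  assert (N2 : RtoC 2 <> 0) by (apply RtoC_neq_0; lra).
  replace (Ci * ((logGamma w - logGamma (Cconj w)) / (2 * Ci) - RtoC t * RtoC (ln PI / 2)))%C
    with (RtoC (/ 2) * (logGamma w - logGamma (Cconj w)) - Ci * RtoC t * RtoC (ln PI / 2))%C.
  2:{ rewrite RtoC_inv by lra. field; auto. }
  revert E. generalize (logGamma w) (logGamma (Cconj w)). intros A B. unfold Re; simpl. intros E.
  rewrite E. ring.
Qed.

(** Stands in for a bound of the digamma function: since q <= p <= 1, ln|k + p + iy| - ln|k + q +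
    iy| is at least (p - q) k / ((k + 1)^2 + y^2), so the sum is dominated by p - q times the
    harmonic defect. At k = 0 this lower bound is 0, and the contribution of [- Clog w] is
    dropped. *)
Lemma Re_logGamma_diff_le (p q y : R) : 0 < q -> q <= p -> p <= 1 ->
  Re (logGamma (p, y)) - Re (logGamma (q, y))
  <= (p - q) * (- euler_gamma + / 2 * ln (1 + y ^ 2) + 4).
Proof.
  intros Hq Hqp Hp. rewrite !logGamma_eq.
  destruct (Series_harmonic_defect y) as [Hex HS].
  assert (Hlog : forall k, 0 <= k ->
     (p - q) * (k / ((k + 1) ^ 2 + y ^ 2)) <= ln (Cmod (k + p, y)) - ln (Cmod (k + q, y))).
  { intros k Hk0.
    assert (HM : forall a, 0 < a -> ln (Cmod (a, y)) = / 2 * ln (a ^ 2 + y ^ 2)).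
    { intros a Ha. assert (0 < Cmod (a, y)) by (apply Cmod_gt_0, Re_pos_neq_0; auto).
      replace (a ^ 2 + y ^ 2) with (Cmod (a, y) * Cmod (a, y)) by (rewrite Cmod_Rsqr; simpl; ring).
      rewrite ln_mult by auto. field. }
    rewrite !HM by lra.
    assert (PA : 0 < (k + p) ^ 2 + y ^ 2) by (apply sum_sqr_pos; lra).
    assert (PB : 0 < (k + q) ^ 2 + y ^ 2) by (apply sum_sqr_pos; lra).
    pose proof (ln_diff_ge _ _ PA PB) as HL. pose proof (pow2_ge_0 y).
    replace (1 - ((k + q) ^ 2 + y ^ 2) / ((k + p) ^ 2 + y ^ 2))
      with ((p - q) * ((2 * k + p + q) / ((k + p) ^ 2 + y ^ 2))) in HL by (field; lra).
    assert (HQ : k / ((k + 1) ^ 2 + y ^ 2) <= / 2 * ((2 * k + p + q) / ((k + p) ^ 2 + y ^ 2))).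
    { apply Rle_trans with (k / ((k + p) ^ 2 + y ^ 2)).
      - apply Rmult_le_compat_l; [lra|]. apply Rinv_le_contravar; nra.
      - replace (/ 2 * ((2 * k + p + q) / ((k + p) ^ 2 + y ^ 2)))
          with ((k + (p + q) / 2) / ((k + p) ^ 2 + y ^ 2)) by (field; lra).
        apply Rmult_le_compat_r; [apply Rlt_le, Rinv_0_lt_compat; auto|lra]. }
    apply Rmult_le_compat_l with (r := p - q) in HQ; [|lra]. lra. }
  assert (HSp := proj1 (CSer_logGamma_term (p, y) ltac:(simpl; lra))).
  assert (HSq := proj1 (CSer_logGamma_term (q, y) ltac:(simpl; lra))).
  change (Re (Cseries (logGamma_term (p, y)))) with (Series (fun n => Re (logGamma_term (p, y) n))) in HSp.
  change (Re (Cseries (logGamma_term (q, y)))) with (Series (fun n => Re (logGamma_term (q, y) n))) in HSq.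
  assert (EP : ex_series (fun n => Re (logGamma_term (p, y) n))) by (eexists; exact HSp).
  assert (EQ : ex_series (fun n => Re (logGamma_term (q, y) n))) by (eexists; exact HSq).
  assert (HD : Series (fun n => Re (logGamma_term (p, y) n)) - Series (fun n => Re (logGamma_term (q, y) n))
     <= (p - q) * Series (harmonic_defect y)).
  { rewrite <- Series_minus, <- Series_scal_l by auto. apply Series_le_gen.
    - apply (ex_series_minus (V := R_NormedModule)); auto.
    - apply (ex_series_scal_l (K := R_AbsRing) (V := R_NormedModule)); auto.
    - intros n. unfold logGamma_term, harmonic_defect. cbv zeta.
      pose proof (INR_S_ge_1 n) as Hk. set (k := INR (S n)) in *.
      assert (HR : forall a, 0 < a -> Re ((a, y) / RtoC k - Clog (1 + (a, y) / RtoC k))%C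
         = a / k - (ln (Cmod (k + a, y)) - ln k)).
      { intros a Ha.
        assert (E1 : ((a, y) / RtoC k)%C = (a / k, y / k)).
        { unfold Cdiv. rewrite <- RtoC_inv by lra. apply C_eq; unfold Re, Im; simpl; field; lra. }
        rewrite E1.
        change (Re (((a / k)%R, (y / k)%R) - Clog (1 + ((a / k)%R, (y / k)%R)))%C)
          with (a / k - ln (Cmod (1 + ((a / k)%R, (y / k)%R))%C)).
        assert (E2 : (1 + ((a / k)%R, (y / k)%R))%C = (((k + a)%R, y) / RtoC k)%C).
        { unfold Cdiv. rewrite <- RtoC_inv by lra. apply C_eq; unfold Re, Im; simpl; field; lra. }
        assert (0 < Cmod (k + a, y)) by (apply Cmod_gt_0, Re_pos_neq_0; simpl; lra).
        rewrite E2, Cmod_div by (apply RtoC_neq_0; lra).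
        rewrite Cmod_R, (Rabs_right k), ln_div by lra. reflexivity. }
      rewrite !HR by lra.
      specialize (Hlog k ltac:(lra)).
      replace ((p - q) * (/ k - k / ((k + 1) ^ 2 + y ^ 2)))
        with ((p / k - q / k) - (p - q) * (k / ((k + 1) ^ 2 + y ^ 2))) by (field; nra).
      lra. }
  specialize (Hlog 0 (Rle_refl 0)).
  rewrite !Rplus_0_l in Hlog. unfold Rdiv in Hlog. rewrite Rmult_0_l, Rmult_0_r in Hlog.
  change (((- euler_gamma * p - 0 * y) - ln (Cmod (p, y)) + Series (fun n => Re (logGamma_term (p, y) n)))
   - ((- euler_gamma * q - 0 * y) - ln (Cmod (q, y)) + Series (fun n => Re (logGamma_term (q, y) n)))
   <= (p - q) * (- euler_gamma + / 2 * ln (1 + y ^ 2) + 4)).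
  apply Rmult_le_compat_l with (r := p - q) in HS; [|lra]. lra.
Qed.

(** At z = tau - i/4 the Gamma arguments are 3/8 + i tau/2 and 1/8 - i tau/2, both in the right
    half-plane, and theta(t) is real. The true growth is |tau|^(1/8); linear growth suffices against
    the kernel. It covers all real tau, including those far from t, where no expansion is
    available. *)
Lemma Cmod_Cexp_theta_line :
  exists A, 0 < A /\ forall t tau : R,
    Cmod (Cexp (Ci * (RStheta (tau, (- (1 / 4))%R) - RStheta (RtoC t)))) <= A * (1 + Rabs tau).
Proof.
  set (c := / 8 * (- euler_gamma + 4) - ln PI / 8).
  exists (exp c). split; [apply exp_pos|]. intros t tau.
  rewrite Cmod_Cexp.
  assert (Hp : 0 < 1 + Rabs tau) by (pose proof (Rabs_pos tau); lra).
  rewrite <- (exp_ln (1 + Rabs tau)) by auto. rewrite <- exp_plus. apply exp_le.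
  assert (E0 := Re_Ci_RStheta_real t).
  replace (Ci * (RStheta (tau, (- (1 / 4))%R) - RStheta (RtoC t)))%C
    with (Ci * RStheta (tau, (- (1 / 4))%R) - Ci * RStheta (RtoC t))%C by ring.
  match goal with |- Re (?a - ?b)%C <= _ => change (Re a - Re b <= c + ln (1 + Rabs tau)) end.
  rewrite E0. unfold RStheta.
  replace (RtoC (1 / 4) + Ci * (tau, (- (1 / 4))%R) * RtoC (1 / 2))%C with ((3 / 8, tau / 2) : C)
    by (apply C_eq; unfold Re, Im; simpl; field).
  replace (RtoC (1 / 4) - Ci * (tau, (- (1 / 4))%R) * RtoC (1 / 2))%C with (Cconj (1 / 8, tau / 2))
    by (apply C_eq; unfold Re, Im; simpl; field).
  assert (E1 := Re_logGamma_conj (1 / 8, tau / 2)).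
  assert (H := Re_logGamma_diff_le (3 / 8) (1 / 8) (tau / 2) ltac:(lra) ltac:(lra) ltac:(lra)).
  rewrite <- E1 in H.
  assert (NCi : Ci <> 0) by (intros X; apply (f_equal Im) in X; simpl in X; lra).
  assert (N2 : RtoC 2 <> 0) by (apply RtoC_neq_0; lra).
  set (l1 := logGamma (3 / 8, tau / 2)) in *. set (l2 := logGamma (Cconj (1 / 8, tau / 2))) in *.
  replace (Ci * ((l1 - l2) / (2 * Ci) - (tau, (- (1 / 4))%R) * RtoC (ln PI / 2)))%C
    with (RtoC (/ 2) * (l1 - l2) - Ci * (tau, (- (1 / 4))%R) * RtoC (ln PI / 2))%C.
  2:{ rewrite RtoC_inv by lra. field; auto. }
  match goal with |- Re ?a - 0 <= _ =>
    replace (Re a) with (/ 2 * (Re l1 - Re l2) - ln PI / 8) by (unfold Re; simpl; field) end.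
  assert (HL : ln (1 + (tau / 2) ^ 2) <= 2 * ln (1 + Rabs tau)).
  { replace (2 * ln (1 + Rabs tau)) with (ln ((1 + Rabs tau) * (1 + Rabs tau)))
      by (rewrite ln_mult by auto; ring).
    apply Rcomplements.ln_le; [pose proof (pow2_ge_0 (tau / 2)); lra|].
    pose proof (pow2_abs tau). pose proof (Rabs_pos tau). nra. }
  assert (HL0 : 0 <= ln (1 + Rabs tau)).
  { rewrite <- ln_1. apply Rcomplements.ln_le; [lra|]. pose proof (Rabs_pos tau); lra. }
  unfold c. lra.
Qed.

(** * Bounds for zeta and the kernel *)

Lemma Cmod_Cpow_pos (a : R) (s : C) : Cmod (Cpow_pos a s) = Rpower a (Re s).
Proof.
  unfold Cpow_pos. rewrite Cmod_Cexp. unfold Rpower. f_equal. unfold Re; simpl. ring.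
Qed.

Lemma is_derive_Cpow_pos (c : C) (n v d : R) : 0 < n + d * v ->
  is_derive (fun v => Re (Cpow_pos (n + d * v) c)) v (Re (RtoC d * (c * Cpow_pos (n + d * v) (c - 1)))%C) /\
  is_derive (fun v => Im (Cpow_pos (n + d * v) c)) v (Im (RtoC d * (c * Cpow_pos (n + d * v) (c - 1)))%C).
Proof.
  intros H.
  assert (E : Cpow_pos (n + d * v) (c - 1)%C = (RtoC (/ (n + d * v)) * Cpow_pos (n + d * v) c)%C).
  { unfold Cpow_pos.
    replace ((c - 1) * RtoC (ln (n + d * v)))%C with (RtoC (- ln (n + d * v)) + c * RtoC (ln (n + d * v)))%C
      by (rewrite RtoC_opp; ring).
    rewrite Cexp_plus. f_equal. unfold Cexp. apply C_eq; unfold Re, Im; simpl.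
    - rewrite cos_0, exp_Ropp, exp_ln by auto. ring.
    - rewrite sin_0. ring. }
  rewrite E. unfold Cpow_pos, Cexp, Re, Im; simpl.
  split; auto_derive; auto; unfold Rminus; field; lra.
Qed.

Lemma Cpow_pos_diff_le (s : C) (n v : R) : 0 <= Re s -> 1 <= n -> 0 <= v <= 1 ->
  Cmod (Cpow_pos (n + v) (- s) - Cpow_pos n (- s))%C <= 2 * (Cmod s * Rpower n (- (1 + Re s))).
Proof.
  intros Hs Hn Hv.
  replace (n + v) with (n + v * 1) by ring. replace n with (n + v * 0) at 2 by ring.
  apply (Cmod_mean_value (fun w => Cpow_pos (n + v * w) (- s)%C)
    (fun w => (RtoC v * (- s * Cpow_pos (n + v * w) (- s - 1)))%C)).
  - intros w Hw. apply is_derive_Cpow_pos. nra.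
  - intros w Hw. apply is_derive_Cpow_pos. nra.
  - intros w Hw. rewrite !Cmod_mult, Cmod_opp, Cmod_R, Rabs_right by lra.
    rewrite Cmod_Cpow_pos.
    replace (Re (- s - 1)%C) with (- (1 + Re s)) by (unfold Re; simpl; ring).
    pose proof (Cmod_ge_0 s).
    assert (HP : Rpower (n + v * w) (- (1 + Re s)) <= Rpower n (- (1 + Re s))).
    { rewrite !Rpower_Ropp. apply Rinv_le_contravar; [apply exp_pos|].
      apply Rle_Rpower_l; nra. }
    assert (H0 : 0 <= Cmod s * Rpower (n + v * w) (- (1 + Re s))).
    { apply Rmult_le_pos; auto. apply Rlt_le, exp_pos. }
    apply Rle_trans with (Cmod s * Rpower (n + v * w) (- (1 + Re s))); [nra|].
    apply Rmult_le_compat_l; auto.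
Qed.

Definition zeta_term (s : C) (m : nat) : C :=
  let n := INR (S m) in
  (Cpow_pos n (- s) - (Cpow_pos (n + 1) (1 - s) - Cpow_pos n (1 - s)) / (1 - s))%C.

Lemma zeta_eq (s : C) : zeta s = (/ (s - 1) + Cseries (zeta_term s))%C.
Proof. reflexivity. Qed.

(** The term is the integral of n^(-s) - u^(-s) over [n, n + 1], obtained here as the increment of v
    n^(-s) - (n + v)^(1-s) / (1-s). Freezing the exponent at 3/2 makes the bound uniform for Re s >=
    1/2. *)
Lemma zeta_term_le (s : C) (m : nat) : / 2 <= Re s -> s <> 1 ->
  Cmod (zeta_term s m) <= 4 * Cmod s * Rpower (INR (S m)) (- (1 + / 2)).
Proof.
  intros Hs Hs1. unfold zeta_term. cbv zeta. pose proof (INR_S_ge_1 m) as Hn. set (n := INR (S m)) in *.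
  assert (N : (1 - s)%C <> 0).
  { intros E. apply Hs1. replace s with (1 - (1 - s))%C by ring. rewrite E. ring. }
  set (f := fun v => (RtoC v * Cpow_pos n (- s) - Cpow_pos (n + 1 * v) (1 - s) / (1 - s))%C).
  replace (_ - _)%C with (f 1 - f 0)%C.
  2:{ unfold f. replace (n + 1 * 1) with (n + 1) by ring. replace (n + 1 * 0) with n by ring. field; auto. }
  apply Rle_trans with (2 * (2 * (Cmod s * Rpower n (- (1 + Re s))))).
  - apply (Cmod_mean_value f (fun v => Cpow_pos n (- s) - Cpow_pos (n + v) (- s))%C).
    + intros v Hv. unfold f.
      destruct (is_derive_Cpow_pos (1 - s) n v 1 ltac:(lra)) as [D1 D2].
      replace (Re (Cpow_pos n (- s) - Cpow_pos (n + v) (- s))%C) with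
        (Re (Cpow_pos n (- s)) - (Re (/ (1 - s))%C * Re (RtoC 1 * ((1 - s) * Cpow_pos (n + 1 * v) (1 - s - 1)))%C
          - Im (/ (1 - s))%C * Im (RtoC 1 * ((1 - s) * Cpow_pos (n + 1 * v) (1 - s - 1)))%C)).
      2:{ replace (n + 1 * v) with (n + v) by ring. replace (1 - s - 1)%C with (- s)%C by ring.
          change (Re (Cpow_pos n (- s)) - Re (/ (1 - s) * (RtoC 1 * ((1 - s) * Cpow_pos (n + v) (- s))))%C
            = Re (Cpow_pos n (- s)) - Re (Cpow_pos (n + v) (- s))).
          f_equal. f_equal. field; auto. }
      apply is_derive_ext with (fun v => v * Re (Cpow_pos n (- s)) -
        (Re (/ (1 - s))%C * Re (Cpow_pos (n + 1 * v) (1 - s)) - Im (/ (1 - s))%C * Im (Cpow_pos (n + 1 * v) (1 - s)))).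
      { intros w. unfold Cdiv. generalize (Cpow_pos n (- s)) (Cpow_pos (n + 1 * w) (1 - s)) (/ (1 - s))%C.
        intros. unfold Re, Im; simpl. ring. }
      apply (is_derive_minus (V := R_NormedModule)).
      { generalize (Cpow_pos n (- s)). intros q. auto_derive; auto. ring. }
      apply (is_derive_minus (V := R_NormedModule)); apply is_derive_scal; assumption.
    + intros v Hv. unfold f.
      destruct (is_derive_Cpow_pos (1 - s) n v 1 ltac:(lra)) as [D1 D2].
      replace (Im (Cpow_pos n (- s) - Cpow_pos (n + v) (- s))%C) with
        (Im (Cpow_pos n (- s)) - (Re (/ (1 - s))%C * Im (RtoC 1 * ((1 - s) * Cpow_pos (n + 1 * v) (1 - s - 1)))%C
          + Im (/ (1 - s))%C * Re (RtoC 1 * ((1 - s) * Cpow_pos (n + 1 * v) (1 - s - 1)))%C)).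
      2:{ replace (n + 1 * v) with (n + v) by ring. replace (1 - s - 1)%C with (- s)%C by ring.
          change (Im (Cpow_pos n (- s)) - Im (/ (1 - s) * (RtoC 1 * ((1 - s) * Cpow_pos (n + v) (- s))))%C
            = Im (Cpow_pos n (- s)) - Im (Cpow_pos (n + v) (- s))).
          f_equal. f_equal. field; auto. }
      apply is_derive_ext with (fun v => v * Im (Cpow_pos n (- s)) -
        (Re (/ (1 - s))%C * Im (Cpow_pos (n + 1 * v) (1 - s)) + Im (/ (1 - s))%C * Re (Cpow_pos (n + 1 * v) (1 - s)))).
      { intros w. unfold Cdiv. generalize (Cpow_pos n (- s)) (Cpow_pos (n + 1 * w) (1 - s)) (/ (1 - s))%C.
        intros. unfold Re, Im; simpl. ring. }
      apply (is_derive_minus (V := R_NormedModule)).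
      { generalize (Cpow_pos n (- s)). intros q. auto_derive; auto. ring. }
      apply (is_derive_plus (V := R_NormedModule)); apply is_derive_scal; assumption.
    + intros v Hv. rewrite Cmod_minus_sym. apply Cpow_pos_diff_le; auto; lra.
  - replace (2 * (2 * (Cmod s * Rpower n (- (1 + Re s))))) with (4 * Cmod s * Rpower n (- (1 + Re s))) by ring.
    apply Rmult_le_compat_l; [pose proof (Cmod_ge_0 s); lra|].
    rewrite !Rpower_Ropp. apply Rinv_le_contravar; [apply exp_pos|].
    apply Rle_Rpower; lra.
Qed.

Lemma zeta_tail_le (s : C) (N : nat) : / 2 <= Re s -> s <> 1 ->
  Cmod (zeta s - (/ (s - 1) + csum (zeta_term s) N))%C
   <= 8 * Cmod s * Series (fun k => Rpower (INR (S (N + k))) (- (1 + / 2))).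
Proof.
  intros Hs Hs1. rewrite zeta_eq.
  replace (_ - _)%C with (Cseries (zeta_term s) - csum (zeta_term s) N)%C by ring.
  assert (Hex := proj1 (p_series (/ 2) ltac:(lra))).
  eapply Rle_trans.
  - apply (Cseries_tail _ (fun m => 4 * Cmod s * Rpower (INR (S m)) (- (1 + / 2)))).
    + intros m. apply zeta_term_le; auto.
    + apply (ex_series_scal_l (K := R_AbsRing) (V := R_NormedModule)); auto.
  - rewrite Series_scal_l. lra.
Qed.

(** The constant is 8 times 3, where 3 = 1 + 1/(1/2) bounds the sum of n^(-3/2). Linear growth is
    enough wherever the kernel supplies a power of t. *)
Lemma zeta_le (s : C) : / 2 <= Re s -> s <> 1 ->
  Cmod (zeta s) <= / Cmod (s - 1)%C + 24 * Cmod s.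
Proof.
  intros Hs Hs1.
  assert (N : (s - 1)%C <> 0).
  { intros E. apply Hs1. replace s with ((s - 1) + 1)%C by ring. rewrite E. ring. }
  assert (H := zeta_tail_le s 0 Hs Hs1).
  replace (zeta s) with (/ (s - 1) + (zeta s - (/ (s - 1) + csum (zeta_term s) 0)))%C by (simpl; ring).
  eapply Rle_trans; [apply Cmod_triangle|]. rewrite Cmod_inv by auto.
  assert (HS := proj2 (p_series (/ 2) ltac:(lra))).
  change (fun k => Rpower (INR (S (0 + k))) (- (1 + / 2))) with (fun k => Rpower (INR (S k)) (- (1 + / 2))) in H.
  pose proof (Cmod_ge_0 s).
  set (Z := Series (fun k => Rpower (INR (S k)) (- (1 + / 2)))) in *.
  assert (8 * Cmod s * Z <= 8 * Cmod s * 3).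
  { apply Rmult_le_compat_l; [lra|]. replace 3 with (1 + / / 2) by field. exact HS. }
  lra.
Qed.

(* For [Re s = 1 + d] the subtracted terms telescope, leaving the Dirichlet series. *)
Lemma zeta_bounded (d : R) : 0 < d ->
  forall s, Re s = 1 + d -> Cmod (zeta s) <= 1 + 2 * / d.
Proof.
  intros Hd s Hs.
  assert (Hs1 : s <> 1) by (intros E; rewrite E in Hs; simpl in Hs; lra).
  assert (N : (1 - s)%C <> 0).
  { intros E. apply Hs1. replace s with (1 - (1 - s))%C by ring. rewrite E. ring. }
  assert (N' : (s - 1)%C <> 0).
  { intros E. apply Hs1. replace s with ((s - 1) + 1)%C by ring. rewrite E. ring. }
  assert (HM : d <= Cmod (1 - s)%C).
  { rewrite Cmod_minus_sym. eapply Rle_trans; [|apply re_le_Cmod].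
    change (d <= Rabs (Re s - 1)). rewrite Hs, Rabs_right; lra. }
  assert (HP := p_series d Hd). destruct HP as [Hex HS].
  assert (Hid : 0 < / d) by (apply Rinv_0_lt_compat; auto).
  (* The telescoping leaves the boundary term (n + 1)^(1-s) / (1-s), whose modulus is at most 1/d
     for every n; with 1 + 1/d for the Dirichlet sum this makes up 1 + 2/d. *)
  assert (Hpart : forall n, (/ (s - 1) + csum (zeta_term s) n)%C =
     (csum (fun m => Cpow_pos (INR (S m)) (- s)) n - Cpow_pos (INR (S n)) (1 - s) / (1 - s))%C).
  { induction n as [|n IH].
    - simpl csum. unfold Cpow_pos. simpl INR. rewrite ln_1.
      replace ((1 - s) * RtoC 0)%C with (RtoC 0) by ring. rewrite Cexp_0. field; auto.
    - rewrite !csum_S, Cplus_assoc, IH. unfold zeta_term. cbv zeta.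
      rewrite (S_INR (S n)). field; auto. }
  assert (Hsum : forall n, Cmod (csum (fun m => Cpow_pos (INR (S m)) (- s)) n) <= 1 + / d).
  (* Partial sum plus remaining tail is an invariant that passes from n to n + 1 by the triangle
     inequality. *)
  { assert (Hk : forall n, Cmod (csum (fun m => Cpow_pos (INR (S m)) (- s)) n)
        + Series (fun k => Rpower (INR (S (n + k))) (- (1 + d))) <= Series (fun k => Rpower (INR (S k)) (- (1 + d)))).
    { induction n as [|n IH].
      - simpl csum. rewrite Cmod_0. simpl. lra.
      - rewrite csum_S. eapply Rle_trans; [|exact IH].
        assert (HI : Series (fun k => Rpower (INR (S (n + k))) (- (1 + d)))
           = Rpower (INR (S (n + 0))) (- (1 + d)) + Series (fun k => Rpower (INR (S (n + S k))) (- (1 + d)))).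
        { apply (Series_incr_1 (fun k => Rpower (INR (S (n + k))) (- (1 + d)))).
          apply (proj1 (ex_series_incr_n (K := R_AbsRing) (V := R_NormedModule) (fun k => Rpower (INR (S k)) (- (1 + d))) n)). auto. }
        rewrite HI. rewrite Nat.add_0_r.
        replace (Series (fun k => Rpower (INR (S (n + S k))) (- (1 + d))))
          with (Series (fun k => Rpower (INR (S (S n + k))) (- (1 + d))))
          by (apply Series_ext; intros k; do 2 f_equal; lia).
        assert (HT := Cmod_triangle (csum (fun m => Cpow_pos (INR (S m)) (- s)) n) (Cpow_pos (INR (S n)) (- s))).
        rewrite (Cmod_Cpow_pos (INR (S n))) in HT.
        replace (Re (- s)%C) with (- (1 + d)) in HT by (rewrite <- Hs; reflexivity). lra. }
    intros n. specialize (Hk n).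
    assert (0 <= Series (fun k => Rpower (INR (S (n + k))) (- (1 + d)))).
    { apply Series_nonneg; [intros; apply Rlt_le, exp_pos|].
      apply (proj1 (ex_series_incr_n (K := R_AbsRing) (V := R_NormedModule) (fun k => Rpower (INR (S k)) (- (1 + d))) n)). auto. }
    lra. }
  apply le_epsilon. intros e He.
  destruct (Series_tail_small (fun k => Rpower (INR (S k)) (- (1 + / 2))) (e / (8 * Cmod s + 1))) as [n Hn].
  { apply p_series; lra. }
  { apply Rdiv_lt_0_compat; auto. pose proof (Cmod_ge_0 s). lra. }
  assert (HZ := zeta_tail_le s n ltac:(lra) Hs1). rewrite Hpart in HZ.
  pose proof (Cmod_ge_0 s).
  assert (8 * Cmod s * Series (fun k => Rpower (INR (S (n + k))) (- (1 + / 2))) <= e).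
  { apply Rle_trans with (8 * Cmod s * (e / (8 * Cmod s + 1))); [apply Rmult_le_compat_l; lra|].
    apply Rmult_le_reg_r with (8 * Cmod s + 1); [lra|].
    replace (8 * Cmod s * (e / (8 * Cmod s + 1)) * (8 * Cmod s + 1)) with (8 * Cmod s * e) by (field; lra).
    nra. }
  assert (HL : Cmod (Cpow_pos (INR (S n)) (1 - s) / (1 - s))%C <= / d).
  { rewrite Cmod_div, Cmod_Cpow_pos by auto.
    replace (Re (1 - s)%C) with (- d) by (change (Re (1 - s)%C) with (1 - Re s); rewrite Hs; ring).
    rewrite <- (Rmult_1_l (/ d)). apply Rmult_le_compat.
    - apply Rlt_le, exp_pos.
    - apply Rlt_le, Rinv_0_lt_compat; lra.
    - rewrite Rpower_Ropp, <- Rinv_1. apply Rinv_le_contravar; [lra|].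
      rewrite <- (Rpower_O (INR (S n))) by (pose proof (INR_S_ge_1 n); lra).
      apply Rle_Rpower; [apply INR_S_ge_1 | lra].
    - apply Rinv_le_contravar; auto. }
  set (A := csum (fun m => Cpow_pos (INR (S m)) (- s)) n) in *.
  set (B := (Cpow_pos (INR (S n)) (1 - s) / (1 - s))%C) in *.
  replace (zeta s) with ((zeta s - (A - B)) + A - B)%C by ring.
  eapply Rle_trans; [apply Cmod_minus_le|].
  eapply Rle_trans; [apply Rplus_le_compat_r, Cmod_triangle|].
  specialize (Hsum n). fold A in Hsum. lra.
Qed.

(** * The kernel between its poles 0 and -2i *)

Lemma Csinh_im (u s : R) :
  Im (Csinh (RtoC (PI / 2) * (u, (- s)%R))) = - (cosh (PI / 2 * u) * sin (PI / 2 * s)).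
Proof.
  unfold Csinh, Cdiv. rewrite <- RtoC_inv by lra.
  unfold Cexp, cosh, Im, Re; simpl.
  replace (PI / 2 * u - 0 * - s) with (PI / 2 * u) by ring.
  replace (PI / 2 * - s + 0 * u) with (- (PI / 2 * s)) by ring.
  rewrite Ropp_involutive, sin_neg. field.
Qed.

(** The imaginary part alone is cosh(PI u/2) sin(PI s/2) up to sign, and the sine is positive
    between the poles. The rate PI/2 is lowered to 3/2: 1 is kept for integration and truncation,
    1/2 is left to absorb polynomials in |u|. *)
Lemma Cmod_Csinh_ge (u s : R) : 0 < s < 2 ->
  exp (3 / 2 * Rabs u) / 2 * sin (PI / 2 * s) <= Cmod (Csinh (RtoC (PI / 2) * (u, (- s)%R))) /\
  0 < sin (PI / 2 * s).
Proof.
  intros Hs. pose proof PI_RGT_0.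
  assert (Hsin : 0 < sin (PI / 2 * s)) by (apply sin_gt_0; nra).
  split; auto. eapply Rle_trans; [|apply im_le_Cmod].
  rewrite Csinh_im, Rabs_Ropp, Rabs_mult, (Rabs_right (sin _)) by lra.
  apply Rmult_le_compat_r; [lra|].
  unfold cosh. assert (H1 := exp_pos (PI / 2 * u)). assert (H2 := exp_pos (- (PI / 2 * u))).
  rewrite (Rabs_right ((_ + _) / 2)) by lra.
  assert (HPI : 3 <= PI) by (pose proof PI2_3_2; lra).
  apply Rmult_le_compat_r; [lra|].
  destruct (Rle_dec 0 u) as [Hu|Hu].
  - rewrite Rabs_right by lra. assert (exp (3 / 2 * u) <= exp (PI / 2 * u)) by (apply exp_le; nra). lra.
  - rewrite Rabs_left by lra. assert (exp (3 / 2 * - u) <= exp (- (PI / 2 * u))) by (apply exp_le; nra). lra.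
Qed.

Lemma Csinh_neq_0 (u s : R) : 0 < s < 2 -> Csinh (RtoC (PI / 2) * (u, (- s)%R)) <> 0.
Proof.
  intros Hs. destruct (Cmod_Csinh_ge u s Hs) as [H1 H2].
  apply Cmod_neq_0 with (2 := H1). pose proof (exp_pos (3 / 2 * Rabs u)). nra.
Qed.

Lemma kernel_le (u s : R) : 0 < s < 2 ->
  Cmod (kernel (u, (- s)%R)) <= PI / sin (PI / 2 * s) * exp (- (3 / 2 * Rabs u)).
Proof.
  intros Hs. pose proof PI_RGT_0. destruct (Cmod_Csinh_ge u s Hs) as [H1 H2].
  pose proof (exp_pos (3 / 2 * Rabs u)) as H3.
  unfold kernel.
  assert (N2 : RtoC 2 <> 0) by (apply RtoC_neq_0; lra).
  rewrite Cmod_div by (apply Cmult_neq_0; auto using Csinh_neq_0).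
  rewrite Cmod_mult, !Cmod_R, !Rabs_right by lra.
  rewrite exp_Ropp.
  replace (PI / sin (PI / 2 * s) * / exp (3 / 2 * Rabs u))
    with (PI * / (2 * (exp (3 / 2 * Rabs u) / 2 * sin (PI / 2 * s)))) by (field; lra).
  apply Rmult_le_compat_l; [lra|]. apply Rinv_le_contravar; nra.
Qed.

Lemma sin_half_ge (a1 a2 : R) : 0 < a1 -> a2 < 2 -> exists m, 0 < m /\
  forall s, a1 <= s <= a2 -> m <= sin (PI / 2 * s).
Proof.
  intros H1 H2. pose proof PI_RGT_0.
  destruct (Rle_dec a1 a2) as [Ha|Ha].
  2:{ exists 1. split; [lra|]. intros s Hs. lra. }
  exists (Rmin (sin (PI / 2 * a1)) (sin (PI / 2 * a2))). split.
  - apply Rmin_pos; apply sin_gt_0; nra.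
  - intros s Hs. destruct (Rle_dec s 1) as [Hs1|Hs1].
    + eapply Rle_trans; [apply Rmin_l|]. apply sin_incr_1; nra.
    + eapply Rle_trans; [apply Rmin_r|].
      apply sin_decr_1; nra.
Qed.

(** * Improper integrals *)

Lemma is_RInt_exp_decay (M a b : R) :
  is_RInt (fun u => M * exp (- u)) a b (M * exp (- a) - M * exp (- b)).
Proof.
  replace (M * exp (- a) - M * exp (- b)) with (minus (- M * exp (- b)) (- M * exp (- a)))
    by (change (- M * exp (- b) - - M * exp (- a) = M * exp (- a) - M * exp (- b)); ring).
  apply (is_RInt_derive (V := R_CompleteNormedModule) (fun u => - M * exp (- u))).
  - intros x _. auto_derive; auto. ring.
  - intros x _. apply (ex_derive_continuous (K := R_AbsRing) (V := R_NormedModule) (fun u => M * exp (- u))).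
    auto_derive; auto.
Qed.

Lemma is_RInt_exp_growth (M a b : R) :
  is_RInt (fun u => M * exp u) a b (M * exp b - M * exp a).
Proof.
  apply (is_RInt_derive (V := R_CompleteNormedModule) (fun u => M * exp u)).
  - intros x _. auto_derive; auto. ring.
  - intros x _. apply (ex_derive_continuous (K := R_AbsRing) (V := R_NormedModule) (fun u => M * exp u)).
    auto_derive; auto.
Qed.

Lemma CInt_Chasles (f : R -> C) (a b c : R) : (forall u, Ccont f u) ->
  (CInt f a b + CInt f b c)%C = CInt f a c.
Proof.
  intros H. apply (RInt_Chasles (V := C_R_CompleteNormedModule) f a b c);
    eexists; apply CInt_is_RInt; auto.
Qed.

Lemma CInt_right_le (f : R -> C) (M b c : R) : 0 <= M -> 0 <= b <= c -> (forall u, Ccont f u) ->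
  (forall u, Cmod (f u) <= M * exp (- Rabs u)) -> Cmod (CInt f b c) <= M * exp (- b).
Proof.
  intros HM Hb Hf HB.
  apply Rle_trans with (M * exp (- b) - M * exp (- c)).
  - apply (CInt_bound f (fun u => M * exp (- u))); auto; try lra.
    + intros u Hu. specialize (HB u). rewrite Rabs_right in HB by lra. exact HB.
    + apply is_RInt_exp_decay.
  - pose proof (exp_pos (- c)). nra.
Qed.

Lemma CInt_left_le (f : R -> C) (M b c : R) : 0 <= M -> 0 <= b <= c -> (forall u, Ccont f u) ->
  (forall u, Cmod (f u) <= M * exp (- Rabs u)) -> Cmod (CInt f (- c) (- b)) <= M * exp (- b).
Proof.
  intros HM Hb Hf HB.
  apply Rle_trans with (M * exp (- b) - M * exp (- c)).
  - apply (CInt_bound f (fun u => M * exp u)); auto; try lra.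
    + intros u Hu. specialize (HB u). rewrite Rabs_left1, Ropp_involutive in HB by lra. exact HB.
    + apply is_RInt_exp_growth.
  - pose proof (exp_pos (- c)). nra.
Qed.

Lemma CInt_sym_le (f : R -> C) (M b : R) : 0 <= M -> 0 <= b ->
  (forall u, - b <= u <= b -> Ccont f u) ->
  (forall u, - b <= u <= b -> Cmod (f u) <= M * exp (- Rabs u)) -> Cmod (CInt f (- b) b) <= 2 * M.
Proof.
  intros HM Hb Hf HB.
  assert (HE : forall a c, - b <= a <= c -> c <= b -> is_RInt (V := C_R_NormedModule) f a c (CInt f a c)).
  { intros a c H1 H2. apply CInt_is_RInt. intros u Hu. rewrite Rmin_left, Rmax_right in Hu by lra.
    apply Hf. lra. }
  assert (E : (CInt f (- b) 0 + CInt f 0 b)%C = CInt f (- b) b).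
  { apply (RInt_Chasles (V := C_R_CompleteNormedModule) f (- b) 0 b); eexists; apply HE; lra. }
  rewrite <- E. eapply Rle_trans; [apply Cmod_triangle|].
  assert (H1 : Cmod (CInt f (- b) 0) <= M * exp 0 - M * exp (- b)).
  { apply (CInt_bound f (fun u => M * exp u)); try lra.
    - intros u Hu. apply Hf. lra.
    - intros u Hu. specialize (HB u ltac:(lra)). rewrite Rabs_left1, Ropp_involutive in HB by lra. exact HB.
    - apply is_RInt_exp_growth. }
  assert (H2 : Cmod (CInt f 0 b) <= M * exp (- 0) - M * exp (- b)).
  { apply (CInt_bound f (fun u => M * exp (- u))); try lra.
    - intros u Hu. apply Hf. lra.
    - intros u Hu. specialize (HB u ltac:(lra)). rewrite Rabs_right in HB by lra. exact HB.
    - apply is_RInt_exp_decay. }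
  rewrite Ropp_0 in H2. rewrite exp_0 in H1, H2. pose proof (exp_pos (- b)). nra.
Qed.

Lemma CInt_extend_le (f : R -> C) (M b a c : R) : 0 <= M -> 0 <= b -> a <= - b -> b <= c ->
  (forall u, Ccont f u) -> (forall u, Cmod (f u) <= M * exp (- Rabs u)) ->
  Cmod (CInt f a c - CInt f (- b) b)%C <= 2 * M * exp (- b).
Proof.
  intros HM Hb Ha Hc Hf HB.
  rewrite <- (CInt_Chasles f a (- b) c), <- (CInt_Chasles f (- b) b c) by auto.
  replace (_ - _)%C with (CInt f a (- b) + CInt f b c)%C by ring.
  eapply Rle_trans; [apply Cmod_triangle|].
  assert (H1 := CInt_right_le f M b c HM ltac:(lra) Hf HB).
  assert (H2 := CInt_left_le f M b (- a) HM ltac:(lra) Hf HB).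
  rewrite Ropp_involutive in H2. lra.
Qed.

(** [RInt_gen] says nothing until a limit is known to exist. The exponential bound first yields a
    Cauchy condition on the integrals over large intervals, and then the tail estimate passes to the
    limit. *)
Lemma CInt_gen_tail (f : R -> C) (M b : R) : 0 <= M -> 0 <= b ->
  (forall u, Ccont f u) -> (forall u, Cmod (f u) <= M * exp (- Rabs u)) ->
  Cmod (@RInt_gen C_R_CompleteNormedModule f (Rbar_locally m_infty) (Rbar_locally p_infty)
        - CInt f (- b) b)%C <= 2 * M * exp (- b).
Proof.
  intros HM Hb Hf HB.
  set (F := filter_prod (Rbar_locally m_infty) (Rbar_locally p_infty)).
  set (g := fun ac : R * R => CInt f (fst ac) (snd ac)).
  assert (HF : forall r, F (fun ac => fst ac <= - r /\ r <= snd ac)).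
  { intros r. apply Filter_prod with (fun a => a < - r) (fun c => r < c).
    - exists (- r). auto.
    - exists r. auto.
    - intros a c H1 H2. simpl. lra. }
  assert (Hlim : exists l : C_R_CompleteNormedModule, filterlim g F (locally l)).
  { apply (proj1 (filterlim_locally_cauchy (U := C_R_CompleteNormedModule) (F := F) g)).
    intros eps. pose proof (cond_pos eps) as He.
    assert (Hr : exists r, 0 <= r /\ 2 * (2 * M * exp (- r)) < eps).
    (* With r = 4M/eps the inequality 1 + r <= e^r gives 4 M e^(-r) < eps. *)
    { exists (4 * M / eps).
      assert (Hr0 : 0 <= 4 * M / eps) by (apply Rmult_le_pos; [lra|apply Rlt_le, Rinv_0_lt_compat; auto]).
      split; auto. rewrite exp_Ropp. pose proof (exp_pos (4 * M / eps)).
      assert (1 + 4 * M / eps <= exp (4 * M / eps)).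
      { destruct (Req_dec (4 * M / eps) 0) as [E|E]; [rewrite E, exp_0; lra|].
        left. apply exp_ineq1; auto. }
      apply Rmult_lt_reg_r with (exp (4 * M / eps)); auto.
      replace (2 * (2 * M * / exp (4 * M / eps)) * exp (4 * M / eps)) with (4 * M) by (field; lra).
      assert (eps * (1 + 4 * M / eps) = eps + 4 * M) by (field; lra). nra. }
    destruct Hr as (r & Hr0 & Hr).
    exists (fun ac => fst ac <= - r /\ r <= snd ac). split; [apply HF|].
    intros [a1 c1] [a2 c2] [H1 H2] [H3 H4]. simpl in *.
    apply (norm_compat1 (V := C_R_NormedModule)). rewrite norm_C_R. unfold g; simpl.
    assert (D1 := CInt_extend_le f M r a1 c1 HM Hr0 H1 H2 Hf HB).
    assert (D2 := CInt_extend_le f M r a2 c2 HM Hr0 H3 H4 Hf HB).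
    change (Cmod (CInt f a2 c2 - CInt f a1 c1)%C < eps).
    replace (CInt f a2 c2 - CInt f a1 c1)%C
      with ((CInt f a2 c2 - CInt f (- r) r) - (CInt f a1 c1 - CInt f (- r) r))%C by ring.
    eapply Rle_lt_trans; [apply Cmod_minus_le|]. lra. }
  destruct Hlim as [l Hl].
  assert (HI : is_RInt_gen (V := C_R_NormedModule) f (Rbar_locally m_infty) (Rbar_locally p_infty) l).
  { intros P HP. specialize (Hl P HP). unfold filtermapi. unfold filtermap in Hl.
    apply filter_imp with (2 := Hl). intros ac Hac. exists (g ac). split; auto.
    apply CInt_is_RInt; auto. }
  rewrite (is_RInt_gen_unique (V := C_R_CompleteNormedModule) f l HI).
  apply le_epsilon. intros e He.
  (* Balls of the uniform structure and of the norm agree only up to [norm_factor], so the radius is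
     divided by it in advance. *)
  set (nf := @norm_factor R_AbsRing C_R_NormedModule).
  assert (Hnf : 0 < nf) by apply norm_factor_gt_0.
  assert (He' : 0 < e / nf) by (apply Rdiv_lt_0_compat; auto).
  assert (Hb' : locally l (ball l (mkposreal _ He'))) by (exists (mkposreal _ He'); auto).
  specialize (Hl _ Hb'). unfold filtermap in Hl.
  destruct (filter_ex (F := F) _ (filter_and _ _ Hl (HF b))) as ([a c] & H1 & H2 & H3).
  simpl in H2, H3.
  apply (norm_compat2 (V := C_R_NormedModule)) in H1. rewrite norm_C_R in H1. unfold g in H1; simpl in H1.
  change (Cmod (CInt f a c - l)%C < nf * (e / nf)) in H1.
  replace (nf * (e / nf)) with e in H1 by (field; lra).
  replace (l - CInt f (- b) b)%C with ((CInt f a c - CInt f (- b) b) - (CInt f a c - l))%C by ring.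
  eapply Rle_trans; [apply Cmod_minus_le|].
  assert (D1 := CInt_extend_le f M b a c HM Hb H2 H3 Hf HB). lra.
Qed.

(** * The integrands as limits of holomorphic functions *)

Definition strip (b : R) (x : C) : Prop := Rabs (Re x) < b + 1 /\ 0 < - Im x < 2.

(** Hiding the derivative lets closure under the operations be applied without ever writing
    derivative formulas. *)
Definition HolOn (D : C -> Prop) (f : C -> C) : Prop := exists f', forall z, D z -> Hol f f' z.

Lemma HolOn_const (D : C -> Prop) (c : C) : HolOn D (fun _ => c).
Proof. eexists. intros z _. apply Hol_const. Qed.

Lemma HolOn_id (D : C -> Prop) : HolOn D (fun z => z).
Proof. eexists. intros z _. apply Hol_id. Qed.

Lemma HolOn_plus (D : C -> Prop) (f g : C -> C) : HolOn D f -> HolOn D g -> HolOn D (fun z => f z + g z)%C.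
Proof. intros [f' Hf] [g' Hg]. eexists. intros z Hz. apply Hol_plus; eauto. Qed.

Lemma HolOn_mult (D : C -> Prop) (f g : C -> C) : HolOn D f -> HolOn D g -> HolOn D (fun z => f z * g z)%C.
Proof. intros [f' Hf] [g' Hg]. eexists. intros z Hz. apply Hol_mult; eauto. Qed.

Lemma HolOn_ext (D : C -> Prop) (f g : C -> C) : (forall z, f z = g z) -> HolOn D f -> HolOn D g.
Proof. intros E [f' Hf]. exists f'. intros z Hz. eapply Hol_ext; eauto. Qed.

Lemma HolOn_opp (D : C -> Prop) (f : C -> C) : HolOn D f -> HolOn D (fun z => - f z)%C.
Proof.
  intros Hf. apply HolOn_ext with (fun z => -1 * f z)%C; [intros; ring|].
  apply HolOn_mult; auto using HolOn_const.
Qed.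

Lemma HolOn_minus (D : C -> Prop) (f g : C -> C) : HolOn D f -> HolOn D g -> HolOn D (fun z => f z - g z)%C.
Proof. intros Hf Hg. apply HolOn_plus; auto using HolOn_opp. Qed.

Lemma HolOn_Cexp (D : C -> Prop) (f : C -> C) : HolOn D f -> HolOn D (fun z => Cexp (f z)).
Proof. intros [f' Hf]. eexists. intros z Hz. apply Hol_comp; eauto. apply Hol_Cexp. Qed.

Lemma HolOn_inv (D : C -> Prop) (f : C -> C) : (forall z, D z -> f z <> 0) -> HolOn D f -> HolOn D (fun z => / f z)%C.
Proof.
  intros H [f' Hf]. eexists. intros z Hz. apply (Hol_comp f f' Cinv); eauto. apply Hol_Cinv; auto.
Qed.

Lemma HolOn_div (D : C -> Prop) (f g : C -> C) : (forall z, D z -> g z <> 0) ->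
  HolOn D f -> HolOn D g -> HolOn D (fun z => f z / g z)%C.
Proof. intros H Hf Hg. apply HolOn_mult; auto using HolOn_inv. Qed.

Lemma HolOn_div_const (D : C -> Prop) (f : C -> C) (c : C) : HolOn D f -> HolOn D (fun z => f z / c)%C.
Proof. intros Hf. apply HolOn_mult; auto using HolOn_const. Qed.

Lemma HolOn_Clog_1p (D : C -> Prop) (f : C -> C) : (forall z, D z -> Cmod (f z) <= / 2) ->
  HolOn D f -> HolOn D (fun z => Clog (1 + f z)).
Proof.
  intros H [f' Hf]. eexists. intros z Hz.
  apply (Hol_comp f f' (fun z => Clog (1 + z)%C)); eauto. apply Hol_Clog_1p.
  specialize (H z Hz). apply Re_ge_of_Cmod_le in H. change (0 < 1 + Re (f z)). lra.
Qed.

Lemma HolOn_csum (D : C -> Prop) (a : C -> nat -> C) (N : nat) :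
  (forall n, HolOn D (fun z => a z n)) -> HolOn D (fun z => csum (a z) N).
Proof.
  intros H. induction N as [|N IH]; simpl; auto using HolOn_const, HolOn_plus.
Qed.

Lemma HolOn_Cpow_pos (D : C -> Prop) (f : C -> C) (a : R) : HolOn D f -> HolOn D (fun z => Cpow_pos a (f z)).
Proof. intros Hf. apply HolOn_Cexp, HolOn_mult; auto using HolOn_const. Qed.

Lemma HolOn_zeta_term (D : C -> Prop) (f : C -> C) (m : nat) : (forall z, D z -> f z <> 1) ->
  HolOn D f -> HolOn D (fun z => zeta_term (f z) m).
Proof.
  intros H Hf. unfold zeta_term. cbv zeta.
  apply HolOn_minus; [apply HolOn_Cpow_pos; auto using HolOn_opp|].
  apply HolOn_div.
  - intros z Hz E. apply (H z Hz). replace (f z) with (1 - (1 - f z))%C by ring. rewrite E. ring.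
  - apply HolOn_minus; apply HolOn_Cpow_pos; apply HolOn_minus; auto using HolOn_const.
  - apply HolOn_minus; auto using HolOn_const.
Qed.

Lemma HolOn_kernel (b : R) : HolOn (strip b) kernel.
Proof.
  unfold kernel. apply HolOn_div.
  - intros [u s] [_ Hz]. simpl in Hz.
    apply Cmult_neq_0; [apply RtoC_neq_0; lra|].
    replace s with (- - s) by ring. apply Csinh_neq_0. lra.
  - apply HolOn_const.
  - apply HolOn_mult; [apply HolOn_const|]. unfold Csinh. apply HolOn_div_const.
    assert (HL : HolOn (strip b) (fun x => RtoC (PI / 2) * x)%C)
      by (apply HolOn_mult; auto using HolOn_const, HolOn_id).
    apply HolOn_minus; apply HolOn_Cexp; auto using HolOn_opp.
Qed.

Lemma HolOn_theta_rem (D : C -> Prop) (t : R) (k : nat) : (forall x, D x -> Cmod x <= Cmod (pole t k)) ->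
  HolOn D (theta_rem t k).
Proof.
  intros H. unfold theta_rem.
  assert (HL : HolOn D (fun x => Ci * x / 2)%C).
  { apply HolOn_div_const, HolOn_mult; auto using HolOn_const, HolOn_id. }
  assert (HR : forall f, (forall x, D x -> Cmod (f x) <= / 2) -> HolOn D f -> HolOn D (fun x => log_rem (f x))).
  { intros f Hf1 Hf. unfold log_rem. apply HolOn_minus; [apply HolOn_Clog_1p; auto|].
    apply HolOn_minus; auto. apply HolOn_div_const, HolOn_mult; auto. }
  apply HolOn_div_const, HolOn_minus; apply HR.
  - intros x Hx. apply pole_ratio_le; auto.
  - apply HolOn_div_const; auto using HolOn_opp.
  - intros x Hx. apply pole_ratio_le; auto.
  - apply HolOn_div_const; auto.
Qed.

(** * Uniform approximation by holomorphic functions *)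

Definition approximable (b a1 a2 : R) (f : C -> C) : Prop :=
  forall eps, 0 < eps -> exists g, HolOn (strip b) g /\
    forall z, box b a1 a2 z -> Cmod (f z - g z)%C <= eps.

Definition bounded_on (b a1 a2 : R) (f : C -> C) : Prop :=
  exists B, 0 <= B /\ forall z, box b a1 a2 z -> Cmod (f z) <= B.

Lemma approximable_Hol_limit (b a1 a2 : R) (f : C -> C) : approximable b a1 a2 f -> Hol_limit f b a1 a2.
Proof.
  intros H eps He. destruct (H eps He) as (g & [g' Hg] & Hfg).
  exists g, g'. split; auto. intros u s Hu Hs. apply Hg. split; simpl; lra.
Qed.

Lemma HolOn_approximable (b a1 a2 : R) (f : C -> C) : HolOn (strip b) f -> approximable b a1 a2 f.
Proof.
  intros H eps He. exists f. split; auto. intros z _.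
  replace (f z - f z)%C with (RtoC 0) by ring. rewrite Cmod_0. lra.
Qed.

Lemma approximable_plus (b a1 a2 : R) (f g : C -> C) :
  approximable b a1 a2 f -> approximable b a1 a2 g -> approximable b a1 a2 (fun z => f z + g z)%C.
Proof.
  intros Hf Hg eps He.
  destruct (Hf (eps / 2) ltac:(lra)) as (f1 & Hf1 & Hf2).
  destruct (Hg (eps / 2) ltac:(lra)) as (g1 & Hg1 & Hg2).
  exists (fun z => f1 z + g1 z)%C. split; [apply HolOn_plus; auto|]. intros z Hz.
  replace (_ - _)%C with ((f z - f1 z) + (g z - g1 z))%C by ring.
  eapply Rle_trans; [apply Cmod_triangle|]. specialize (Hf2 z Hz). specialize (Hg2 z Hz). lra.
Qed.

Lemma approximable_mult (b a1 a2 : R) (f g : C -> C) :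
  approximable b a1 a2 f -> approximable b a1 a2 g -> bounded_on b a1 a2 f -> bounded_on b a1 a2 g ->
  approximable b a1 a2 (fun z => f z * g z)%C.
Proof.
  intros Hf Hg (A & HA & Bf) (B & HB & Bg) eps He.
  set (e := Rmin 1 (eps / (A + B + 1))).
  assert (He0 : 0 < eps / (A + B + 1)) by (apply Rdiv_lt_0_compat; lra).
  assert (Hep : 0 < e) by (apply Rmin_pos; lra).
  assert (He1 : e <= 1) by apply Rmin_l. assert (He2 : e <= eps / (A + B + 1)) by apply Rmin_r.
  assert (He3 : e * (A + B + 1) <= eps).
  { apply Rmult_le_compat_r with (r := A + B + 1) in He2; [|lra].
    replace (eps / (A + B + 1) * (A + B + 1)) with eps in He2 by (field; lra). exact He2. }
  destruct (Hf e Hep) as (f1 & Hf1 & Hf2). destruct (Hg e Hep) as (g1 & Hg1 & Hg2).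
  exists (fun z => f1 z * g1 z)%C. split; [apply HolOn_mult; auto|]. intros z Hz.
  specialize (Hf2 z Hz). specialize (Hg2 z Hz). specialize (Bf z Hz). specialize (Bg z Hz).
  replace (_ - _)%C with ((f z - f1 z) * g z + f z * (g z - g1 z) - (f z - f1 z) * (g z - g1 z))%C by ring.
  eapply Rle_trans; [apply Cmod_minus_le|].
  eapply Rle_trans; [apply Rplus_le_compat_r, Cmod_triangle|]. rewrite !Cmod_mult.
  assert (C1 := Rmult_le_compat _ _ _ _ (Cmod_ge_0 _) (Cmod_ge_0 _) Hf2 Bg).
  assert (C2 := Rmult_le_compat _ _ _ _ (Cmod_ge_0 _) (Cmod_ge_0 _) Bf Hg2).
  assert (C3 := Rmult_le_compat _ _ _ _ (Cmod_ge_0 _) (Cmod_ge_0 _) Hf2 Hg2).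
  nra.
Qed.

Lemma bounded_on_mult (b a1 a2 : R) (f g : C -> C) :
  bounded_on b a1 a2 f -> bounded_on b a1 a2 g -> bounded_on b a1 a2 (fun z => f z * g z)%C.
Proof.
  intros (A & HA & Bf) (B & HB & Bg). exists (A * B). split; [nra|]. intros z Hz.
  rewrite Cmod_mult. apply Rmult_le_compat; auto using Cmod_ge_0.
Qed.

Lemma bounded_on_Cexp (b a1 a2 : R) (f : C -> C) :
  bounded_on b a1 a2 f -> bounded_on b a1 a2 (fun z => Cexp (f z)).
Proof.
  intros (A & HA & Bf). exists (exp A). split; [apply Rlt_le, exp_pos|]. intros z Hz.
  eapply Rle_trans; [apply Cmod_Cexp_le|]. apply exp_le. auto.
Qed.

Lemma approximable_Cexp (b a1 a2 : R) (f : C -> C) :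
  approximable b a1 a2 f -> bounded_on b a1 a2 f -> approximable b a1 a2 (fun z => Cexp (f z)).
Proof.
  intros Hf (A & HA & Bf) eps He.
  pose proof (exp_pos A) as PA. pose proof (exp_pos 1) as P1.
  set (c := exp A * (2 * exp 1)). assert (Hc : 0 < c) by (unfold c; nra).
  set (e := Rmin 1 (eps / c)).
  assert (He0 : 0 < eps / c) by (apply Rdiv_lt_0_compat; lra).
  assert (Hep : 0 < e) by (apply Rmin_pos; lra).
  assert (He1 : e <= 1) by apply Rmin_l. assert (He2 : e <= eps / c) by apply Rmin_r.
  assert (He3 : c * e <= eps).
  { apply Rmult_le_compat_l with (r := c) in He2; [|lra].
    replace (c * (eps / c)) with eps in He2 by (field; lra). exact He2. }
  destruct (Hf e Hep) as (f1 & Hf1 & Hf2).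
  exists (fun z => Cexp (f1 z)). split; [apply HolOn_Cexp; auto|]. intros z Hz.
  specialize (Hf2 z Hz). specialize (Bf z Hz).
  rewrite Cmod_minus_sym in Hf2.
  replace (Cexp (f z) - Cexp (f1 z))%C with (- (Cexp (f z) * (Cexp (f1 z - f z) - 1)))%C.
  2:{ assert (E : Cexp (f1 z) = (Cexp (f z) * Cexp (f1 z - f z))%C)
        by (rewrite <- Cexp_plus; f_equal; ring). rewrite E. ring. }
  rewrite Cmod_opp, Cmod_mult.
  eapply Rle_trans; [|exact He3]. unfold c. rewrite Rmult_assoc.
  apply Rmult_le_compat; auto using Cmod_ge_0.
  - eapply Rle_trans; [apply Cmod_Cexp_le|]. apply exp_le. auto.
  - eapply Rle_trans; [apply Cexp_minus_1_le|].
    replace (2 * exp 1 * e) with (2 * (e * exp 1)) by ring.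
    apply Rmult_le_compat_l; [lra|].
    apply Rmult_le_compat; auto using Cmod_ge_0; [apply Rlt_le, exp_pos|].
    apply exp_le. lra.
Qed.

(** * Bounds of the individual factors on the strip *)

(** On the strip |x| <= b + 3, from width b + 1 and height 2. The quadratic condition with t >= 16
    gives b + 3 <= t/4, which keeps the singular point x = -t - i/2 away, and (b + 3)^3 <= t^2,
    which keeps the Taylor remainder bounded. *)
Definition regime (b t : R) : Prop := 16 <= t /\ 0 <= b /\ (b + 3) ^ 2 <= t.

Definition zeta_arg (t : R) (x : C) : C := (RtoC (1 / 2) + Ci * (RtoC t + x))%C.

Definition quad_phase (t : R) (x : C) : C :=
  (Ci * (x * RtoC (theta1 t) + x * x * RtoC (1 / 2) * RtoC (theta2 t)))%C.

Definition V_integrand (t : R) (x : C) : C := (Cexp (quad_phase t x) * zeta_shift t x * kernel x)%C.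

Definition U_integrand (t : R) (x : C) : C :=
  (Cexp (Ci * (RStheta (RtoC t + x) - RStheta (RtoC t))) * zeta_shift t x * kernel x)%C.

Lemma regime_le (b t : R) : regime b t -> b + 3 <= t / 4.
Proof.
  intros (H1 & H2 & H3). destruct (Rle_dec (b + 3) (t / 4)); auto. exfalso. nra.
Qed.

Lemma strip_Cmod (b : R) (x : C) : strip b x -> Cmod x <= Rabs (Re x) + 2 /\ Cmod x <= b + 3.
Proof.
  intros [H1 H2].
  assert (Cmod x <= Rabs (Re x) + 2).
  { apply Cmod_le_parts; [lra|]. apply Rabs_le_between. lra. }
  lra.
Qed.

Lemma strip_pole (b t : R) (x : C) : regime b t -> strip b x -> forall k, Cmod x <= Cmod (pole t k).
Proof.
  intros Hr Hx k. pose proof (regime_le _ _ Hr). destruct (strip_Cmod _ _ Hx).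
  pose proof (Cmod_pole_ge_im t k). destruct Hr. lra.
Qed.

Lemma box_strip (b a1 a2 : R) (x : C) : 0 < a1 -> a2 < 2 -> box b a1 a2 x -> strip b x.
Proof. intros H1 H2 [H3 H4]. split; auto. lra. Qed.

Lemma Re_zeta_arg (t : R) (x : C) : Re (zeta_arg t x) = / 2 - Im x.
Proof. unfold zeta_arg, Re, Im; simpl. field. Qed.

Lemma Im_zeta_arg (t : R) (x : C) : Im (zeta_arg t x) = t + Re x.
Proof. unfold zeta_arg, Re, Im; simpl. ring. Qed.

(** The pole of zeta is avoided through the imaginary part: t + Re x is at least 3t/4, hence above
    1. *)
Lemma strip_zeta_arg (b t : R) (x : C) : regime b t -> strip b x ->
  / 2 <= Re (zeta_arg t x) /\ zeta_arg t x <> 1 /\ 1 <= Cmod (zeta_arg t x - 1)%C /\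
  Cmod (zeta_arg t x) <= 3 + 2 * t.
Proof.
  intros Hr [H1 H2]. pose proof (regime_le _ _ Hr). destruct Hr as (Ht & _).
  apply Rabs_lt_between in H1.
  assert (HR := Re_zeta_arg t x). assert (HI := Im_zeta_arg t x).
  split; [lra|].
  assert (HM : 1 <= Cmod (zeta_arg t x - 1)%C).
  { eapply Rle_trans; [|apply im_le_Cmod].
    change (Im (zeta_arg t x - 1)%C) with (Im (zeta_arg t x) - 0). rewrite HI.
    eapply Rle_trans; [|apply Rle_abs]. lra. }
  split; [|split; auto].
  - intros E. rewrite E in HM. replace (1 - 1)%C with (RtoC 0) in HM by ring. rewrite Cmod_0 in HM. lra.
  - apply Cmod_le_parts; apply Rabs_le_between; lra.
Qed.

Lemma strip_zeta_le (b t : R) (x : C) : regime b t -> strip b x -> Cmod (zeta_shift t x) <= 60 * t.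
Proof.
  intros Hr Hx. destruct (strip_zeta_arg b t x Hr Hx) as (H1 & H2 & H3 & H4).
  assert (H := zeta_le _ H1 H2). change (zeta_shift t x) with (zeta (zeta_arg t x)).
  assert (/ Cmod (zeta_arg t x - 1)%C <= 1) by (apply Rle_trans with (/ 1); [apply Rinv_le_contravar; lra | lra]).
  destruct Hr. lra.
Qed.

Lemma HolOn_zeta_arg (D : C -> Prop) (t : R) : HolOn D (zeta_arg t).
Proof.
  unfold zeta_arg. apply HolOn_plus; [apply HolOn_const|].
  apply HolOn_mult; [apply HolOn_const|]. apply HolOn_plus; [apply HolOn_const | apply HolOn_id].
Qed.

Definition zeta_part (t : R) (N : nat) (x : C) : C :=
  (/ (zeta_arg t x - 1) + csum (zeta_term (zeta_arg t x)) N)%C.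

Lemma HolOn_zeta_part (D : C -> Prop) (t : R) (N : nat) : (forall x, D x -> zeta_arg t x <> 1) ->
  HolOn D (zeta_part t N).
Proof.
  intros H. unfold zeta_part. apply HolOn_plus.
  - apply HolOn_inv.
    + intros z Hz E. apply (H z Hz). replace (zeta_arg t z) with ((zeta_arg t z - 1) + 1)%C by ring.
      rewrite E. ring.
    + apply HolOn_minus; [apply HolOn_zeta_arg | apply HolOn_const].
  - apply (HolOn_csum D (fun x => zeta_term (zeta_arg t x))). intros n.
    apply HolOn_zeta_term; auto using HolOn_zeta_arg.
Qed.

Lemma zeta_part_uniform (t B eps : R) : 0 <= B -> 0 < eps -> exists N, forall x,
  / 2 <= Re (zeta_arg t x) -> zeta_arg t x <> 1 -> Cmod (zeta_arg t x) <= B ->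
  Cmod (zeta_shift t x - zeta_part t N x)%C <= eps.
Proof.
  intros HB He.
  destruct (Series_tail_small (fun k => Rpower (INR (S k)) (- (1 + / 2))) (eps / (8 * B + 1))) as [N HN].
  { apply p_series; lra. }
  { apply Rdiv_lt_0_compat; lra. }
  exists N. intros x H1 H2 H3.
  change (zeta_shift t x) with (zeta (zeta_arg t x)).
  eapply Rle_trans; [apply zeta_tail_le; auto|].
  apply Rle_trans with (8 * B * (eps / (8 * B + 1))).
  - apply Rmult_le_compat; auto; try lra.
    + pose proof (Cmod_ge_0 (zeta_arg t x)). lra.
    + apply Series_nonneg; [intros; apply Rlt_le, exp_pos|].
      apply (proj1 (ex_series_incr_n (K := R_AbsRing) (V := R_NormedModule) (fun k => Rpower (INR (S k)) (- (1 + / 2))) N)).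
      apply p_series; lra.
  - apply Rmult_le_reg_r with (8 * B + 1); [lra|].
    replace (8 * B * (eps / (8 * B + 1)) * (8 * B + 1)) with (8 * B * eps) by (field; lra). nra.
Qed.

Lemma approximable_zeta (b t a1 a2 : R) : regime b t -> 0 < a1 -> a2 < 2 ->
  approximable b a1 a2 (zeta_shift t).
Proof.
  intros Hr H1 H2 eps He.
  destruct (zeta_part_uniform t (3 + 2 * t) eps) as [N HN]; auto.
  { destruct Hr; lra. }
  exists (zeta_part t N). split.
  - apply HolOn_zeta_part. intros x Hx. apply (strip_zeta_arg b t x Hr Hx).
  - intros x Hx. apply box_strip in Hx; auto.
    destruct (strip_zeta_arg b t x Hr Hx) as (A1 & A2 & A3 & A4). apply HN; auto.
Qed.

Lemma approximable_theta_rem_sum (b t a1 a2 : R) : regime b t -> 0 < a1 -> a2 < 2 ->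
  approximable b a1 a2 (theta_rem_sum t).
Proof.
  intros Hr H1 H2 eps He. set (X := (b + 3) ^ 3).
  assert (HX : 0 <= X) by (apply pow_le; destruct Hr as (_ & ? & _); lra).
  assert (Hex : ex_series (fun n => X * / INR (S n) ^ 2)).
  { apply (ex_series_scal_l (K := R_AbsRing) (V := R_NormedModule)), ex_series_inv_sqr. }
  destruct (Series_tail_small _ (eps / 2) Hex ltac:(lra)) as [N HN].
  exists (fun x => theta_rem t 0 x + csum (fun n => theta_rem t (S n) x) N)%C. split.
  - apply HolOn_plus.
    + apply HolOn_theta_rem. intros x Hx. apply (strip_pole b); auto.
    + apply (HolOn_csum _ (fun x n => theta_rem t (S n) x)). intros n.
      apply HolOn_theta_rem. intros x Hx. apply (strip_pole b); auto.
  - intros x Hx. apply box_strip in Hx; auto.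
    unfold theta_rem_sum.
    replace (_ - _)%C with (Cseries (fun n => theta_rem t (S n) x) - csum (fun n => theta_rem t (S n) x) N)%C by ring.
    eapply Rle_trans; [apply (Cseries_tail _ (fun n => X * / INR (S n) ^ 2)); auto|lra].
    intros n. eapply Rle_trans; [apply theta_rem_le, (strip_pole b); auto|].
    apply Rmult_le_compat.
    + apply pow_le, Cmod_ge_0.
    + apply pow_le, Rlt_le, Rinv_0_lt_compat, Cmod_gt_0, pole_neq_0.
    + apply pow_incr. split; [apply Cmod_ge_0 | apply (strip_Cmod b x Hx)].
    + apply inv_pole_cube_le.
Qed.

(** The first bound carries the power t^(-2) of the final error; the second bounds e^E by e^20, so
    that e^E - 1 is linear in E. *)
Lemma theta_rem_sum_small (b t : R) (x : C) : regime b t -> strip b x ->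
  Cmod (theta_rem_sum t x) <= 20 * (Cmod x ^ 3 / t ^ 2) /\ Cmod (theta_rem_sum t x) <= 20.
Proof.
  intros Hr Hx. assert (Ht : 16 <= t) by apply Hr.
  destruct (theta_rem_sum_le t x (strip_pole b t x Hr Hx)) as [_ H].
  assert (H1 := Series_inv_pole_cube_le t ltac:(lra)).
  assert (H0 : 0 <= Cmod x ^ 3) by apply pow_le, Cmod_ge_0.
  apply Rmult_le_compat_l with (r := Cmod x ^ 3) in H1; auto.
  assert (H2 : Cmod (theta_rem_sum t x) <= 20 * (Cmod x ^ 3 / t ^ 2)).
  { replace (20 * (Cmod x ^ 3 / t ^ 2)) with (Cmod x ^ 3 * (20 / t ^ 2)) by (field; lra). lra. }
  split; auto. eapply Rle_trans; [exact H2|].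
  assert (H3 : Cmod x ^ 3 <= t ^ 2).
  { apply Rle_trans with ((b + 3) ^ 3).
    - apply pow_incr. split; [apply Cmod_ge_0 | apply (strip_Cmod b x Hx)].
    - pose proof (regime_le _ _ Hr). destruct Hr as (_ & Hb & Hb2).
      replace ((b + 3) ^ 3) with ((b + 3) ^ 2 * (b + 3)) by ring.
      replace (t ^ 2) with (t * t) by ring.
      apply Rmult_le_compat; try lra. apply pow2_ge_0. }
  assert (Cmod x ^ 3 / t ^ 2 <= 1).
  { apply Rmult_le_reg_r with (t ^ 2); [nra|].
    replace (Cmod x ^ 3 / t ^ 2 * t ^ 2) with (Cmod x ^ 3) by (field; lra). lra. }
  lra.
Qed.

Lemma HolOn_quad_phase (D : C -> Prop) (t : R) : HolOn D (quad_phase t).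
Proof.
  unfold quad_phase. apply HolOn_mult; [apply HolOn_const|].
  apply HolOn_plus; repeat apply HolOn_mult; auto using HolOn_const, HolOn_id.
Qed.

Lemma Re_quad_phase (t u s : R) :
  Re (quad_phase t (u, (- s)%R)) = s * theta1 t + u * s * theta2 t.
Proof. unfold quad_phase, Re; simpl. field. Qed.

(** The summand 2 [theta1_const] covers heights up to 2, and the summand 2 covers the quadratic term
    u s theta'', which is at most 3/2 when |u| <= t/4. *)
Definition phase_const : R := exp (2 * theta1_const + 2).

Lemma Cmod_quad_phase_le (b t u s : R) : regime b t -> strip b (u, (- s)%R) ->
  Cmod (Cexp (quad_phase t (u, (- s)%R))) <= phase_const * Rpower t (s / 2).
Proof.
  intros Hr [H1 H2]. simpl in H1, H2. pose proof (regime_le _ _ Hr) as H3. destruct Hr as (Ht & Hb & _).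
  rewrite Cmod_Cexp, Re_quad_phase. unfold phase_const, Rpower. rewrite <- exp_plus. apply exp_le.
  assert (A1 := theta1_le t ltac:(lra)). assert (A2 := theta2_le t ltac:(lra)).
  assert (A3 : 0 <= theta1_const) by apply Rabs_pos.
  assert (A4 : s * theta1 t <= s * (/ 2 * ln t + theta1_const)) by (apply Rmult_le_compat_l; lra).
  assert (A5 : s * theta1_const <= 2 * theta1_const) by (apply Rmult_le_compat_r; lra).
  assert (A6 : u * s * theta2 t <= 2).
  { eapply Rle_trans; [apply Rle_abs|]. rewrite !Rabs_mult, (Rabs_right s) by lra.
    apply Rle_trans with (t / 4 * 2 * (3 / t)).
    - apply Rmult_le_compat; auto using Rabs_pos.
      + apply Rmult_le_pos; [apply Rabs_pos|lra].
      + apply Rmult_le_compat; auto using Rabs_pos; lra.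
    - replace (t / 4 * 2 * (3 / t)) with (3 / 2) by (field; lra). lra. }
  lra.
Qed.

Lemma U_integrand_strip (b t : R) (x : C) : regime b t -> strip b x ->
  U_integrand t x = (Cexp (quad_phase t x + theta_rem_sum t x) * zeta_shift t x * kernel x)%C.
Proof.
  intros Hr Hx. unfold U_integrand. rewrite theta_taylor by (apply (strip_pole b); auto). reflexivity.
Qed.

Lemma bounded_on_kernel (b a1 a2 : R) : 0 < a1 -> a2 < 2 -> bounded_on b a1 a2 kernel.
Proof.
  intros H1 H2. destruct (sin_half_ge a1 a2 H1 H2) as (m & Hm & HM).
  pose proof PI_RGT_0.
  exists (PI / m). split; [apply Rlt_le, Rdiv_lt_0_compat; auto|].
  intros [u s] [Hu Hs]. simpl in Hu, Hs.
  replace s with (- - s) by ring. eapply Rle_trans; [apply kernel_le; lra|].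
  rewrite <- (Rmult_1_r (PI / m)). specialize (HM (- s) Hs).
  apply Rmult_le_compat.
  - apply Rlt_le, Rdiv_lt_0_compat; lra.
  - apply Rlt_le, exp_pos.
  - apply Rmult_le_compat_l; [lra|]. apply Rinv_le_contravar; auto.
  - rewrite <- exp_0. apply exp_le. pose proof (Rabs_pos u). lra.
Qed.

Lemma bounded_on_zeta (b t a1 a2 : R) : regime b t -> 0 < a1 -> a2 < 2 ->
  bounded_on b a1 a2 (zeta_shift t).
Proof.
  intros Hr H1 H2. exists (60 * t). split; [destruct Hr; lra|].
  intros x Hx. apply (strip_zeta_le b); auto. apply box_strip with a1 a2; auto.
Qed.

Lemma bounded_on_quad_phase (b t a1 a2 : R) : 0 <= b -> 0 < a1 -> a2 < 2 ->
  bounded_on b a1 a2 (quad_phase t).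
Proof.
  intros Hb H1 H2.
  exists ((b + 3) * Rabs (theta1 t) + (b + 3) * (b + 3) * / 2 * Rabs (theta2 t)).
  pose proof (Rabs_pos (theta1 t)). pose proof (Rabs_pos (theta2 t)).
  assert (0 <= (b + 3) * (b + 3)) by nra.
  split; [nra|].
  intros x Hx. apply box_strip in Hx; auto. destruct (strip_Cmod b x Hx) as [_ Hc].
  pose proof (Cmod_ge_0 x).
  unfold quad_phase. rewrite Cmod_mult, Cmod_Ci, Rmult_1_l.
  eapply Rle_trans; [apply Cmod_triangle|]. rewrite !Cmod_mult, !Cmod_R, (Rabs_right (1 / 2)) by lra.
  apply Rplus_le_compat.
  - apply Rmult_le_compat_r; lra.
  - replace (1 / 2) with (/ 2) by field. apply Rmult_le_compat_r; [lra|]. nra.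
Qed.

Lemma V_integrand_limit (b t a1 a2 : R) : regime b t -> 0 < a1 -> a2 < 2 ->
  Hol_limit (V_integrand t) b a1 a2.
Proof.
  intros Hr H1 H2. assert (Hb : 0 <= b) by apply Hr. apply approximable_Hol_limit. unfold V_integrand.
  assert (A1 : approximable b a1 a2 (fun x => Cexp (quad_phase t x)))
    by (apply HolOn_approximable, HolOn_Cexp, HolOn_quad_phase).
  assert (A2 : bounded_on b a1 a2 (fun x => Cexp (quad_phase t x)))
    by (apply bounded_on_Cexp, bounded_on_quad_phase; auto).
  assert (A3 := approximable_zeta b t a1 a2 Hr H1 H2).
  assert (A4 := bounded_on_zeta b t a1 a2 Hr H1 H2).
  apply approximable_mult; auto using bounded_on_kernel, bounded_on_mult, HolOn_approximable, HolOn_kernel.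
  apply approximable_mult; auto.
Qed.

Lemma U_integrand_limit (b t a1 a2 : R) : regime b t -> 0 < a1 -> a2 < 2 ->
  Hol_limit (U_integrand t) b a1 a2.
Proof.
  intros Hr H1 H2. assert (Hb : 0 <= b) by apply Hr.
  assert (B0 : bounded_on b a1 a2 (fun x => quad_phase t x + theta_rem_sum t x)%C).
  { destruct (bounded_on_quad_phase b t a1 a2 Hb H1 H2) as (B & HB & HP).
    exists (B + 20). split; [lra|]. intros x Hx. eapply Rle_trans; [apply Cmod_triangle|].
    specialize (HP x Hx). apply box_strip in Hx; auto.
    destruct (theta_rem_sum_small b t x Hr Hx). lra. }
  assert (A0 : approximable b a1 a2 (fun x => quad_phase t x + theta_rem_sum t x)%C).
  { apply approximable_plus; auto using approximable_theta_rem_sum.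
    apply HolOn_approximable, HolOn_quad_phase. }
  assert (A1 := approximable_Cexp _ _ _ _ A0 B0). assert (A2 := bounded_on_Cexp _ _ _ _ B0).
  assert (A3 := approximable_zeta b t a1 a2 Hr H1 H2).
  assert (A4 := bounded_on_zeta b t a1 a2 Hr H1 H2).
  assert (A5 : approximable b a1 a2
    (fun x => Cexp (quad_phase t x + theta_rem_sum t x) * zeta_shift t x * kernel x)%C).
  { apply approximable_mult; auto using bounded_on_kernel, bounded_on_mult, HolOn_approximable, HolOn_kernel.
    apply approximable_mult; auto. }
  intros eps He. destruct (approximable_Hol_limit _ _ _ _ A5 eps He) as (g & g' & Hg & Hfg).
  exists g, g'. split; auto. intros x Hx. rewrite (U_integrand_strip b); auto.
  apply box_strip with a1 a2; auto.
Qed.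

(** * Size of the integrands and of their difference *)

Lemma Rpower_half_le (t s : R) : 1 <= t -> s <= 2 -> Rpower t (s / 2) <= t.
Proof.
  intros Ht Hs. rewrite <- (Rpower_1 t) at 2 by lra. apply Rle_Rpower; lra.
Qed.

Definition kernel_const (m : R) : R := PI / m.

Lemma kernel_le_const (m u s : R) : 0 < m -> 0 < s < 2 -> m <= sin (PI / 2 * s) ->
  Cmod (kernel (u, (- s)%R)) <= kernel_const m * exp (- (3 / 2 * Rabs u)).
Proof.
  intros Hm Hs HM. pose proof PI_RGT_0. eapply Rle_trans; [apply kernel_le; auto|].
  apply Rmult_le_compat_r; [apply Rlt_le, exp_pos|].
  apply Rmult_le_compat_l; [lra|]. apply Rinv_le_contravar; auto.
Qed.

Lemma kernel_const_pos (m : R) : 0 < m -> 0 < kernel_const m.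
Proof. intros Hm. pose proof PI_RGT_0. apply Rdiv_lt_0_compat; auto. Qed.

Lemma phase_const_pos : 0 < phase_const.
Proof. apply exp_pos. Qed.

Lemma Cmod_mult3_le (a b c : C) (A B D : R) : Cmod a <= A -> Cmod b <= B -> Cmod c <= D ->
  Cmod (a * b * c)%C <= A * B * D.
Proof.
  intros H1 H2 H3. rewrite !Cmod_mult.
  apply Rmult_le_compat; auto using Cmod_ge_0.
  - apply Rmult_le_pos; apply Cmod_ge_0.
  - apply Rmult_le_compat; auto using Cmod_ge_0.
Qed.

(** Deliberately crude: one factor t from the phase at any height below 2, another from zeta. It is
    applied at |u| = b, where the exponential absorbs t^2. *)
Lemma integrands_le (b t m u s : R) : regime b t -> strip b (u, (- s)%R) -> 0 < m ->
  m <= sin (PI / 2 * s) ->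
  Cmod (V_integrand t (u, (- s)%R)) <= phase_const * exp 20 * 60 * kernel_const m * t ^ 2 * exp (- Rabs u) /\
  Cmod (U_integrand t (u, (- s)%R)) <= phase_const * exp 20 * 60 * kernel_const m * t ^ 2 * exp (- Rabs u).
Proof.
  intros Hr Hx Hm HM. assert (Hs : 0 < s < 2) by (destruct Hx as [_ Hx]; simpl in Hx; lra).
  assert (Ht : 16 <= t) by apply Hr.
  assert (H1 := Cmod_quad_phase_le b t u s Hr Hx).
  assert (H2 := strip_zeta_le b t _ Hr Hx).
  assert (H3 := kernel_le_const m u s Hm Hs HM).
  assert (H4 := Rpower_half_le t s ltac:(lra) ltac:(lra)).
  assert (PP := phase_const_pos). assert (KP := kernel_const_pos m Hm).
  assert (E1 : 1 <= exp 20) by (rewrite <- exp_0; apply exp_le; lra).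
  assert (H5 : phase_const * Rpower t (s / 2) <= phase_const * t) by (apply Rmult_le_compat_l; lra).
  assert (H6 : phase_const * t <= phase_const * t * exp 20).
  { rewrite <- (Rmult_1_r (phase_const * t)) at 1. apply Rmult_le_compat_l; [|lra]. apply Rmult_le_pos; lra. }
  assert (H7 : kernel_const m * exp (- (3 / 2 * Rabs u)) <= kernel_const m * exp (- Rabs u)).
  { apply Rmult_le_compat_l; [lra|]. apply exp_le. pose proof (Rabs_pos u). lra. }
  replace (phase_const * exp 20 * 60 * kernel_const m * t ^ 2 * exp (- Rabs u))
    with (phase_const * t * exp 20 * (60 * t) * (kernel_const m * exp (- Rabs u))) by ring.
  split.
  - apply Cmod_mult3_le; lra.
  - rewrite (U_integrand_strip b) by auto. apply Cmod_mult3_le; try lra.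
    rewrite Cexp_plus, Cmod_mult. apply Rmult_le_compat; auto using Cmod_ge_0; [lra|].
    eapply Rle_trans; [apply Cmod_Cexp_le|]. apply exp_le.
    apply (theta_rem_sum_small b t _ Hr Hx).
Qed.

(** Spends the spare decay e^(-v/2) as three factors e^(-v/6), one for each v + 2 <= 12 e^(v/6);
    1728 is 12^3. The cube comes from |x|^3 in the Taylor remainder. *)
Lemma cube_exp_le (v : R) : 0 <= v -> (v + 2) ^ 3 * exp (- (3 / 2 * v)) <= 1728 * exp (- v).
Proof.
  intros Hv. assert (H : v + 2 <= 12 * exp (v / 6)).
  { assert (1 + v / 6 <= exp (v / 6)).
    { destruct (Req_dec (v / 6) 0) as [E|E]; [rewrite E, exp_0; lra | left; apply exp_ineq1; auto]. }
    lra. }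
  apply Rle_trans with ((12 * exp (v / 6)) ^ 3 * exp (- (3 / 2 * v))).
  - apply Rmult_le_compat_r; [apply Rlt_le, exp_pos|]. apply pow_incr. lra.
  - right. replace ((12 * exp (v / 6)) ^ 3) with (1728 * (exp (v / 6) * exp (v / 6) * exp (v / 6))) by ring.
    rewrite Rmult_assoc. f_equal. rewrite <- !exp_plus. f_equal. field.
Qed.

(** At height 1/2 + d the common factor e^P is O(t^(1/4 + d/2)), zeta is at most 1 + 2/d, and e^E -
    1 supplies |x|^3 t^(-2), whose cube the kernel absorbs. *)
Lemma integrand_diff_le (d b t m u : R) : 0 < d < 1 -> regime b t -> Rabs u < b + 1 -> 0 < m ->
  m <= sin (PI / 2 * (/ 2 + d)) ->
  Cmod (U_integrand t (u, (- (/ 2 + d))%R) - V_integrand t (u, (- (/ 2 + d))%R))%C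
  <= phase_const * (2 * (20 * 1728) * exp 20) * (1 + 2 * / d) * kernel_const m
     * Rpower t (- 7 / 4 + d / 2) * exp (- Rabs u).
Proof.
  intros Hd Hr Hu Hm HM. set (s := / 2 + d) in *. assert (Hs : 0 < s < 2) by (unfold s; lra).
  assert (Ht : 16 <= t) by apply Hr.
  assert (Hx : strip b (u, (- s)%R)) by (split; simpl; lra).
  rewrite (U_integrand_strip b) by auto. unfold V_integrand.
  set (x := (u, (- s)%R) : C) in *.
  replace (_ - _)%C with (Cexp (quad_phase t x) * ((Cexp (theta_rem_sum t x) - 1) * zeta_shift t x) * kernel x)%C
    by (rewrite Cexp_plus; ring).
  destruct (theta_rem_sum_small b t x Hr Hx) as [E1 E2].
  assert (E3 := Cexp_minus_1_le (theta_rem_sum t x)).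
  assert (PP := phase_const_pos). assert (KP := kernel_const_pos m Hm).
  pose proof (Rabs_pos u) as Hu0. pose proof (exp_pos 20) as P20.
  assert (E4 : Cmod x ^ 3 <= (Rabs u + 2) ^ 3).
  { apply pow_incr. split; [apply Cmod_ge_0|]. apply (strip_Cmod b x Hx). }
  assert (Ht2 : 0 < / t ^ 2) by (apply Rinv_0_lt_compat; nra).
  assert (E5 : Cmod (Cexp (theta_rem_sum t x) - 1)%C <= 2 * (20 * ((Rabs u + 2) ^ 3 * / t ^ 2) * exp 20)).
  { eapply Rle_trans; [exact E3|]. apply Rmult_le_compat_l; [lra|].
    apply Rmult_le_compat; auto using Cmod_ge_0, exp_le; [apply Rlt_le, exp_pos|].
    eapply Rle_trans; [exact E1|]. apply Rmult_le_compat_l; [lra|].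
    apply Rmult_le_compat_r; lra. }
  assert (E6 : Cmod (zeta_shift t x) <= 1 + 2 * / d).
  { change (zeta_shift t x) with (zeta (zeta_arg t x)). apply zeta_bounded; [lra|].
    rewrite Re_zeta_arg. unfold x, s; simpl. field. }
  assert (E7 := kernel_le_const m u s Hm Hs HM). fold x in E7.
  assert (E8 := Cmod_quad_phase_le b t u s Hr Hx). fold x in E8.
  assert (Hid : 0 < / d) by (apply Rinv_0_lt_compat; lra).
  eapply Rle_trans.
  { apply Cmod_mult3_le; [exact E8 | | exact E7]. rewrite Cmod_mult.
    apply Rmult_le_compat; auto using Cmod_ge_0; [exact E5 | exact E6]. }
  assert (EP : Rpower t (- 7 / 4 + d / 2) = Rpower t (s / 2) * / t ^ 2).
  { rewrite <- (Rpower_pow 2 t), <- Rpower_Ropp, <- Rpower_plus by lra. f_equal. unfold s. simpl. field. }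
  rewrite EP. assert (HR : 0 < Rpower t (s / 2)) by apply exp_pos.
  assert (E9 := cube_exp_le (Rabs u) Hu0).
  set (c := phase_const * 2 * 20 * exp 20 * (1 + 2 * / d) * kernel_const m * (Rpower t (s / 2) * / t ^ 2)).
  assert (Hc : 0 <= c).
  { unfold c. apply Rmult_le_pos; [|apply Rmult_le_pos; lra].
    repeat (apply Rmult_le_pos; [|lra]). lra. }
  apply Rle_trans with (c * ((Rabs u + 2) ^ 3 * exp (- (3 / 2 * Rabs u)))); [unfold c; right; ring|].
  apply Rle_trans with (c * (1728 * exp (- Rabs u))); [apply Rmult_le_compat_l; auto|].
  unfold c. right. ring.
Qed.

(** * The line of integration of U *)

Lemma Ccont_lipschitz (f : R -> C) (u r K : R) : 0 < r ->
  (forall v, Rabs (v - u) <= r -> Cmod (f v - f u)%C <= K * Rabs (v - u)) -> Ccont f u.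
Proof.
  intros Hr H eps He. set (K' := Rabs K + 1). assert (HK : 0 < K') by (unfold K'; pose proof (Rabs_pos K); lra).
  exists (Rmin r (eps / K')). split; [apply Rmin_pos; auto; apply Rdiv_lt_0_compat; auto|].
  intros v Hv.
  assert (H1 := Rlt_le_trans _ _ _ Hv (Rmin_l _ _)).
  assert (H2 := Rlt_le_trans _ _ _ Hv (Rmin_r _ _)).
  eapply Rle_trans; [apply H; lra|].
  apply Rlt_le in H2. apply Rmult_le_compat_l with (r := K') in H2; [|lra].
  replace (K' * (eps / K')) with eps in H2 by (field; lra).
  eapply Rle_trans; [|exact H2]. apply Rmult_le_compat_r; [apply Rabs_pos|].
  unfold K'. pose proof (Rle_abs K). lra.
Qed.

Lemma Ccont_affine (f : R -> C) (a c u : R) : Ccont f (a + c * u) -> Ccont (fun u => f (a + c * u)) u.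
Proof.
  intros H eps He. destruct (H eps He) as (d & Hd & HH).
  set (c' := Rabs c + 1). assert (Hc : 0 < c') by (unfold c'; pose proof (Rabs_pos c); lra).
  exists (d / c'). split; [apply Rdiv_lt_0_compat; auto|]. intros v Hv. apply HH.
  replace (a + c * v - (a + c * u)) with (c * (v - u)) by ring. rewrite Rabs_mult.
  apply Rmult_lt_compat_l with (r := c') in Hv; auto.
  replace (c' * (d / c')) with d in Hv by (field; lra).
  eapply Rle_lt_trans; [|exact Hv]. apply Rmult_le_compat_r; [apply Rabs_pos|]. unfold c'. lra.
Qed.

Lemma Ccont_ext (f g : R -> C) (u : R) : (forall v, f v = g v) -> Ccont f u -> Ccont g u.
Proof.
  intros E H eps He. destruct (H eps He) as (d & Hd & HH). exists d. split; auto.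
  intros v Hv. rewrite <- !E. auto.
Qed.

Lemma Ccont_const (c : C) (u : R) : Ccont (fun _ => c) u.
Proof.
  intros eps He. exists 1. split; [lra|]. intros v _.
  replace (c - c)%C with (RtoC 0) by ring. rewrite Cmod_0. lra.
Qed.

Lemma Ccont_Cexp (f : R -> C) (u : R) : Ccont f u -> Ccont (fun u => Cexp (f u)) u.
Proof.
  intros Hf eps He. set (A := Cmod (Cexp (f u))). assert (HA : 0 <= A) by apply Cmod_ge_0.
  pose proof (exp_pos 1) as P1.
  set (c := A * (2 * exp 1) + 1). assert (Hc : 0 < c) by (unfold c; nra).
  set (e := Rmin 1 (eps / c)).
  assert (He0 : 0 < eps / c) by (apply Rdiv_lt_0_compat; lra).
  assert (Hep : 0 < e) by (apply Rmin_pos; lra).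
  assert (He1 : e <= 1) by apply Rmin_l. assert (He2 : e <= eps / c) by apply Rmin_r.
  assert (He3 : c * e <= eps).
  { apply Rmult_le_compat_l with (r := c) in He2; [|lra].
    replace (c * (eps / c)) with eps in He2 by (field; lra). exact He2. }
  destruct (Hf e Hep) as (d & Hd & HH). exists d. split; auto. intros v Hv. specialize (HH v Hv).
  replace (Cexp (f v) - Cexp (f u))%C with (Cexp (f u) * (Cexp (f v - f u) - 1))%C.
  2:{ assert (E : Cexp (f v) = (Cexp (f u) * Cexp (f v - f u))%C)
        by (rewrite <- Cexp_plus; f_equal; ring). rewrite E. ring. }
  rewrite Cmod_mult. fold A.
  assert (H1 : Cmod (Cexp (f v - f u) - 1)%C <= 2 * exp 1 * e).
  { eapply Rle_trans; [apply Cexp_minus_1_le|].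
    replace (2 * exp 1 * e) with (2 * (e * exp 1)) by ring.
    apply Rmult_le_compat_l; [lra|].
    apply Rmult_le_compat; auto using Cmod_ge_0; [apply Rlt_le, exp_pos|]. apply exp_le. lra. }
  apply Rmult_le_compat_l with (r := A) in H1; auto. unfold c in *. nra.
Qed.

(** Obtained from the bound of the increment series, which makes [logGamma] locally Lipschitz along
    a vertical line in the right half-plane. *)
Lemma Ccont_logGamma (p y : R) : 0 < p -> Ccont (fun y => logGamma (p, y)) y.
Proof.
  intros Hp. set (w := (p, y) : C). set (Z := Series (fun n => / INR (S n) ^ 2)).
  assert (HZ : 0 <= Z).
  { apply Series_nonneg; [|apply ex_series_inv_sqr]. intros n. apply Rlt_le, Rinv_0_lt_compat.
    apply pow_lt. pose proof (INR_S_ge_1 n). lra. }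
  assert (Hw0 := proj1 (Cmod_gt_0 w) (Re_pos_neq_0 w Hp)).
  assert (Hwp : p <= Cmod w) by (eapply Rle_trans; [|apply re_le_Cmod]; apply Rle_abs).
  apply Ccont_lipschitz with (r := Rmin 1 (p / 2))
    (K := Rabs euler_gamma + 3 * / Cmod w + 2 * ((Cmod w + 4) * Z)).
  { apply Rmin_pos; lra. }
  intros v Hv. set (h := (0, v - y) : C).
  assert (Hh : Cmod h = Rabs (v - y)).
  { replace h with (Ci * RtoC (v - y))%C by (apply C_eq; unfold h, Re, Im; simpl; ring).
    rewrite Cmod_mult, Cmod_Ci, Cmod_R. ring. }
  assert (Hh1 := Rle_trans _ _ _ Hv (Rmin_l _ _)). assert (Hh2 := Rle_trans _ _ _ Hv (Rmin_r _ _)).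
  rewrite <- Hh in *.
  replace ((p, v) : C) with (w + h)%C by (apply C_eq; unfold w, h, Re, Im; simpl; ring).
  destruct (logGamma_increment w h Hp) as (L & _ & E & HL).
  { intros k. eapply Rle_trans; [|apply re_le_Cmod]. rewrite Cplus_RtoC_Re.
    pose proof (pos_INR k). simpl. rewrite Rabs_right; lra. }
  fold w. rewrite E. eapply Rle_trans; [apply Cmod_triangle|].
  eapply Rle_trans; [apply Rplus_le_compat_r, Cmod_minus_le|].
  rewrite Cmod_mult, Cmod_opp, Cmod_R.
  pose proof (Cmod_ge_0 h) as Hh0.
  assert (Nw : w <> 0) by (apply Re_pos_neq_0; auto).
  assert (Hz : Cmod (h / w)%C = Cmod h * / Cmod w) by (rewrite Cmod_div; auto).
  assert (Hz2 : Cmod (h / w)%C <= / 2).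
  { rewrite Hz. apply Rmult_le_reg_r with (Cmod w); auto. rewrite Rmult_assoc, Rinv_l by lra. lra. }
  assert (HC : Cmod (Clog (1 + h / w)) <= 3 * (Cmod h * / Cmod w)).
  { replace (Clog (1 + h / w)) with ((Clog (1 + h / w) - h / w) + h / w)%C by ring.
    eapply Rle_trans; [apply Cmod_triangle|]. assert (D := Clog_1p_linear_small _ Hz2).
    rewrite <- Hz. pose proof (Cmod_ge_0 (h / w)%C). nra. }
  fold Z in HL.
  assert (HD : Cmod h * (Cmod w + 4 * Cmod h) * Z <= Cmod h * (Cmod w + 4) * Z).
  { apply Rmult_le_compat_r; auto. apply Rmult_le_compat_l; lra. }
  lra.
Qed.

Lemma RStheta_quarter_line (tau : R) : RStheta (tau, (- (1 / 4))%R) =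
  ((logGamma ((3 / 8)%R, (tau / 2)%R) - logGamma ((1 / 8)%R, (- (tau / 2))%R)) / (2 * Ci)
   - (tau, (- (1 / 4))%R) * RtoC (ln PI / 2))%C.
Proof.
  unfold RStheta. do 2 f_equal. f_equal; f_equal; apply C_eq; unfold Re, Im; simpl; field.
Qed.

(** Needed on the whole line, outside the range of the Taylor expansion, so it rests on the
    continuity of [logGamma]. Zeta is handled as a locally uniform limit, and its pole is excluded
    by Re s = 3/4. *)
Lemma Ccont_U_integrand (t u : R) : Ccont (fun u => U_integrand t (u, (- (1 / 4))%R)) u.
Proof.
  unfold U_integrand. apply Ccont_mult; [apply Ccont_mult|].
  - apply Ccont_Cexp, Ccont_mult; [apply Ccont_const|]. apply Ccont_minus; [|apply Ccont_const].
    apply Ccont_ext with (fun u =>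
      ((logGamma ((3 / 8)%R, (t / 2 + / 2 * u)%R) - logGamma ((1 / 8)%R, (- (t / 2) + - / 2 * u)%R)) * / (2 * Ci)
       - ((t + 1 * u)%R, (- (1 / 4))%R) * RtoC (ln PI / 2))%C).
    { intros v. replace (RtoC t + (v, (- (1 / 4))%R))%C with (((t + v)%R, (- (1 / 4))%R) : C)
        by (apply C_eq; unfold Re, Im; simpl; ring).
      rewrite RStheta_quarter_line. unfold Cdiv.
      replace (t / 2 + / 2 * v) with ((t + v) / 2) by field.
      replace (- (t / 2) + - / 2 * v) with (- ((t + v) / 2)) by field.
      replace (t + 1 * v) with (t + v) by ring. reflexivity. }
    apply Ccont_minus.
    + apply Ccont_mult; [|apply Ccont_const]. apply Ccont_minus.
      * apply (Ccont_affine (fun y => logGamma ((3 / 8)%R, y))), Ccont_logGamma. lra.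
      * apply (Ccont_affine (fun y => logGamma ((1 / 8)%R, y))), Ccont_logGamma. lra.
    + apply Ccont_mult; [|apply Ccont_const].
      apply (Ccont_affine (fun y => (y, (- (1 / 4))%R))).
      apply (Hol_Ccont (fun z => z) (fun _ => RtoC 1)), Hol_id.
  - apply Ccont_uniform_limit with (d := 1); [lra|]. intros eps He.
    destruct (zeta_part_uniform t (1 + (Rabs (t + u) + 1)) eps) as [N HN]; auto.
    { pose proof (Rabs_pos (t + u)). lra. }
    assert (Hn1 : forall v, zeta_arg t (v, (- (1 / 4))%R) <> 1).
    { intros v E. apply (f_equal Re) in E. rewrite Re_zeta_arg in E. simpl in E. lra. }
    exists (fun v => zeta_part t N (v, (- (1 / 4))%R)). split.
    + destruct (HolOn_zeta_part (fun x => zeta_arg t x <> 1) t N) as [f' Hf']; [auto|].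
      apply (Hol_Ccont _ f'). apply Hf', Hn1.
    + intros v Hv. apply HN; auto.
      * rewrite Re_zeta_arg. simpl. lra.
      * apply Cmod_le_parts; [rewrite Re_zeta_arg; simpl; apply Rabs_le_between; lra|].
        rewrite Im_zeta_arg. simpl. replace (t + v) with ((t + u) + (v - u)) by ring.
        eapply Rle_trans; [apply Rabs_triang|]. lra.
  - destruct (HolOn_kernel (Rabs u)) as [f' Hf']. apply (Hol_Ccont _ f'). apply Hf'.
    split; simpl; lra.
Qed.

Lemma square_exp_le (v : R) : 0 <= v -> (1 + v) ^ 2 * exp (- (3 / 2 * v)) <= 16 * exp (- v).
Proof.
  intros Hv. assert (H : 1 + v <= 4 * exp (v / 4)).
  { assert (1 + v / 4 <= exp (v / 4)).
    { destruct (Req_dec (v / 4) 0) as [E|E]; [rewrite E, exp_0; lra | left; apply exp_ineq1; auto]. }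
    lra. }
  apply Rle_trans with ((4 * exp (v / 4)) ^ 2 * exp (- (3 / 2 * v))).
  - apply Rmult_le_compat_r; [apply Rlt_le, exp_pos|]. apply pow_incr. lra.
  - right. replace ((4 * exp (v / 4)) ^ 2) with (16 * (exp (v / 4) * exp (v / 4))) by ring.
    rewrite Rmult_assoc. f_equal. rewrite <- !exp_plus. f_equal. field.
Qed.

(** Phase and zeta each grow like 1 + |t + u| <= 2 t (1 + |u|). The square of 1 + |u| is absorbed by
    the kernel, leaving t^2. *)
Lemma U_integrand_line_le : exists K, 0 < K /\ forall t u, 1 <= t ->
  Cmod (U_integrand t (u, (- (1 / 4))%R)) <= K * t ^ 2 * exp (- Rabs u).
Proof.
  destruct Cmod_Cexp_theta_line as (A & HA & HB).
  assert (Hm : 0 < sin (PI / 2 * (1 / 4))).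
  { pose proof PI_RGT_0. apply sin_gt_0; lra. }
  set (m := sin (PI / 2 * (1 / 4))) in *.
  assert (KP := kernel_const_pos m Hm).
  (* 28 = 4 + 24 bounds zeta at real part 3/4, 4 is the square of the factor 2 in 2 t (1 + |u|), and
     16 comes from [square_exp_le]. *)
  exists (A * 28 * kernel_const m * 4 * 16). split.
  { repeat (apply Rmult_lt_0_compat; [|lra]). lra. }
  intros t u Ht. unfold U_integrand.
  replace (RtoC t + (u, (- (1 / 4))%R))%C with (((t + u)%R, (- (1 / 4))%R) : C)
    by (apply C_eq; unfold Re, Im; simpl; ring).
  assert (H1 := HB t (t + u)).
  assert (H2 : Cmod (zeta_shift t (u, (- (1 / 4))%R)) <= 28 * (1 + Rabs (t + u))).
  { change (zeta_shift t (u, (- (1 / 4))%R)) with (zeta (zeta_arg t (u, (- (1 / 4))%R))).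
    set (s := zeta_arg t (u, (- (1 / 4))%R)).
    assert (ER : Re s = 3 / 4) by (unfold s; rewrite Re_zeta_arg; simpl; field).
    assert (EI : Im s = t + u) by (unfold s; rewrite Im_zeta_arg; reflexivity).
    assert (N1 : s <> 1) by (intros E; rewrite E in ER; simpl in ER; lra).
    eapply Rle_trans; [apply zeta_le; auto; lra|].
    assert (G1 : / 4 <= Cmod (s - 1)%C).
    { eapply Rle_trans; [|apply re_le_Cmod]. change (Re (s - 1)%C) with (Re s - 1). rewrite ER.
      rewrite Rabs_left; lra. }
    assert (G2 : / Cmod (s - 1)%C <= 4).
    { replace 4 with (/ / 4) by field. apply Rinv_le_contravar; lra. }
    assert (G3 : Cmod s <= 1 + Rabs (t + u)).
    { apply Cmod_le_parts; [rewrite ER, Rabs_right; lra | rewrite EI; lra]. }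
    pose proof (Rabs_pos (t + u)). lra. }
  assert (H3 := kernel_le_const m u (1 / 4) Hm ltac:(lra) (Rle_refl _)).
  eapply Rle_trans; [apply (Cmod_mult3_le _ _ _ _ _ _ H1 H2 H3)|].
  pose proof (Rabs_pos u) as Hu.
  assert (H4 : 0 <= 1 + Rabs (t + u) <= 2 * t * (1 + Rabs u)).
  { split; [pose proof (Rabs_pos (t + u)); lra|].
    pose proof (Rabs_triang t u). rewrite (Rabs_right t) in H by lra. nra. }
  assert (H5 := square_exp_le (Rabs u) Hu).
  pose proof (exp_pos (- (3 / 2 * Rabs u))) as HE.
  apply Rle_trans with (A * 28 * kernel_const m * ((1 + Rabs (t + u)) ^ 2 * exp (- (3 / 2 * Rabs u)))); [right; ring|].
  replace (A * 28 * kernel_const m * 4 * 16 * t ^ 2 * exp (- Rabs u))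
    with (A * 28 * kernel_const m * (4 * t ^ 2 * (16 * exp (- Rabs u)))) by ring.
  apply Rmult_le_compat_l; [repeat (apply Rmult_le_pos; [|lra]); lra|].
  apply Rle_trans with ((2 * t * (1 + Rabs u)) ^ 2 * exp (- (3 / 2 * Rabs u))).
  - apply Rmult_le_compat_r; [lra|]. apply pow_incr. lra.
  - replace ((2 * t * (1 + Rabs u)) ^ 2 * exp (- (3 / 2 * Rabs u)))
      with (4 * t ^ 2 * ((1 + Rabs u) ^ 2 * exp (- (3 / 2 * Rabs u)))) by ring.
    apply Rmult_le_compat_l; auto. nra.
Qed.

(** * Conclusion *)

Lemma shifted_point (u s : R) : (RtoC u - Ci * RtoC s)%C = (u, (- s)%R).
Proof. apply C_eq; unfold Re, Im; simpl; ring. Qed.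

Lemma U_eq (t : R) :
  U t = (@RInt_gen C_R_CompleteNormedModule (fun u => U_integrand t (u, (- (1 / 4))%R))
          (Rbar_locally m_infty) (Rbar_locally p_infty) / (RtoC (2 * PI) * Ci))%C.
Proof.
  unfold U, U_sigma. do 2 f_equal. apply functional_extensionality. intros u. cbv zeta.
  rewrite shifted_point. reflexivity.
Qed.

Lemma V_approx_eq (s b t : R) :
  V_approx s b t = (CInt (fun u => V_integrand t (u, (- s)%R)) (- b) b / (RtoC (2 * PI) * Ci))%C.
Proof.
  unfold V_approx, CInt. do 2 f_equal. apply functional_extensionality. intros u. cbv zeta.
  rewrite shifted_point, dtheta_eq, d2theta_eq. reflexivity.
Qed.

(** With r = t^(1/4) one has ln t <= 4 r, so C ln t + 3 <= (4 C + 3) r <= r^2 as soon as r >= 4 C +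
    3; squaring gives t. *)
Lemma regime_eventually (C : R) : 0 <= C -> exists T, forall t, T <= t -> regime (C * ln t) t.
Proof.
  intros HC. exists ((4 * C + 3) ^ 4). intros t Ht.
  assert (H0 : 81 <= (4 * C + 3) ^ 4).
  { replace 81 with (3 ^ 4) by ring. apply pow_incr. lra. }
  set (r := sqrt (sqrt t)).
  assert (Hr1 : r * r = sqrt t) by (apply sqrt_sqrt, sqrt_pos).
  assert (Hr2 : sqrt t * sqrt t = t) by (apply sqrt_sqrt; lra).
  assert (Hr0 : 0 <= r) by apply sqrt_pos.
  assert (Hr4 : r ^ 4 = t) by (rewrite <- Hr2, <- Hr1; ring).
  assert (Hr : 4 * C + 3 <= r).
  { destruct (Rle_dec (4 * C + 3) r) as [H|H]; auto. exfalso.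
    assert (Hlt : r < 4 * C + 3) by lra.
    assert (r ^ 2 < (4 * C + 3) ^ 2) by nra.
    assert (0 <= r ^ 2) by nra.
    assert (r ^ 4 < (4 * C + 3) ^ 4).
    { replace (r ^ 4) with (r ^ 2 * r ^ 2) by ring.
      replace ((4 * C + 3) ^ 4) with ((4 * C + 3) ^ 2 * (4 * C + 3) ^ 2) by ring. nra. }
    lra. }
  assert (Hln : ln t <= 4 * r).
  { rewrite <- Hr4, ln_pow by lra. simpl INR. pose proof (ln_le_minus_1 r ltac:(lra)). lra. }
  assert (Hln0 : 0 <= ln t) by (rewrite <- ln_1; apply Rcomplements.ln_le; lra).
  assert (Hb : 0 <= C * ln t) by (apply Rmult_le_pos; auto).
  repeat split; auto; [lra|].
  assert (C * ln t <= C * (4 * r)) by (apply Rmult_le_compat_l; auto).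
  assert (C * ln t + 3 <= r ^ 2) by nra.
  replace t with (r ^ 2 * r ^ 2) at 2 by (rewrite <- Hr4; ring).
  replace ((C * ln t + 3) ^ 2) with ((C * ln t + 3) * (C * ln t + 3)) by ring.
  apply Rmult_le_compat; lra.
Qed.

(** Here C >= 4 enters: t^2 t^(-C) <= t^(-2), below t^(-7/4). *)
Lemma side_decay (C eps t : R) : 4 <= C -> 0 < eps -> 1 <= t ->
  t ^ 2 * exp (- (C * ln t)) <= Rpower t (- 7 / 4 + eps).
Proof.
  intros HC He Ht. replace (exp (- (C * ln t))) with (Rpower t (- C)) by (unfold Rpower; f_equal; ring).
  rewrite <- (Rpower_pow 2 t), <- Rpower_plus by lra. apply Rle_Rpower; auto. simpl. lra.
Qed.

Theorem mainTheorem4 :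
  forall eps sigma0 : R, 0 < eps < 1 -> 0 < sigma0 < 2 ->
  exists C0 : R, 0 < C0 /\
  forall C : R, C0 <= C ->
  exists K T : R,
    forall t : R, T <= t ->
      Cmod (Cminus (U t) (V_approx sigma0 (C * ln t) t))
        <= K * Rpower t (- 7 / 4 + eps).
Proof.
  intros eps sigma0 Heps Hs0. exists 4. split; [lra|]. intros C HC.
  (* The height at which the integrands are compared; it stays below 3/2 because eps < 1. *)
  set (s1 := / 2 + eps).
  (* The closed range a1 <= s <= a2 contains the three heights 1/4, [s1] and [sigma0], and stays
     away from both poles of the kernel. *)
  set (a1 := Rmin (1 / 4) sigma0). set (a2 := Rmax sigma0 s1).
  assert (Ha1 : 0 < a1) by (apply Rmin_pos; lra).
  assert (Ha2 : a2 < 2) by (apply Rmax_lub_lt; unfold s1; lra).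
  assert (I1 : a1 <= 1 / 4) by apply Rmin_l. assert (I2 : a1 <= sigma0) by apply Rmin_r.
  assert (I3 : sigma0 <= a2) by apply Rmax_l. assert (I4 : s1 <= a2) by apply Rmax_r.
  assert (I5 : 1 / 4 <= s1) by (unfold s1; lra).
  destruct (sin_half_ge a1 a2 Ha1 Ha2) as (m & Hm & HM).
  destruct U_integrand_line_le as (K1 & HK1 & HU).
  destruct (regime_eventually C ltac:(lra)) as (T & HT).
  set (K2 := phase_const * exp 20 * 60 * kernel_const m).
  set (K3 := phase_const * (2 * (20 * 1728) * exp 20) * (1 + 2 * / eps) * kernel_const m).
  assert (PP := phase_const_pos). assert (KP := kernel_const_pos m Hm). pose proof (exp_pos 20) as P20.
  assert (Hie : 0 < / eps) by (apply Rinv_0_lt_compat; lra).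
  assert (HK2 : 0 <= K2) by (unfold K2; repeat (apply Rmult_le_pos; [|lra]); lra).
  assert (HK3 : 0 <= K3) by (unfold K3; repeat (apply Rmult_le_pos; [|lra]); lra).
  (* 2 K1 pays for cutting [U], 8 K2 for each of the two contour shifts, and 2 K3 for the comparison
     at height [s1]. The factor 1 / (2 PI) is simply bounded by 1. *)
  exists (2 * K1 + 16 * K2 + 2 * K3), T. intros t Ht.
  assert (Hr := HT t Ht). set (b := C * ln t) in *.
  assert (Ht16 : 16 <= t) by apply Hr. assert (Hb : 0 <= b) by apply Hr.
  set (R0 := Rpower t (- 7 / 4 + eps)).
  assert (HR0 : t ^ 2 * exp (- b) <= R0) by (apply side_decay; lra).
  assert (HR1 : Rpower t (- 7 / 4 + eps / 2) <= R0) by (apply Rle_Rpower; lra).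
  assert (HR2 : 0 < Rpower t (- 7 / 4 + eps / 2)) by apply exp_pos.
  assert (Ht2 : 0 <= t ^ 2) by apply pow2_ge_0.
  rewrite U_eq, V_approx_eq.
  set (J := @RInt_gen _ _ _ _).
  set (JU := fun s => CInt (fun u => U_integrand t (u, (- s)%R)) (- b) b).
  set (JV := fun s => CInt (fun u => V_integrand t (u, (- s)%R)) (- b) b).
  fold (JV sigma0).
  assert (D1 : Cmod (J - JU (1 / 4)%R)%C <= 2 * K1 * R0).
  { eapply Rle_trans.
    - apply (CInt_gen_tail (fun u => U_integrand t (u, (- (1 / 4))%R)) (K1 * t ^ 2) b); auto.
      + apply Rmult_le_pos; lra.
      + intros u. apply Ccont_U_integrand.
      + intros u. apply HU. lra.
    - replace (2 * (K1 * t ^ 2) * exp (- b)) with (2 * K1 * (t ^ 2 * exp (- b))) by ring.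
      apply Rmult_le_compat_l; lra. }
  assert (Hside : forall s, a1 <= s <= a2 -> forall u, Rabs u = b ->
    Cmod (V_integrand t (u, (- s)%R)) <= K2 * R0 /\ Cmod (U_integrand t (u, (- s)%R)) <= K2 * R0).
  { intros s Hs u Hu.
    assert (Hx : strip b (u, (- s)%R)) by (split; simpl; lra).
    destruct (integrands_le b t m u s Hr Hx Hm (HM s Hs)) as [B1 B2]. fold K2 in B1, B2. rewrite Hu in B1, B2.
    assert (K2 * t ^ 2 * exp (- b) <= K2 * R0)
      by (rewrite Rmult_assoc; apply Rmult_le_compat_l; auto).
    lra. }
  assert (Hab : Rabs b = b) by (apply Rabs_right; lra).
  assert (Hab' : Rabs (- b) = b) by (rewrite Rabs_Ropp; auto).
  assert (D2 : Cmod (JU (1 / 4)%R - JU s1)%C <= 8 * (K2 * R0)).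
  { refine (Hol_limit_horizontal_integral (U_integrand t) b a1 a2 (K2 * R0) Hb Ha1 Ha2
      (U_integrand_limit b t a1 a2 Hr Ha1 Ha2) _ (1 / 4) s1 _ _); try (split; lra).
    intros s Hs. exact (conj (proj2 (Hside s Hs b Hab)) (proj2 (Hside s Hs (- b) Hab'))). }
  assert (D3 : Cmod (JV s1 - JV sigma0)%C <= 8 * (K2 * R0)).
  { refine (Hol_limit_horizontal_integral (V_integrand t) b a1 a2 (K2 * R0) Hb Ha1 Ha2
      (V_integrand_limit b t a1 a2 Hr Ha1 Ha2) _ s1 sigma0 _ _); try (split; lra).
    intros s Hs. exact (conj (proj1 (Hside s Hs b Hab)) (proj1 (Hside s Hs (- b) Hab'))). }
  assert (D4 : Cmod (JU s1 - JV s1)%C <= 2 * (K3 * R0)).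
  { assert (Hin : forall u, - b <= u <= b -> Rabs u < b + 1) by (intros; apply Rabs_lt_between; lra).
    assert (CU : forall u, - b <= u <= b -> Ccont (fun u => U_integrand t (u, (- s1)%R)) u).
    { intros u Hu. apply (Hol_limit_Ccont _ b a1 a2); auto; [apply U_integrand_limit; auto | lra]. }
    assert (CV : forall u, - b <= u <= b -> Ccont (fun u => V_integrand t (u, (- s1)%R)) u).
    { intros u Hu. apply (Hol_limit_Ccont _ b a1 a2); auto; [apply V_integrand_limit; auto | lra]. }
    unfold JU, JV. rewrite CInt_minus by (auto; lra).
    apply Rle_trans with (2 * (K3 * Rpower t (- 7 / 4 + eps / 2))).
    - apply CInt_sym_le; auto.
      + apply Rmult_le_pos; lra.
      + intros u Hu. apply Ccont_minus; auto.
      + intros u Hu. apply (integrand_diff_le eps b t m u); auto. apply HM. fold s1. lra.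
    - apply Rmult_le_compat_l; [lra|]. apply Rmult_le_compat_l; auto. }
  assert (N : (RtoC (2 * PI) * Ci)%C <> 0).
  { apply Cmult_neq_0; [apply RtoC_neq_0; pose proof PI_RGT_0; lra|].
    intros X. apply (f_equal Im) in X. simpl in X. lra. }
  (* The chain runs from the full line to the segment at height 1/4, then to [s1], from the exact to
     the quadratic phase, and finally to [sigma0]. *)
  replace (J / (RtoC (2 * PI) * Ci) - JV sigma0 / (RtoC (2 * PI) * Ci))%C
    with (((J - JU (1 / 4)%R) + (JU (1 / 4)%R - JU s1) + (JU s1 - JV s1) + (JV s1 - JV sigma0)) / (RtoC (2 * PI) * Ci))%C
    by (unfold Cdiv; ring).
  rewrite Cmod_div, Cmod_mult, Cmod_Ci, Cmod_R, Rmult_1_r by auto.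
  assert (HPI : 1 <= Rabs (2 * PI)).
  { pose proof PI2_3_2. rewrite Rabs_right; lra. }
  set (S := (_ + _)%C).
  assert (HS : Cmod S <= (2 * K1 + 16 * K2 + 2 * K3) * R0).
  { unfold S. eapply Rle_trans; [apply Cmod_triangle|].
    eapply Rle_trans; [apply Rplus_le_compat_r, Cmod_triangle|].
    eapply Rle_trans; [do 2 apply Rplus_le_compat_r; apply Cmod_triangle|].
    lra. }
  eapply Rle_trans; [|exact HS].
  rewrite <- (Rmult_1_r (Cmod S)) at 2. apply Rmult_le_compat_l; [apply Cmod_ge_0|].
  apply Rle_trans with (/ 1); [apply Rinv_le_contravar; lra | lra].
Qed.
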